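(* Let $H$ be a semisimple Hopf algebra over $k$, let $G$ be a finite group, and fix a $G$-grading $\mathcal{C}=\bigoplus_{g\in G}\mathcal{C}_g$ of the fusion category $\mathcal{C}=\mathrm{Rep}(H^* )$. Let $M$ and $N$ be any two subgroups of $G$. Then $(H(M),H(N))$ is a Mackey pair of Hopf subalgebras of $H$.
   Context: $k$ is an algebraically closed field of characteristic zero; $H$ is a semisimple (hence finite dimensional and cosemisimple) Hopf algebra over $k$ with counit $\epsilon$. For subspaces $X,Y\subseteq H$, $XY$ denotes the linear span of all products $xy$. Irreducible characters of $H^*$ are viewed as elements of $H$; they correspond bijectively to simple subcoalgebras: a simple subcoalgebra $C$ with comatrix basis $(x_{ij})$, $\Delta(x_{ij})=\sum_l x_{il}\otimes x_{lj}$, corresponds to $c=\sum_i x_{ii}$; one writes $C=C_c$. $\mathrm{Irr}(H^* )$ is the set of these characters. $\Lambda_K\in K$ is the integral of a Hopf subalgebra $K$ with $\epsilon(\Lambda_K)=1$. Grading: a $G$-grading on $\mathrm{Rep}(H^* )$ is a function $\deg:\mathrm{Irr}(H^* )\to G$ such that $\deg(z)=\deg(x)\deg(y)$ whenever $z$ is a constituent of the product $xy$; $\mathcal{C}_g$ is the full abelian subcategory generated by the simple objects of degree $g$. For a subset $M\subseteq G$ put $H(M):=\bigoplus_{d\in\mathrm{Irr}(H^* ),\ \deg(d)\in M}C_d$; if $M$ is a subgroup this is a Hopf subalgebra of $H$. Double cosets: for Hopf subalgebras $L,K$ of $H$, the relation $C\sim D$ iff $C\subseteq LDK$ is an equivalence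 relation on simple subcoalgebras of $H$, with $C\sim D$ iff $LCK=LDK$. A sum over $C\in L\backslash H/K$ runs over one representative simple subcoalgebra $C$ per equivalence class. Conjugate Hopf subalgebra: for a simple subcoalgebra $C$ with character $c$, ${}^CK:=\bigoplus_{d}C_d$, the sum over all $d\in\mathrm{Irr}(H^* )$ with $dc\Lambda_K=\epsilon(d)c\Lambda_K$. It is a Hopf subalgebra of $H$, and $CK$ is stable under left multiplication by ${}^CK$; for a left $K$-module $V$, ${}^CV:=CK\otimes_KV$ is a left ${}^CK$-module. Mackey pair: $(L,K)$ is a Mackey pair if for every finite dimensional left $K$-module $V$ the (always surjective) $L$-module map $\bigoplus_{C\in L\backslash H/K}L\otimes_{L\cap{}^CK}{}^CV\to (H\otimes_KV)\downarrow^H_L$, $l\otimes(x\otimes_Kv)\mapsto lx\otimes_Kv$, is an isomorphism. *)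

(* Defs.v *)
From HB Require Import structures.
From mathcomp Require Import all_boot all_order all_algebra all_fingroup.
From mathcomp Require Import all_field.
From mathcomp Require Import boolp classical_sets.

Set Implicit Arguments.
Unset Strict Implicit.
Unset Printing Implicit Defensive.

Import GRing.Theory.

Local Open Scope ring_scope.
Local Open Scope classical_set_scope.

Section Span.
Variables (k : fieldType) (V : vectType k).
Implicit Types (P : set V) (U W : {vspace V}).

Definition is_span P W :=
  (forall v, P v -> v \in W) /\
  (forall U, (forall v, P v -> v \in U) -> (W <= U)%VS).

(* the linear span of an arbitrary, possibly infinite, set of vectors *)
Definition spanP P : {vspace V} := xget 0%VS [set W | is_span P W].

Lemma spanP_is_span P : is_span P (spanP P).
Proof.
apply: (@xgetPex _ 0%VS [set W | is_span P W]).
pose Q n := `[< exists2 s : seq V, (forall v, v \in s -> P v) &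
                 \dim (span s) = n >].
have exQ : exists n, Q n.
  by exists 0%N; apply/asboolP; exists [::] => //; rewrite span_nil dimv0.
have ubQ n : Q n -> (n <= \dim (fullv : {vspace V}))%N.
  by move=> /asboolP[s _ <-]; apply/dimvS/subvf.
case: (ex_maxnP exQ ubQ) => n /asboolP[s sP dims] maxn.
exists (span s); split=> [v Pv|U PU]; last by apply/span_subvP => v /sP /PU.
have /maxn le_n : Q (\dim (span (v :: s))).
  apply/asboolP; exists (v :: s) => // w; rewrite inE.
  by case/orP => [/eqP->|/sP].
have sub : (span s <= span (v :: s))%VS.
  by apply: sub_span => w ws; rewrite inE ws orbT.
have /eqP -> : span s == span (v :: s) by rewrite eqEdim sub dims.
by apply: memv_span; rewrite mem_head.
Qed.

Lemma mem_spanP P v : P v -> v \in spanP P.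
Proof. exact: (spanP_is_span P).1. Qed.

Lemma spanP_sub P U : (forall v, P v -> v \in U) -> (spanP P <= U)%VS.
Proof. exact: (spanP_is_span P).2. Qed.

End Span.

Section Tensor.
Variables (k : fieldType).
Implicit Types U V W : vectType k.

Definition dimT V := \dim (fullv : {vspace V}).

(* In the coordinates of fixed bases, U (x) V is a space of matrices. *)
Definition tensor U V : vectType k := 'M[k]_(dimT U, dimT V).

Definition bvec V (i : 'I_(dimT V)) : V := (vbasis (fullv : {vspace V}))`_i.

Definition bcoord V (v : V) (i : 'I_(dimT V)) : k := coord (vbasis fullv) i v.

Definition tens U V (u : U) (v : V) : tensor U V :=
  \matrix_(i, j) (bcoord u i * bcoord v j).

Definition bilin U V W (b : U -> V -> W) :=
  (forall v, linear (b^~ v)) /\ (forall u, linear (b u)).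

(* the linear map U (x) V -> W extending a bilinear map b, see tliftE *)
Definition tlift U V W (b : U -> V -> W) (t : tensor U V) : W :=
  \sum_i \sum_j (t : 'M_(_, _)) i j *: b (bvec i) (bvec j).

Lemma tlift_is_linear U V W (b : U -> V -> W) : linear (tlift b).
Proof.
move=> a s t; rewrite /tlift scaler_sumr -big_split; apply: eq_bigr => i _ /=.
rewrite scaler_sumr -big_split; apply: eq_bigr => j _ /=.
by rewrite !mxE scalerDl scalerA.
Qed.

HB.instance Definition _ U V W (b : U -> V -> W) :=
  GRing.isLinear.Build k (tensor U V) W *:%R (tlift b) (tlift_is_linear b).

Lemma linear_sumZ U W (f : U -> W) (n : nat) (a : 'I_n -> k) (u : 'I_n -> U) :
  linear f -> f (\sum_i a i *: u i) = \sum_i a i *: f (u i).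
Proof.
move=> lf.
pose g : {linear U -> W} :=
  HB.pack f (GRing.isLinear.Build k U W *:%R f lf).
rewrite -[f _]/(g _) linear_sum.
by apply: eq_bigr => i _; rewrite linearZ.
Qed.

Lemma bcoord_sum V (v : V) : v = \sum_i bcoord v i *: bvec i.
Proof. exact: coord_vbasis (memvf v). Qed.

Lemma tliftE U V W (b : U -> V -> W) u v :
  bilin b -> tlift b (tens u v) = b u v.
Proof.
move=> [bl br]; rewrite [in RHS](bcoord_sum u).
rewrite (linear_sumZ _ _ (bl v)); apply: eq_bigr => i _.
rewrite [in RHS](bcoord_sum v) (linear_sumZ _ _ (br _)) scaler_sumr.
by apply: eq_bigr => j _; rewrite scalerA mxE.
Qed.

Lemma tens_bilin U V : bilin (@tens U V).
Proof.
split=> [v a x y|u a x y]; apply/matrixP => i j; rewrite !mxE /bcoord linearP /=.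
  by rewrite mulrDl mulrA.
by rewrite mulrDr mulrCA.
Qed.

Lemma tensor_sum U V (t : tensor U V) :
  t = \sum_i \sum_j (t : 'M_(_, _)) i j *: tens (bvec i) (bvec j).
Proof.
have bvecE W (i j : 'I_(dimT W)) : bcoord (bvec i) j = (i == j)%:R.
  by rewrite /bcoord /bvec coord_free ?(basis_free (vbasisP _)) // eq_sym.
apply/matrixP => i0 j0; rewrite summxE (bigD1 i0) //= summxE (bigD1 j0) //=.
rewrite !big1 ?addr0 => [|i /negPf ni|j /negPf nj].
- by rewrite !mxE !bvecE !eqxx !mulr1.
- by rewrite summxE big1 // => j _; rewrite !mxE !bvecE ni mul0r mulr0.
- by rewrite !mxE !bvecE nj !mulr0.
Qed.

End Tensor.

Section BalancedTensor.
Variables (k : fieldType) (A : Type) (X V : vectType k).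
Variables (ra : X -> A -> X) (la : A -> V -> V).

Definition bal_rel : {vspace tensor X V} :=
  spanP [set t | exists x a v, t = tens (ra x a) v - tens x (la a v)].

(* X (x)_A V, for a right action ra and a left action la of A; the quotient  *)
(* of X (x) V by the balancing relations is realised on a linear complement. *)
Definition btensor : vectType k := subvs_of (bal_rel^C)%VS.

Definition bproj (t : tensor X V) : btensor :=
  vsproj _ (daddv_pi (bal_rel^C)%VS bal_rel t).

Definition btens (x : X) (v : V) : btensor := bproj (tens x v).

(* the linear map X (x)_A V -> W induced by a balanced bilinear map, see     *)
(* btliftE                                                                   *)
Definition btlift (W : vectType k) (b : X -> V -> W) (q : btensor) : W :=
  tlift b (vsval q).

Lemma bproj_rel t : t - vsval (bproj t) \in bal_rel.
Proof.
rewrite /bproj vsprojK ?memv_pi //.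
have dx : ((bal_rel^C :&: bal_rel) = 0)%VS by rewrite capvC capv_compl.
rewrite -{1}[t](daddv_pi_add dx) ?[(bal_rel^C + _)%VS]addvC ?addv_complf ?memvf //.
by rewrite addrC addKr memv_pi.
Qed.

Lemma bproj_eq0 t : (bproj t == 0) = (t \in bal_rel).
Proof.
have rel := bproj_rel t; apply/eqP/idP => [e|tr].
  by rewrite e (raddf0 (@vsval _ _ _)) subr0 in rel.
apply: val_inj; apply/eqP; rewrite /= -memv0 -(capv_compl bal_rel) memv_cap subvsP andbT.
by rewrite -[vsval _](subKr t) rpredB.
Qed.

Lemma btliftE (W : vectType k) (b : X -> V -> W) x v :
  bilin b -> (forall x a v, b (ra x a) v = b x (la a v)) ->
  btlift b (btens x v) = b x v.
Proof.
move=> bb bal; rewrite /btlift -(tliftE x v bb).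
pose f : 'Hom(tensor X V, W) := linfun (tlift b).
have : (bal_rel <= lker f)%VS.
  apply: spanP_sub => _ [y [a [w ->]]].
  by rewrite memv_ker lfunE /= linearB /= !tliftE // bal subrr.
move=> /subvP/(_ _ (bproj_rel (tens x v))).
by rewrite memv_ker lfunE /= linearB subr_eq0 => /eqP.
Qed.

Lemma bproj_is_linear : linear bproj.
Proof. by move=> a s t; rewrite /bproj !linearP. Qed.

HB.instance Definition _ :=
  GRing.isLinear.Build k (tensor X V) btensor *:%R bproj bproj_is_linear.

HB.instance Definition _ (W : vectType k) (b : X -> V -> W) :=
  GRing.isLinear.Build k btensor W *:%R (btlift b)
    (fun a s t => etrans (congr1 (tlift b) (linearP (@vsval _ _ _) a s t))
                         (linearP (tlift b) a (vsval s) (vsval t))).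

Lemma btens_bal x a v : btens (ra x a) v = btens x (la a v).
Proof.
apply/eqP; rewrite -subr_eq0 -linearB /= bproj_eq0.
by apply: mem_spanP; exists x, a, v.
Qed.

Lemma btens_bilin : bilin btens.
Proof.
have [tl tr] := tens_bilin X V.
by split=> [v a x y|u a x y]; rewrite /btens ?tl ?tr linearP.
Qed.

Lemma bprojK q : bproj (vsval q) = q.
Proof.
apply/val_inj; rewrite /= /bproj vsprojK ?memv_pi //.
by rewrite daddv_pi_id ?subvsP // capvC capv_compl.
Qed.

Lemma btens_ext (W : vectType k) (f g : {linear btensor -> W}) :
  (forall x v, f (btens x v) = g (btens x v)) -> f =1 g.
Proof.
move=> fg q; rewrite -(bprojK q) (tensor_sum (vsval q)) !linear_sum.
apply: eq_bigr => i _; rewrite !linear_sum; apply: eq_bigr => j _.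
by rewrite !linearZ /= fg.
Qed.

End BalancedTensor.

HB.mixin Record Falgebra_isHopf (k : fieldType) H of Falgebra k H := {
  comul : 'Hom(H, tensor H H);
  counit : 'Hom(H, k^o);
  antipode : 'End(H);
  comul_coassoc : forall h : H,
    tlift (fun x y => tens (comul x) y) (comul h) =
    tlift (fun x y => tlift (fun y1 y2 => tens (tens x y1) y2) (comul y))
      (comul h);
  comul_counitl : forall h : H,
    tlift (fun x y => (counit x : k) *: y) (comul h) = h;
  comul_counitr : forall h : H,
    tlift (fun x y => (counit y : k) *: x) (comul h) = h;
  comul1 : comul 1 = tens 1 1;
  comulM : forall a b : H,
    comul (a * b) =
    tlift (fun a1 a2 =>
      tlift (fun b1 b2 => tens (a1 * b1) (a2 * b2)) (comul b)) (comul a);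
  counit1 : counit 1 = 1;
  counitM : forall a b : H, counit (a * b) = counit a * counit b;
  antipodel : forall h : H,
    tlift (fun x y => antipode x * y) (comul h) = (counit h : k) *: 1;
  antipoder : forall h : H,
    tlift (fun x y => x * antipode y) (comul h) = (counit h : k) *: 1
}.

#[short(type="hopfType")]
HB.structure Definition Hopf (k : fieldType) :=
  { H of Falgebra k H & Falgebra_isHopf k H }.

Section Hopf.
Variables (k : fieldType) (H : hopfType k).
Implicit Types (C D K L : {vspace H}) (c d h : H).

Definition eps h : k := counit h.

(* complete reducibility of the left regular module *)
Definition semisimple :=
  forall I : {vspace H}, (fullv * I <= I)%VS ->
  exists J : {vspace H},
    [/\ (fullv * J <= J)%VS, (I + J)%VS = fullv & (I :&: J)%VS = 0%VS].

Definition tensv C D : {vspace tensor H H} :=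
  spanP [set t | exists x y, [/\ x \in C, y \in D & t = tens x y]].

Definition subcoalg C := forall h, h \in C -> comul h \in tensv C C.

Definition simple_subcoalg C :=
  [/\ subcoalg C, C != 0%VS &
      forall D, subcoalg D -> (D <= C)%VS -> D = 0%VS \/ D = C].

Definition hopf_subalg K :=
  [/\ 1 \in K, (K * K <= K)%VS, subcoalg K & (antipode @: K <= K)%VS].

Definition comatrix_basis C n (x : 'M[H]_n) :=
  (forall i j, comul (x i j) = \sum_l tens (x i l) (x l j)) /\
  basis_of C [seq x p.1 p.2 | p : 'I_n * 'I_n].

Definition has_char C c :=
  simple_subcoalg C /\
  exists n (x : 'M[H]_n), comatrix_basis C x /\ c = \tr x.

(* The irreducible characters of the dual algebra of H, as elements of H: the *)
(* traces of the comatrix bases of the simple subcoalgebras.                 *)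
Definition irr : set H := [set c | exists C, has_char C c].

Definition coalg_of (c : irr) : {vspace H} :=
  xget 0%VS [set C | has_char C (val c)].

(* z occurs in the decomposition of chi into irreducible characters *)
Definition constituent (z : irr) (chi : H) :=
  exists s : seq irr, chi = \sum_(d <- s) val d /\ z \in s.

Definition is_grading (gT : finGroupType) (deg : irr -> gT) :=
  forall x y z : irr, constituent z (val x * val y) ->
    deg z = (deg x * deg y)%g.

Definition graded_part (gT : finGroupType) (deg : irr -> gT)
    (M : {set gT}) : {vspace H} :=
  spanP [set h | exists d : irr, deg d \in M /\ h \in coalg_of d].

Definition is_integral K (z : H) :=
  [/\ z \in K, forall a, a \in K -> a * z = eps a *: z,
      forall a, a \in K -> z * a = eps a *: z & eps z = 1].

(* the normalised two-sided integral of K *)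
Definition integral K : H := xget 0 [set z | is_integral K z].

(* the conjugate ^C K, for C = C_c *)
Definition conj_sub (c : irr) K : {vspace H} :=
  spanP [set h | exists d : irr,
    val d * val c * integral K = eps (val d) *: (val c * integral K) /\
    h \in coalg_of d].

Definition dcoset_rel L K C D := (C <= L * D * K)%VS.

(* Since c |-> C_c is bijective, simple subcoalgebras are indexed by their *)
(* characters.                                                             *)
Definition dcoset_reps L K (I : finType) (c : I -> irr) :=
  (forall d : irr, exists i, dcoset_rel L K (coalg_of d) (coalg_of (c i))) /\
  (forall i j, dcoset_rel L K (coalg_of (c i)) (coalg_of (c j)) -> i = j).

(* finite dimensional left K-modules *)
Record lmodule K := LModule {
  lmod_sort :> vectType k;
  lmod_act : 'Hom(subvs_of K, 'End(lmod_sort));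
  lmod_act1 : forall a : subvs_of K, vsval a = 1 ->
    forall v, lmod_act a v = v;
  lmod_actM : forall a b c : subvs_of K, vsval c = vsval a * vsval b ->
    forall v, lmod_act c v = lmod_act a (lmod_act b v)
}.

(* vsproj X is a retraction onto X, so these are the left and right          *)
(* multiplications X is stable under; on products outside X they are junk.   *)
Definition subv_mulr (X A : {vspace H}) (x : subvs_of X) (a : subvs_of A) :
  subvs_of X := vsproj X (vsval x * vsval a).

Definition subv_mull (X A : {vspace H}) (a : subvs_of A) (x : subvs_of X) :
  subvs_of X := vsproj X (vsval a * vsval x).

Section Mackey.
Variables (L K : {vspace H}) (V : lmodule K).

Let act (a : subvs_of K) (v : V) : V := lmod_act V a v.

(* H (x)_K V *)
Definition induced : vectType k :=
  btensor (fun (h : H) (a : subvs_of K) => h * vsval a) act.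

Definition ind_tens (h : H) (v : V) : induced := btens _ _ h v.

(* ^C V = CK (x)_K V *)
Definition conj_mod (c : irr) : vectType k :=
  btensor (@subv_mulr (coalg_of c * K)%VS K) act.

Definition conj_act (c : irr) (A : {vspace H}) (a : subvs_of A)
    (w : conj_mod c) : conj_mod c :=
  btlift (fun x v => btens _ _ (subv_mull a x) v) w.

(* L (x)_(L :&: ^C K) ^C V *)
Definition mackey_summand (c : irr) : vectType k :=
  btensor (@subv_mulr L (L :&: conj_sub c K)%VS)
          (@conj_act c (L :&: conj_sub c K)%VS).

(* l (x) (x (x)_K v) |-> l x (x)_K v *)
Definition mackey_component (c : irr) : mackey_summand c -> induced :=
  btlift (fun l w =>
    btlift (fun x v => ind_tens (vsval l * vsval x) v) w).

(* C runs over C_(c i), for c a system of representatives of L \ H / K *)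
Definition mackey_map (I : finType) (c : I -> irr)
    (f : {dffun forall i, mackey_summand (c i)}) : induced :=
  \sum_i mackey_component (f i).

Lemma ind_tens_bilin (X : {vspace H}) (l : H) :
  bilin (fun (x : subvs_of X) (v : V) => ind_tens (l * vsval x) v).
Proof.
have [bl br] := btens_bilin (fun h (a : subvs_of K) => h * vsval a) act.
split=> [v a x y|x a v w]; last exact: br.
by rewrite /ind_tens linearP /= mulrDr -scalerAr bl.
Qed.

Lemma conj_actE (c : irr) (A : {vspace H}) (a : subvs_of A)
    (x : subvs_of (coalg_of c * K)) (v : V) :
  (K * K <= K)%VS -> (A * (coalg_of c * K) <= coalg_of c * K)%VS ->
  conj_act a (btens _ _ x v) = btens _ _ (subv_mull a x) v :> conj_mod c.
Proof.
move=> KK AK; rewrite /conj_act btliftE //.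
  have [bl br] := btens_bilin (@subv_mulr (coalg_of c * K)%VS K) act.
  split=> [w b y z|y b w z]; last exact: br.
  by rewrite -bl /subv_mull linearP /= mulrDr -scalerAr linearP.
move=> y b w; rewrite -btens_bal; congr (btens _ _ _ _); apply: val_inj.
have yK (z : subvs_of (coalg_of c * K)) : vsval z * vsval b \in (coalg_of c * K)%VS.
  apply: (subvP (prodvSr _ KK)); rewrite prodvA.
  by apply: memv_mul; apply: subvsP.
have Ay (z : subvs_of (coalg_of c * K)) : vsval a * vsval z \in (coalg_of c * K)%VS.
  by apply: (subvP AK); apply: memv_mul; apply: subvsP.
have ab : vsval a * (vsval y * vsval b) \in (coalg_of c * K)%VS.
  by have := Ay (vsproj _ (vsval y * vsval b)); rewrite vsprojK.
rewrite /subv_mull /subv_mulr /= [vsval (vsproj _ (_ * vsval b))]vsprojK //.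
by rewrite [vsval (vsproj _ (_ * vsval y))]vsprojK // mulrA.
Qed.

Lemma mackey_componentE (c : irr) (l : subvs_of L)
    (x : subvs_of (coalg_of c * K)) (v : V) :
  (L * L <= L)%VS -> (K * K <= K)%VS ->
  (conj_sub c K * (coalg_of c * K) <= coalg_of c * K)%VS ->
  mackey_component (btens _ _ l (btens _ _ x v) : mackey_summand c)
  = ind_tens (vsval l * vsval x) v.
Proof.
move=> LL KK CK.
have inner (h : H) (y : subvs_of (coalg_of c * K)) (w : V) :
    btlift (fun y w => ind_tens (h * vsval y) w)
           (btens _ _ y w : conj_mod c) = ind_tens (h * vsval y) w.
  rewrite btliftE //; first exact: ind_tens_bilin.
  move=> z b u; rewrite /ind_tens -btens_bal; congr (btens _ _ _ _).
  rewrite vsprojK ?mulrA //.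
  apply: (subvP (prodvSr _ KK)); rewrite prodvA.
  by apply: memv_mul; apply: subvsP.
have AK : ((L :&: conj_sub c K) * (coalg_of c * K) <= coalg_of c * K)%VS.
  by apply: subv_trans CK; apply: prodvSl; apply: capvSr.
rewrite /mackey_component btliftE //.
  split=> [w a y z|y a w z]; last exact: linearP.
  rewrite /btlift /tlift scaler_sumr -big_split; apply: eq_bigr => i _ /=.
  rewrite scaler_sumr -big_split; apply: eq_bigr => j _ /=.
  have [bl _] := btens_bilin (fun h (a : subvs_of K) => h * vsval a) act.
  rewrite /ind_tens mulrDl -scalerAl bl scalerDr !scalerA.
  by rewrite [a * _]mulrC.
move=> m a; set f := btlift _; set g := btlift _; move=> w.
pose b1 := fun (y : subvs_of (coalg_of c * K)) (u : V) =>
  btens (@subv_mulr (coalg_of c * K)%VS K) act (subv_mull a y) u.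
have -> : g (conj_act a w) = (g \o btlift b1 : conj_mod c -> _) w by [].
move: w; apply: btens_ext => y u /=.
rewrite -/(conj_act a (btens _ _ y u)) conj_actE // /f /g !inner.
rewrite /subv_mulr /subv_mull !vsprojK ?mulrA //.
  by apply: (subvP AK); apply: memv_mul; apply: subvsP.
apply: (subvP LL); apply: memv_mul; first exact: subvsP.
by apply: (subvP (capvSl L (conj_sub c K))); apply: subvsP.
Qed.

End Mackey.

(* An L-linear map is an isomorphism iff it is bijective. *)
Definition mackey_pair L K :=
  [/\ hopf_subalg L, hopf_subalg K &
      forall (I : finType) (c : I -> irr), dcoset_reps L K c ->
      forall V : lmodule K, bijective (@mackey_map L K V I c)].

End Hopf.

Arguments semisimple {k} H.
Arguments irr {k} H.

(* Main.v *)
Require Import Defs.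
From HB Require Import structures.
From mathcomp Require Import all_boot all_order all_algebra all_fingroup.
From mathcomp Require Import all_field.
From mathcomp Require Import boolp classical_sets.
From mathcomp Require Import zify ring.

Set Implicit Arguments.
Unset Strict Implicit.
Unset Printing Implicit Defensive.

Import GRing.Theory.

Local Open Scope ring_scope.
Local Open Scope classical_set_scope.

(** The theorem for the trivial group says that [H] is cosemisimple, so
    semisimplicity has to be transferred to the dual (Larson-Radford). The
    functional [lam h = Tr (x |-> h * S (S x))] is always a left integral of the
    dual, and cosemisimplicity is [lam 1 != 0]. Suppose [lam 1 = 0], and let [a]
    be the modular grouplike element, so that [S^4] is conjugation by [a^-1].
    Then [lam] vanishes on all powers of [a]. Splitting [H] into matrix algebras
    and extracting square roots of scalars, [S^2] is conjugation by some [v] with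
    [a = w ^ 2], [w = v^-1], whence [lam h = \sum_i tr_i (h v) * tr_i w] and
    [\sum_i tr_i w * tr_i (w ^ (2 j + 1)) = 0] for all [j]. The multiplicities of
    the eigenvalues being integers, the positive semidefinite Gram matrix of the
    antisymmetrised multiplicities forces [tr_i w = 0] for all [i], so [lam = 0],
    although [lam] takes the value 1 at the normalised integral.

    Granting this, [H] is the direct sum of the spans [H_g] of the [C_d] with
    [deg d = g], with [H_g H_h <= H_(gh)] and [S H_g <= H_(g^-1)]. For [y] in
    [C_c] with [eps y = 1], the identity [h = y_1 (S y_2 h)] gives
    [C_c H(N) = H(gN)] and [h Lambda = eps h * (y Lambda)] for [h] in [H(gN)],
    [g = deg c]; hence the conjugate of [H(N)] by [C_c] is [H(g N g^-1)]. With [L]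
    the normalised integral of [H], the map
    [h (x) v |-> pr_M L_1 (x) (pr_(gN) (S L_2 h) (x) v)] is, up to the nonzero
    scalar [eps (pr_(M :&: g N g^-1) L)], inverse to the component of the Mackey
    map at [c] and kills the other components. *)

(** * Sweedler calculus *)

(** Both [H] and its dual are treated as separable algebras, the first through L_1 (x) S L_2, the
    second through the form lam (x S y) / lam 1. This is why the representation theory below is
    developed for a bare bilinear product on a vector space, with a separability idempotent as
    hypothesis. The dual is what the grading needs: [deg] constrains only the constituents of
    products of characters, and it takes complete reducibility of comodules to conclude that the
    subcoalgebra product C_x C_y lies in the sum of the C_z over these constituents.

    Over a general [k] there is no complex conjugation, and the eigenvalues of w carry no
    positivity. The only positive object at hand is the integer matrix of their multiplicities, so
    the vanishing power sums are converted into linear algebra over the rationals. Only odd moments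
    are available, since a^(j+1) v = w^(2j+1); they see the multiplicities of z and -z only through
    their difference. This loses nothing, because the wanted trace of w is itself an odd moment. *)

Section Linearity.
Variable k : fieldType.
Implicit Types U V W : lmodType k.

(* A copy of [linear] with a rigid head symbol, on which the tactic [lin] below
   proceeds by the shape of the function. *)
Definition islin U V (f : U -> V) := linear f.

Lemma islin_id U : islin (fun x : U => x). Proof. by []. Qed.

Lemma islin_comp U V W (g : V -> W) (f : U -> V) :
  islin g -> islin f -> islin (fun x => g (f x)).
Proof. by move=> lg lf a x y; rewrite lf lg. Qed.

Lemma islin_scaler U V (c : k) (f : U -> V) :
  islin f -> islin (fun x => c *: f x).
Proof. by move=> lf a x y; rewrite lf scalerDr !scalerA mulrC. Qed.

Lemma islin_scalel U V (f : U -> k^o) (v : V) :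
  islin f -> islin (fun x => (f x : k) *: v).
Proof. by move=> lf a x y; rewrite lf scalerDl scalerA. Qed.

Lemma islin_sum U V (n : nat) (f : 'I_n -> U -> V) :
  (forall i, islin (f i)) -> islin (fun x => \sum_i f i x).
Proof.
move=> lf a x y; rewrite scaler_sumr -big_split.
by apply: eq_bigr => i _; rewrite lf.
Qed.

Lemma islin_add U V (f g : U -> V) :
  islin f -> islin g -> islin (fun x => f x + g x).
Proof. by move=> lf lg a x y; rewrite lf lg scalerDr addrACA. Qed.

Lemma islin_opp U V (f : U -> V) : islin f -> islin (fun x => - f x).
Proof. by move=> lf a x y; rewrite lf opprD scalerN. Qed.

Lemma islinZ U V (f : U -> V) : islin f -> forall a x, f (a *: x) = a *: f x.
Proof.
move=> lf a x; have f0 : f 0 = 0.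
  by have := lf (-1) 0 0; rewrite !scaleN1r oppr0 addr0 addNr.
by rewrite -[a *: x]addr0 lf f0 addr0.
Qed.

Lemma islinD U V (f : U -> V) : islin f -> forall x y, f (x + y) = f x + f y.
Proof. by move=> lf x y; have := lf 1 x y; rewrite !scale1r. Qed.

Lemma islin0 U V (f : U -> V) : islin f -> f 0 = 0.
Proof. by move=> lf; have := islinZ lf 0 0; rewrite !scale0r. Qed.

Lemma islinN U V (f : U -> V) : islin f -> forall x, f (- x) = - f x.
Proof. by move=> lf x; rewrite -scaleN1r islinZ // scaleN1r. Qed.

Lemma islin_big U V (f : U -> V) (I : Type) (r : seq I) (P : pred I) (F : I -> U) :
  islin f -> f (\sum_(i <- r | P i) F i) = \sum_(i <- r | P i) f (F i).
Proof.
move=> lf; apply: (big_morph f) => [x y|]; last exact: islin0.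
exact: islinD.
Qed.

Lemma islin_mull (A : algType k) U (f : U -> A) (c : A) :
  islin f -> islin (fun x => f x * c).
Proof. by move=> lf a x y; rewrite lf mulrDl scalerAl. Qed.

Lemma islin_mulr (A : algType k) U (f : U -> A) (c : A) :
  islin f -> islin (fun x => c * f x).
Proof. by move=> lf a x y; rewrite lf mulrDr scalerAr. Qed.

Lemma islin_bl (U : lmodType k) (V V' W : vectType k) (b : V -> V' -> W) (f : U -> V) w :
  bilin b -> islin f -> islin (fun x => b (f x) w).
Proof. by move=> [bl _] lf a x y; rewrite lf bl. Qed.

Lemma islin_br (U : lmodType k) (V V' W : vectType k) (b : V -> V' -> W) (f : U -> V') w :
  bilin b -> islin f -> islin (fun x => b w (f x)).
Proof. by move=> [_ br] lf a x y; rewrite lf br. Qed.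

Lemma islin_hom (U V : vectType k) (W : lmodType k) (g : 'Hom(U, V)) (f : W -> U) :
  islin f -> islin (fun x => g (f x)).
Proof. by move=> lf a x y; rewrite lf linearP. Qed.

End Linearity.

Lemma linfunE_islin (k : fieldType) (U V : vectType k) (f : U -> V) (lf : islin f) :
  exists F : 'Hom(U, V), forall x, F x = f x.
Proof.
pose g : {linear U -> V} := HB.pack f (GRing.isLinear.Build k U V *:%R f lf).
by exists (linfun g) => x; rewrite lfunE.
Qed.

Section Sweedler.
Variables (k : fieldType) (H : hopfType k).
Implicit Types (V W : vectType k) (g h : H).

(* [sw b h] is the Sweedler sum [\sum b h_1 h_2]. *)
Definition sw V (b : H -> H -> V) (h : H) : V := tlift b (comul h).

Lemma swE V (b : H -> H -> V) h :
  sw b h = \sum_i \sum_j (comul h : 'M_(_, _)) i j *: b (bvec i) (bvec j).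
Proof. by []. Qed.

Lemma eq_sw V (b b' : H -> H -> V) h :
  (forall x y, b x y = b' x y) -> sw b h = sw b' h.
Proof.
by move=> e; rewrite !swE; apply: eq_bigr => i _; apply: eq_bigr => j _; rewrite e.
Qed.

Lemma sw_lin V W (f : V -> W) (b : H -> H -> V) h :
  islin f -> f (sw b h) = sw (fun x y => f (b x y)) h.
Proof.
move=> lf; rewrite !swE islin_big //; apply: eq_bigr => i _.
by rewrite islin_big //; apply: eq_bigr => j _; rewrite islinZ.
Qed.

Lemma islin_sw (U : lmodType k) V (b : H -> H -> V) (f : U -> H) :
  islin f -> islin (fun x => sw b (f x)).
Proof. by move=> lf a x y; rewrite /sw lf !linearP. Qed.

Lemma islin_swf (U : lmodType k) V (t : U -> H -> H -> V) h :
  (forall x y, islin (fun u => t u x y)) -> islin (fun u => sw (t u) h).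
Proof.
move=> lt; rewrite /sw /tlift.
do 2![apply: islin_sum => ?]; exact: islin_scaler.
Qed.

Lemma sw_sum V (n : nat) (b : 'I_n -> H -> H -> V) h :
  sw (fun x y => \sum_i b i x y) h = \sum_i sw (b i) h.
Proof.
rewrite swE; under eq_bigr => i _ do under eq_bigr => j _ do rewrite scaler_sumr.
under eq_bigr => i _ do rewrite exchange_big.
by rewrite exchange_big.
Qed.

Lemma sw_sub V (b b' : H -> H -> V) h :
  sw (fun x y => b x y - b' x y) h = sw b h - sw b' h.
Proof.
rewrite !swE -sumrB; apply: eq_bigr => i _; rewrite -sumrB.
by apply: eq_bigr => j _; rewrite scalerBr.
Qed.

Lemma sw_add V (b b' : H -> H -> V) h :
  sw (fun x y => b x y + b' x y) h = sw b h + sw b' h.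
Proof.
rewrite !swE -big_split; apply: eq_bigr => i _; rewrite -big_split.
by apply: eq_bigr => j _; rewrite scalerDr.
Qed.

Lemma sw_exch V (t : H -> H -> H -> H -> V) g h :
  sw (fun a b => sw (fun c d => t a b c d) h) g =
  sw (fun c d => sw (fun a b => t a b c d) g) h.
Proof.
under eq_sw => a b do rewrite [sw _ _]swE.
rewrite [RHS]swE sw_sum; apply: eq_bigr => i _.
rewrite sw_sum; apply: eq_bigr => j _.
by rewrite -(@sw_lin _ _ (fun x => _ *: x)) //; apply/islin_scaler/islin_id.
Qed.

Definition trilin V (t : H -> H -> H -> V) :=
  [/\ forall y z, islin (fun x => t x y z), forall x z, islin (fun y => t x y z)
    & forall x y, islin (t x y)].

Lemma bilinP V V' W (b : V -> V' -> W) :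
  (forall y, islin (b^~ y)) -> (forall x, islin (b x)) -> bilin b.
Proof. by []. Qed.

Lemma sw_coassoc V (t : H -> H -> H -> V) h : trilin t ->
  sw (fun x z => sw (fun x y => t x y z) x) h =
  sw (fun x y => sw (fun y z => t x y z) y) h.
Proof.
move=> [t1 t2 t3].
(* The axiom is an equation in (H (x) H) (x) H, so [t] is extended in two stages, to the first two
   factors by [T] and then to all three by [tlift T]. *)
pose T (s : tensor H H) (z : H) := tlift (fun x y => t x y z) s.
have TE x y z : T (tens x y) z = t x y z.
  by rewrite /T tliftE //; split=> ?; [apply: t1 | apply: t2].
have Tb : bilin T.
  split=> z a s s'; first exact: linearP.
  rewrite /T /tlift; do 2![rewrite scaler_sumr -big_split; apply: eq_bigr => ? _ /=].
  by rewrite t3 scalerDr !scalerA mulrC.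
have TTE s z : tlift T (tens s z) = T s z by rewrite tliftE.
have := congr1 (tlift T) (comul_coassoc h).
rewrite -!/(sw _ _) !(@sw_lin _ _ (tlift T)); try exact: linearP.
under eq_sw => x y do rewrite TTE /T -/(sw _ _).
move=> ->; apply: eq_sw => x y.
rewrite -!/(sw _ _) (@sw_lin _ _ (tlift T)); last exact: linearP.
by apply: eq_sw => y1 y2; rewrite TTE TE.
Qed.

Lemma sw_counitl V (f : H -> V) h : islin f ->
  sw (fun x y => eps x *: f y) h = f h.
Proof.
move=> lf; rewrite -[in RHS](comul_counitl h) -/(sw _ h) (sw_lin _ _ lf).
by apply: eq_sw => x y; rewrite (islinZ lf).
Qed.

Lemma sw_counitr V (f : H -> V) h : islin f ->
  sw (fun x y => eps y *: f x) h = f h.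
Proof.
move=> lf; rewrite -[in RHS](comul_counitr h) -/(sw _ h) (sw_lin _ _ lf).
by apply: eq_sw => x y; rewrite (islinZ lf).
Qed.

Lemma sw1 V (b : H -> H -> V) : bilin b -> sw b 1 = b 1 1.
Proof. by move=> bb; rewrite /sw comul1 tliftE. Qed.

Lemma swM V (b : H -> H -> V) g h : bilin b ->
  sw b (g * h) =
  sw (fun x x' => sw (fun y y' => b (x * y) (x' * y')) h) g.
Proof.
move=> bb; rewrite /sw comulM -!/(sw _ _) (@sw_lin _ _ (tlift b)); last exact: linearP.
apply: eq_sw => x x'; rewrite -!/(sw _ _) (@sw_lin _ _ (tlift b)); last exact: linearP.
by apply: eq_sw => y y'; rewrite tliftE.
Qed.

Lemma islin_eps (U : lmodType k) (f : U -> H) : islin f -> islin (fun x => eps (f x) : k^o).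
Proof. by move=> lf a x y; rewrite lf /eps linearP. Qed.

Lemma epsM g h : eps (g * h) = eps g * eps h. Proof. exact: counitM. Qed.
Lemma eps1 : eps (1 : H) = 1. Proof. exact: counit1. Qed.

Local Notation S := (antipode : H -> H).

Lemma sw_antipodel h : sw (fun x y => S x * y) h = eps h *: 1.
Proof. exact: antipodel. Qed.

Lemma sw_antipoder h : sw (fun x y => x * S y) h = eps h *: 1.
Proof. exact: antipoder. Qed.

End Sweedler.

(** A function without a rule of its own is handled through an [islin] or [bilin] hypothesis of the
    context; hence facts such as [islin_lam] are copied there before [lin] or [mlin] is called. *)
Ltac lin_step :=
  first [ assumption | exact: islin_id | eassumption
        | apply: islin_sw | apply: islin_swf;
          intros | apply: islin_hom | apply: islin_mull | apply: islin_mulr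
        | apply: islin_scaler | apply: islin_scalel | apply: islin_eps
        | apply: islin_add | apply: islin_opp
        | eapply islin_bl; [eassumption|] | eapply islin_br; [eassumption|]
        | eapply islin_comp; [eassumption|]
        | apply: islin_sum; intros ].
Ltac lin := try refine (_ : islin _); repeat lin_step.
Ltac mlin := split; intros; lin.

Section Antipode.
Variables (k : fieldType) (H : hopfType k).
Local Notation S := (antipode : H -> H).

Lemma eps_antipode (h : H) : eps (S h) = eps h.
Proof.
have le : islin (fun x : H => eps x : k^o) by lin.
have -> : eps (S h) = sw (fun x y => eps y *: (eps (S x) : k^o)) h.
  by rewrite (sw_counitr (f := fun x => eps (S x) : k^o)) //; lin.
rewrite -[eps h](mulr1 (eps h)) -(eps1 H) -[_ * _](islinZ le) -sw_antipodel.
rewrite (sw_lin (W:=k^o) _ _ le).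
by apply: (@eq_sw _ _ k^o) => x y; rewrite epsM mulrC.
Qed.

Lemma antipode1 : S 1 = 1.
Proof.
have := sw_antipodel (1 : H); rewrite sw1; last by mlin.
by rewrite mulr1 eps1 scale1r.
Qed.

Lemma sw_mulr (c : H) (b : H -> H -> H) h :
  c * sw b h = sw (fun x y => c * b x y) h.
Proof. by apply: (sw_lin (f := fun z => c * z)); lin. Qed.

Lemma sw_mull (c : H) (b : H -> H -> H) h :
  sw b h * c = sw (fun x y => b x y * c) h.
Proof. by apply: (sw_lin (f := fun z => z * c)); lin. Qed.

Lemma sw_hom (V W : vectType k) (f : 'Hom(V, W)) (b : H -> H -> V) (h : H) :
  f (sw b h) = sw (fun x y => f (b x y)) h.
Proof. by apply: sw_lin; lin. Qed.

Lemma sw_scale (V : vectType k) (c : k) (b : H -> H -> V) (h : H) :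
  c *: sw b h = sw (fun x y => c *: b x y) h.
Proof. by apply: (sw_lin (f := fun z => c *: z)); lin. Qed.

(* Both sides are convolution inverses of the multiplication [H (x) H -> H]. *)
Lemma antipodeM (x y : H) : S (x * y) = S y * S x.
Proof.
pose t x1 x2 x3 y1 y2 y3 : H := S y1 * S x1 * ((x2 * y2) * S (x3 * y3)).
pose E : H := sw (fun x1 x' => sw (fun x2 x3 =>
  sw (fun y1 y' => sw (fun y2 y3 => t x1 x2 x3 y1 y2 y3) y') y) x') x.
transitivity E; last first.
  transitivity (sw (fun x1 x' => eps x' *: (sw (fun y1 y' => eps y' *: (S y1 * S x1))
    y)) x).
    apply: eq_sw => x1 x'; rewrite sw_exch sw_scale; apply: eq_sw => y1 y'.
    have := sw_antipoder (x' * y'); rewrite swM; last by mlin.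
    move=> /(congr1 (fun z => S y1 * S x1 * z)).
    rewrite sw_mulr; under eq_sw => ? ? do rewrite sw_mulr.
    by move=> ->; rewrite epsM -scalerAr mulr1 scalerA.
  rewrite (sw_counitr (f := fun x1 => sw (fun y1 y' => eps y' *: (S y1 * S x1)) y));
    last by lin.
  by rewrite (sw_counitr (f := fun y1 => S y1 * S x)) //; lin.
rewrite /E -sw_coassoc; last by rewrite /t; mlin.
transitivity (sw (fun x' x3 => eps x' *: (sw (fun y' y3 => eps y' *: S (x3 * y3)) y)) x).
  rewrite (sw_counitl (f := fun x3 => sw (fun y' y3 => eps y' *: S (x3 * y3)) y));
    last by lin.
  by rewrite (sw_counitl (f := fun y3 => S (x * y3))) //; lin.
apply: eq_sw => x' x3.
under [RHS]eq_sw => x1 x2 do (rewrite -sw_coassoc; last by rewrite /t; mlin).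
rewrite sw_exch sw_scale; apply: eq_sw => y' y3.
transitivity (sw (fun y1 y2 => S y1 * (eps x' *: 1) * y2 * S (x3 * y3)) y').
  under [RHS]eq_sw => ? ? do rewrite -scalerAr mulr1 -2!scalerAl.
  rewrite -sw_scale; congr (_ *: _); rewrite -sw_mull sw_antipodel.
  by rewrite -scalerAl mul1r.
rewrite sw_exch; apply: eq_sw => y1 y2; rewrite -sw_antipodel.
rewrite sw_mulr !sw_mull; apply: eq_sw => x1 x2.
by rewrite /t !mulrA.
Qed.

(* Both sides are convolution inverses of the comultiplication. *)
Lemma sw_antipode (V : vectType k) (b : H -> H -> V) (h : H) : bilin b ->
  sw b (S h) = sw (fun x y => b (S y) (S x)) h.
Proof.
move=> bb.
pose E : V := sw (fun h1 h' => sw (fun h2 h'' => sw (fun h3 h4 => 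
   sw (fun x y => b (S h2 * x) (S h1 * y)) (h3 * S h4)) h'') h') h.
transitivity E; last first.
  rewrite /E; transitivity (sw (fun h1 h' => sw (fun h2 h'' => eps h'' *: b (S h2)
    (S h1)) h') h).
    apply: eq_sw => h1 h'; apply: eq_sw => h2 h''.
    rewrite -(@sw_lin _ _ _ _ (fun z => sw (fun x y => b (S h2 * x) (S h1 * y)) z));
      last by lin.
    rewrite sw_antipoder (@islinZ _ _ _ (fun z => sw (fun x y => b (S h2 * x)
      (S h1 * y)) z)); last by lin.
    by rewrite sw1; [rewrite !mulr1 | mlin].
  apply: eq_sw => h1 h'.
  by rewrite (sw_counitr (f := fun h2 => b (S h2) (S h1))) //; lin.
have reb : E = sw (fun h' h4 => sw (fun h1 h'' => sw (fun h2 h3 => sw (fun x y =>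
  b (S h2 * x) (S h1 * y)) (h3 * S h4)) h'') h') h.
  rewrite /E [RHS]sw_coassoc; last by mlin.
  by apply: eq_sw => h1 h'; rewrite sw_coassoc //; mlin.
rewrite reb.
transitivity (sw (fun h' h4 => eps h' *: sw b (S h4)) h).
  by rewrite (sw_counitl (f := fun h4 => sw b (S h4))) //; lin.
apply: eq_sw => h' h4.
under [RHS]eq_sw => h1 h'' do (under eq_sw => h2 h3 do (rewrite swM; last by mlin)).
transitivity (sw (fun x y => sw (fun h1 h'' => sw (fun h2 h3 => sw (fun x3 y3 =>
  b (S h2 * (x3 * x)) (S h1 * (y3 * y))) h3) h'') h') (S h4)).
  rewrite sw_scale; apply: eq_sw => x y.
  transitivity (sw (fun h1 h'' => sw (fun h' y3 => sw (fun h2 x3 => b (S h2 * x3 * x)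
    (S h1 * (y3 * y))) h') h'') h').
    transitivity (sw (fun h1 h'' => b x (S h1 * (h'' * y))) h').
      rewrite -(@sw_lin _ _ _ _ (fun z => b x z)); last by lin.
      rewrite -(_ : (eps h' *: 1) * y = sw (fun h1 h'' => S h1 * (h'' * y)) h').
        by rewrite -scalerAl mul1r (islinZ (bb.2 x)).
      by rewrite -sw_antipodel sw_mull; apply: eq_sw => ? ?; rewrite mulrA.
    apply: eq_sw => h1 h''.
    rewrite -[in LHS](@sw_counitl _ _ _ (fun z => b x (S h1 * (z * y))) h''); last by lin.
    apply: eq_sw => g y3.
    rewrite -(@sw_lin _ _ _ _ (fun z => b (z * x) (S h1 * (y3 * y)))); last by lin.
    rewrite sw_antipodel -scalerAl mul1r.
    by rewrite (@islinZ _ _ _ (fun z => b z (S h1 * (y3 * y)))) //; lin.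
  apply: eq_sw => h1 h''; rewrite sw_coassoc; last by mlin.
  by apply: eq_sw => h2 h3; apply: eq_sw => x3 y3; congr (b _ _); rewrite mulrA.
rewrite sw_exch; apply: eq_sw => h1 h''; rewrite sw_exch; apply: eq_sw => h2 h3.
by rewrite sw_exch.
Qed.

Lemma sw_antipode2 (V : vectType k) (b : H -> H -> V) (h : H) : bilin b ->
  sw b (S (S h)) = sw (fun x y => b (S (S x)) (S (S y))) h.
Proof. by move=> bb; rewrite !sw_antipode //; mlin. Qed.

Lemma sw_antipode_twist h : sw (fun x y => S (S y) * S x) h = eps h *: 1.
Proof.
transitivity (S (sw (fun x y => x * S y) h)).
  by rewrite sw_hom; apply: eq_sw => x y; rewrite antipodeM.
by rewrite sw_antipoder linearZ /= antipode1.
Qed.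

End Antipode.

(** * Integrals *)

Section Trace.
Variables (k : fieldType) (V : vectType k).

Lemma islin_bcoord i : islin (fun v : V => bcoord v i : k^o).
Proof. by move=> a u v; rewrite /bcoord linearP. Qed.

Lemma bcoord_bvec (i j : 'I_(dimT V)) : bcoord (bvec i : V) j = (i == j)%:R.
Proof. by rewrite /bcoord /bvec coord_free ?(basis_free (vbasisP _)) // eq_sym. Qed.

Definition ftrace (f : V -> V) : k := \sum_i bcoord (f (bvec i)) i.

Lemma eq_ftrace (f g : V -> V) : f =1 g -> ftrace f = ftrace g.
Proof. by move=> e; apply: eq_bigr => i _; rewrite e. Qed.

Lemma ftraceC (f g : V -> V) : islin f -> islin g ->
  ftrace (fun v => f (g v)) = ftrace (fun v => g (f v)).
Proof.
move=> lf lg.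
rewrite {1}/ftrace.
have Eg i : g (bvec i) = \sum_j bcoord (g (bvec i)) j *: bvec j := bcoord_sum _.
transitivity (\sum_i \sum_j bcoord (g (bvec i)) j * bcoord (f (bvec j)) i).
  apply: eq_bigr => i _; rewrite {1}Eg (islin_big _ _ _ lf).
  rewrite (islin_big _ _ _ (islin_bcoord i)); apply: eq_bigr => j _.
  by rewrite (islinZ lf) (islinZ (islin_bcoord i)).
rewrite exchange_big; apply: eq_bigr => j _ /=.
rewrite [f (bvec j) in RHS]bcoord_sum (islin_big _ _ _ lg).
rewrite (islin_big _ _ _ (islin_bcoord j)); apply: eq_bigr => i _.
by rewrite (islinZ lg) (islinZ (islin_bcoord j)) mulrC.
Qed.

End Trace.

Section Integral.
Variables (k : fieldType) (H : hopfType k).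
Local Notation S := (antipode : H -> H).

(** The component [e] of 1 in a complement of the augmentation ideal is a left integral with counit
    1. *)
Lemma is_integral_fullv : semisimple H -> exists L : H, is_integral fullv L.
Proof.
move=> ssH.
have le : islin (fun x : H => eps x : k^o) by lin.
have linI (z : H) : (forall h, h * z = eps h *: z) -> (fullv * <[z]> <= <[z]>)%VS.
  move=> zE; apply/prodvP => h _ _ /vlineP[c ->].
  by rewrite -scalerAr zE scalerA memvZ // memv_line.
pose I := lker (counit : 'Hom(H, k^o)).
have inI (x : H) : (x \in I) = (eps x == 0) by rewrite memv_ker.
have idI : (fullv * I <= I)%VS.
  apply/prodvP => h x _; rewrite !inI epsM => /eqP->.
  by rewrite mulr0.
have [J [idJ IJ IJ0]] := ssH _ idI.
have /memv_addP[i iI [e eJ eq1]] : 1 \in (I + J)%VS by rewrite IJ memvf.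
have epse : eps e = 1.
  rewrite -(eps1 H) eq1 (islinD le); move: iI; rewrite inI => /eqP->.
  by rewrite add0r.
have he (h : H) : h * e = eps h *: e.
  apply/eqP; rewrite -subr_eq0 -memv0 -IJ0 memv_cap inI (islinD le) (islinN le).
  rewrite epsM (islinZ le) epse mulr1 [_ *: _]mulr1 subrr eqxx /=.
  by rewrite rpredB ?memvZ // (subvP idJ) // memv_mul ?memvf.
exists e; split=> [|h _|h _|]; [exact: memvf | exact: he | | exact: epse].
(* The failure of [e] to be a right integral is a left integral of counit 0, so it spans a left
   ideal of square zero. Such an ideal has a complement only if it is zero. *)
pose z := e * (h - eps h *: 1).
have zE (g : H) : g * z = eps g *: z by rewrite mulrA he -scalerAl.
have epsz : eps z = 0.
  rewrite epsM (islinD le) (islinN le) (islinZ le) eps1 [_ *: 1]mulr1.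
  by rewrite subrr mulr0.
have [N [idN zN zN0]] := ssH _ (linI z zE).
have /memv_addP[_ /vlineP[c ->] [n nN eq1n]] : 1 \in (<[z]> + N)%VS.
  by rewrite zN memvf.
have : z * n = z.
  by rewrite -[RHS]mulr1 eq1n mulrDr -scalerAr zE epsz scale0r scaler0 add0r.
move=> zn; have : z \in (<[z]> :&: N)%VS.
  by rewrite memv_cap memv_line -zn (subvP idN) // memv_mul ?memvf.
by rewrite zN0 memv0 /z mulrBr -scalerAr mulr1 subr_eq0 => /eqP.
Qed.

Variables (L : H) (intL : is_integral fullv L).

Let LL h : h * L = eps h *: L.
Proof. by case: intL => _ /(_ h (memvf _)). Qed.
Let LR h : L * h = eps h *: L.
Proof. by case: intL => _ _ /(_ h (memvf _)). Qed.
Let epsL : eps L = 1. Proof. by case: intL. Qed.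

(** Insert h_1 (x) S(h_2) h_3 for [h]: then S(L_2) S(h_2) = S(h_2 L_2), and the coproduct of h_1 L
    is eps(h_1) times that of L. *)
Lemma int_casimir (V : vectType k) (b : H -> H -> V) h : bilin b ->
  sw (fun x y => b (h * x) (S y)) L = sw (fun x y => b x (S y * h)) L.
Proof.
move=> bb.
transitivity (sw (fun h' h3 => sw (fun x y => b x (S y * h3)) (h' * L)) h); last first.
  rewrite -[RHS](@sw_counitl _ _ _ (fun h3 => sw (fun x y => b x (S y * h3)) L));
    last by lin.
  apply: eq_sw => h' h3; rewrite LL.
  by rewrite (@islinZ _ _ _ (fun z => sw (fun x y => b x (S y * h3)) z)) //; lin.
transitivity (sw (fun h' h3 => sw (fun h1 h2 => sw (fun x y => b (h1 * x) (S (h2 * y)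
  * h3)) L) h') h); last first.
  by apply: eq_sw => h' h3; rewrite swM //; mlin.
rewrite sw_coassoc; last by mlin.
rewrite -[LHS](@sw_counitr _ _ _ (fun h1 => sw (fun x y => b (h1 * x) (S y)) L));
  last by lin.
apply: eq_sw => h1 h''; rewrite sw_exch sw_scale; apply: eq_sw => x y.
transitivity (b (h1 * x) (S y * (eps h'' *: 1))).
  by rewrite -scalerAr mulr1 (islinZ (bb.2 _)).
rewrite -sw_antipodel sw_mulr (sw_lin _ _ (bb.2 _)).
by apply: eq_sw => h2 h3; rewrite antipodeM mulrA.
Qed.

(** Evaluate S(h_1) h_2 L_1 (x) h_3 L_2 in two ways: absorb h_2 and h_3 into L, or contract S(h_1)
    h_2. The lemma [int_shiftr] is the mirror image. *)
Lemma int_shiftl (V : vectType k) (b : H -> H -> V) h : bilin b ->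
  sw (fun x y => b (S h * x) y) L = sw (fun x y => b x (h * y)) L.
Proof.
move=> bb.
transitivity (sw (fun h1 h' => sw (fun x y => b (S h1 * x) y) (h' * L)) h).
  rewrite -[LHS](@sw_counitr _ _ _ (fun h1 => sw (fun x y => b (S h1 * x) y) L));
    last by lin.
  apply: eq_sw => h1 h'; rewrite LL.
  by rewrite (@islinZ _ _ _ (fun z => sw (fun x y => b (S h1 * x) y) z)) //; lin.
transitivity (sw (fun h1 h' => sw (fun h2 h3 => sw (fun x y => b (S h1 * h2 * x)
  (h3 * y)) L) h') h).
  apply: eq_sw => h1 h'; rewrite swM; last by mlin.
  by apply: eq_sw => h2 h3; apply: eq_sw => x y; congr (b _ _); rewrite mulrA.
rewrite -sw_coassoc; last by mlin.
rewrite -[RHS](@sw_counitl _ _ _ (fun h => sw (fun x y => b x (h * y)) L)); last by lin.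
apply: eq_sw => h' h3; rewrite sw_exch sw_scale; apply: eq_sw => x y.
transitivity (b ((eps h' *: 1) * x) (h3 * y)); last first.
  by rewrite -scalerAl mul1r (islinZ (bb.1 _)).
by rewrite -sw_antipodel sw_mull (sw_lin _ _ (bb.1 _)).
Qed.

Lemma int_shiftr (V : vectType k) (b : H -> H -> V) h : bilin b ->
  sw (fun x y => b (x * h) y) L = sw (fun x y => b x (y * S h)) L.
Proof.
move=> bb.
transitivity (sw (fun h' h3 => sw (fun x y => b x (y * S h3)) (L * h')) h); last first.
  rewrite -[RHS](@sw_counitl _ _ _ (fun h3 => sw (fun x y => b x (y * S h3)) L));
    last by lin.
  apply: eq_sw => h' h3; rewrite LR.
  by rewrite (@islinZ _ _ _ (fun z => sw (fun x y => b x (y * S h3)) z)) //; lin.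
transitivity (sw (fun h' h3 => sw (fun h1 h2 => sw (fun x y => b (x * h1)
  (y * h2 * S h3)) L) h') h); last first.
  by apply: eq_sw => h' h3; rewrite swM; [rewrite sw_exch | mlin].
rewrite sw_coassoc; last by mlin.
rewrite -[LHS](@sw_counitr _ _ _ (fun h1 => sw (fun x y => b (x * h1) y) L)); last by lin.
apply: eq_sw => h1 h''; rewrite sw_exch sw_scale; apply: eq_sw => x y.
transitivity (b (x * h1) (y * (eps h'' *: 1))).
  by rewrite -scalerAr mulr1 (islinZ (bb.2 _)).
rewrite -sw_antipoder sw_mulr (sw_lin _ _ (bb.2 _)).
by apply: eq_sw => h2 h3; rewrite mulrA.
Qed.

End Integral.

(** * The trace functional is a left integral of the dual *)

Section TraceIntegral.
Variables (k : fieldType) (H : hopfType k).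
Local Notation S := (antipode : H -> H).

Definition lam (h : H) : k := ftrace (fun x => h * S (S x)).

Lemma islin_lam : islin (fun h => lam h : k^o).
Proof.
rewrite /lam /ftrace; apply: islin_sum => i a u v.
by rewrite mulrDl -scalerAl; apply: islin_bcoord.
Qed.

(** Cyclicity of the trace, S^2 being multiplicative; so S^2 is the Nakayama automorphism of
    [lam]. *)
Lemma lam_twist (a b : H) : lam (a * b) = lam (b * S (S a)).
Proof.
rewrite /lam.
transitivity (ftrace (fun x => a * (b * S (S x)))).
  by apply: eq_ftrace => x; rewrite mulrA.
rewrite (@ftraceC _ _ (fun x => a * x) (fun x => b * S (S x))); try by lin.
by apply: eq_ftrace => x; rewrite !antipodeM mulrA.
Qed.

(** For h = L the map under the trace is x |-> eps x L, of rank one and trace eps L. *)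
Lemma lam_int L : is_integral fullv L -> lam L = 1.
Proof.
case=> _ _ LR epsL; rewrite -epsL [in RHS](bcoord_sum L).
have le : islin (fun x : H => eps x : k^o) by lin.
rewrite (islin_big _ _ _ le); apply: eq_bigr => i _.
rewrite (islinZ le) LR ?memvf // (islinZ (islin_bcoord i)).
by rewrite !eps_antipode; apply: mulrC.
Qed.

(* As [S (S x_2) * S x_1] collapses, [h_1 (x) h_2 S (S x)] is
   [Delta (h * S (S x_2)) * (S x_1 (x) 1)]; the trace over [x] is then cyclic. *)
Lemma sw_mul_antipode2 (p : H -> k^o) (h x : H) : islin p ->
  sw (fun h1 h2 => (p (h2 * S (S x)) : k) *: h1) h =
  sw (fun x1 x' => sw (fun z1 z2 => (p z2 : k) *: (z1 * S x1)) (h * S (S x'))) x.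
Proof.
move=> lp.
transitivity (sw (fun x1 x' => sw (fun u v => sw (fun h1 h2 =>
    (p (h2 * S (S v)) : k) *: (h1 * (S (S u) * S x1))) h) x') x); last first.
  apply: eq_sw => x1 x'; rewrite swM; last by mlin.
  rewrite sw_exch; apply: eq_sw => h1 h2; rewrite sw_antipode2; last by mlin.
  by apply: eq_sw => u v; rewrite mulrA.
rewrite -sw_coassoc; last by mlin.
transitivity (sw (fun x' v => eps x' *: sw (fun h1 h2 => (p (h2 * S (S v)) : k) *: h1)
  h) x).
  rewrite (@sw_counitl _ _ _ (fun v => sw (fun h1 h2 => (p (h2 * S (S v)) : k) *: h1)
    h)) //; lin.
apply: eq_sw => x' v; rewrite sw_exch sw_scale; apply: eq_sw => h1 h2.
rewrite -(sw_lin (f := fun z => (p (h2 * S (S v)) : k) *: (h1 * z))); last by lin.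
by rewrite sw_antipode_twist -scalerAr mulr1 scalerA mulrC -scalerA.
Qed.

(** After [sw_mul_antipode2], exchanging the two basis sums moves the coproduct from x onto z_2.
    With z = h S^2(x) the summand becomes z_1 S(z_2) (x) z_3, which contracts to 1 (x) z and leaves
    the trace. *)
Lemma lam_left (h : H) : sw (fun x y => lam y *: x) h = lam h *: 1.
Proof.
pose F x : H := h * S (S x).
have lF : islin F by rewrite /F; lin.
transitivity (\sum_i sw (fun h1 h2 => bcoord (h2 * S (S (bvec i))) i *: h1) h).
  by rewrite -sw_sum; apply: eq_sw => x y; rewrite scaler_suml.
under eq_bigr => i _ do rewrite (sw_mul_antipode2 _ _ (islin_bcoord i)).
pose T l z1 z2 : H := sw (fun x1 x' => bcoord x' l *: (z1 * S x1)) z2.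
transitivity (\sum_i \sum_l sw (fun z1 z2 => bcoord z2 i *: T l z1 (bvec i)) (F (bvec l))).
  apply: eq_bigr => i _; rewrite /T.
  pose G l x1 x' : H := bcoord x' l *: sw (fun z1 z2 => bcoord z2 i *: (z1 * S x1))
    (F (bvec l)).
  transitivity (sw (fun x1 x' => \sum_l G l x1 x') (bvec i)).
    apply: eq_sw => x1 x'; rewrite -/(F x') {1}(bcoord_sum x') (islin_big _ _ _ lF).
    rewrite (@islin_big _ _ _ (fun z => sw (fun z1 z2 => bcoord z2 i *: (z1 * S x1))
      z)); last by lin.
    apply: eq_bigr => l _; rewrite (islinZ lF).
    by rewrite (@islinZ _ _ _ (fun z => sw (fun z1 z2 => bcoord z2 i *: (z1 * S x1))
      z)); last by lin.
  rewrite sw_sum; apply: eq_bigr => l _; rewrite /G.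
  under eq_sw => x1 x' do rewrite sw_scale.
  rewrite sw_exch; apply: eq_sw => z1 z2; rewrite sw_scale; apply: eq_sw => x1 x'.
  by rewrite !scalerA mulrC.
rewrite exchange_big /lam /ftrace scaler_suml; apply: eq_bigr => l _ /=.
rewrite -sw_sum -/(F (bvec l)).
have lT z1 : islin (T l z1) by rewrite /T; lin.
transitivity (sw (fun z1 z2 => T l z1 z2) (F (bvec l))).
  apply: eq_sw => z1 z2; rewrite [in RHS](bcoord_sum z2) (islin_big _ _ _ (lT z1)).
  by apply: eq_bigr => i _; rewrite (islinZ (lT z1)).
have lb := @islin_bcoord _ H l.
rewrite /T -sw_coassoc; last by split=> *; [lin|lin|apply: islin_scalel].
rewrite -(@sw_counitl _ _ _ (fun z => bcoord z l *: 1)); last by apply: islin_scalel.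
apply: eq_sw => y z3; rewrite -sw_scale sw_antipoder.
by rewrite !scalerA mulrC.
Qed.

End TraceIntegral.

(** * The modular element and the fourth power of the antipode *)

Section Modular.
Variables (k : fieldType) (H : hopfType k) (L : H) (intL : is_integral fullv L).
Local Notation S := (antipode : H -> H).
Let llam := @islin_lam k H.

(** Moving [h] to the first leg of L leaves the left integral evaluated at L, which is 1. Since [h]
    is recovered from S h, this also gives the injectivity of S. *)
Lemma lam_shiftr (h : H) : sw (fun x y => lam (y * S h) *: x) L = h.
Proof.
have ll := llam.
rewrite -(int_shiftr intL (b := fun x y => lam y *: x)); last by mlin.
under eq_sw => x y do rewrite scalerAl.
by rewrite -sw_mull lam_left lam_int // scale1r mul1r.
Qed.

Lemma lam_shiftl (h : H) : sw (fun x y => lam (h * y) *: x) L = S h.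
Proof.
have ll := llam.
rewrite -(int_shiftl intL (b := fun x y => lam y *: x)); last by mlin.
under eq_sw => x y do rewrite scalerAr.
by rewrite -sw_mulr lam_left lam_int // scale1r mulr1.
Qed.

Lemma antipode_inj : injective S.
Proof. by move=> g h e; rewrite -(lam_shiftr g) e lam_shiftr. Qed.

Lemma antipode_surj (h : H) : exists g, S g = h.
Proof.
have /eqP/lker0_limgf e : lker (antipode : 'End(H)) = 0%VS.
  by apply/eqP/lker0P; exact: antipode_inj.
by have /memv_imgP[g _ ->] : h \in limg antipode; [rewrite e memvf | exists g].
Qed.

Lemma lam_nondegl (x : H) : (forall c, lam (x * c) = 0) -> x = 0.
Proof.
move=> x0; apply: antipode_inj; rewrite linear0 -lam_shiftl.
rewrite (@eq_sw _ _ _ _ (fun _ _ => 0 *: (0 : H))) => [|? ?].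
  by rewrite -sw_scale scale0r.
by rewrite x0 !scale0r.
Qed.

Lemma lam_nondegr (x y : H) : (forall c, lam (c * x) = lam (c * y)) -> x = y.
Proof.
have [x' <-] := antipode_surj x; have [y' <-] := antipode_surj y => e.
by congr (S _); rewrite -[x']lam_shiftr -[y']lam_shiftr; apply: eq_sw => ? ?; rewrite e.
Qed.

(** The distinguished grouplike element, measuring how far [lam] is from being a right integral
    ([lam_modular]). It is read off at L because [lam] is 1 there. *)
Definition modular : H := sw (fun x y => lam x *: y) L.

Lemma lam_antipode (h : H) : lam (S h) = lam (h * modular).
Proof.
have ll := llam.
rewrite -lam_shiftl /modular sw_mulr !(sw_lin (W := k^o) _ _ ll).
by apply: (@eq_sw _ _ k^o) => x y; rewrite -scalerAr !(islinZ ll); apply: mulrC.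
Qed.

Lemma lam_modular_antipode (h : H) : lam (modular * S h) = lam h.
Proof.
have ll := llam.
rewrite -[in RHS](lam_shiftr h) /modular sw_mull !(sw_lin (W := k^o) _ _ ll).
by apply: (@eq_sw _ _ k^o) => x y; rewrite -scalerAl !(islinZ ll); apply: mulrC.
Qed.

(** The inverse is a preimage [s] of the modular element under S: by [lam_antipode] and
    [lam_modular_antipode], lam (h s a) = lam (S (h s)) = lam (a S h) = lam h for all h. *)
Lemma modular_inv : exists s, s * modular = 1 /\ modular * s = 1.
Proof.
have [s sE] := antipode_surj modular.
have sa : s * modular = 1.
  apply: lam_nondegr => h.
  by rewrite mulr1 mulrA -lam_antipode antipodeM sE lam_modular_antipode.
exists s; split=> //; apply/eqP; rewrite -subr_eq0; apply/eqP.
apply: antipode_inj; rewrite linear0; apply: lam_nondegl => c.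
have [c' <-] := antipode_surj c.
rewrite -antipodeM lam_antipode -mulrA mulrBl mul1r -mulrA sa mulr1 subrr mulr0.
exact: islin0 llam.
Qed.

(** Every [h] has the form [modular * S g], and shifting g across the legs of L gives q h = q L lam
    g. *)
Lemma left_integral_uniq (q : H -> k^o) : islin q ->
  (forall h, sw (fun x y => (q y : k) *: x) h = (q h : k) *: 1) -> q L = 0 ->
  forall h, q h = 0.
Proof.
move=> lq ql q0 h; have ll := llam; have [s [_ as1]] := modular_inv.
have [g gE] := antipode_surj (s * h).
rewrite -[h]mul1r -as1 -mulrA -gE /modular sw_mull (sw_lin (W := k^o) _ _ lq).
transitivity (sw (fun x y => (lam x : k) *: (q (y * S g) : k^o)) L).
  by apply: (@eq_sw _ _ k^o) => x y; rewrite -scalerAl (islinZ lq).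
rewrite -(int_shiftr intL (b := fun x y => (lam x : k) *: (q y : k^o))); last first.
  by mlin.
transitivity (lam (sw (fun x y => (q y : k) *: x) L * g)).
  rewrite sw_mull (sw_lin (W := k^o) _ _ ll); apply: (@eq_sw _ _ k^o) => x y.
  by rewrite -scalerAl (islinZ ll); apply: mulrC.
by rewrite ql q0 scale0r mul0r (islin0 ll).
Qed.

(** Each coordinate of the difference of the two sides is a left integral of the dual that vanishes
    at L. *)
Lemma lam_modular (h : H) : sw (fun x y => lam x *: y) h = lam h *: modular.
Proof.
have ll := llam.
rewrite [LHS]bcoord_sum [RHS]bcoord_sum; apply: eq_bigr => i _; congr (_ *: _).
have lb := @islin_bcoord _ H i.
pose q h : k^o := bcoord (sw (fun x y => lam x *: y) h - lam h *: modular) i.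
suff : q h = 0.
  by rewrite /q (islinD lb) (islinN lb) => /eqP; rewrite subr_eq0 => /eqP.
have qE g : q g = sw (fun x y => lam x *: (bcoord y i : k^o))
  g - lam g *: (bcoord modular i : k^o).
  rewrite /q (islinD lb) (islinN lb) (islinZ lb); congr (_ - _).
  rewrite (sw_lin (W := k^o) _ _ lb); apply: (@eq_sw _ _ k^o) => x y.
  by rewrite (islinZ lb).
have lq : islin q by rewrite /q; lin.
apply: left_integral_uniq => //; last first.
  by rewrite /q -/modular lam_int // scale1r subrr (islin0 lb).
move=> g.
pose p g : k^o := sw (fun x y => lam x *: (bcoord y i : k^o)) g.
have lp : islin p by rewrite /p; lin.
transitivity (sw (fun x y => (p y : k) *: x) g - bcoord modular i *: sw (fun x y =>
  lam y *: x) g).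
  rewrite sw_scale -sw_sub; apply: eq_sw => x y; rewrite qE scalerBl scalerA.
  by congr (_ - _ *: _); apply: mulrC.
rewrite lam_left qE scalerBl; congr (_ - _); last first.
  by rewrite scalerA; congr (_ *: _); apply: mulrC.
transitivity (sw (fun x y => sw (fun y1 y2 => lam y1 *: (bcoord y2 i *: x)) y) g).
  apply: eq_sw => x y; rewrite /p (sw_lin (f := fun c : k^o => (c : k) *: x)); last by lin.
  by apply: eq_sw => ? ?; rewrite scalerA.
rewrite -sw_coassoc; last by mlin.
rewrite (sw_lin (f := fun c : k^o => (c : k) *: (1 : H))); last by lin.
apply: eq_sw => x y.
under eq_sw => x1 x2 do rewrite scalerA mulrC -scalerA.
by rewrite -sw_scale lam_left !scalerA mulrC.
Qed.

Lemma sw_modular (V : vectType k) (b : H -> H -> V) : bilin b ->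
  sw b modular = b modular modular.
Proof.
move=> bb; have ll := llam.
rewrite {1}/modular (@sw_lin _ _ _ _ (sw b)); last by apply: islin_sw; lin.
transitivity (sw (fun x y => sw (fun y1 y2 => lam x *: b y1 y2) y) L).
  apply: eq_sw => x y; rewrite (@islinZ _ _ _ (sw b)) ?sw_scale //.
  by apply: islin_sw; lin.
rewrite -sw_coassoc; last by mlin.
transitivity (sw (fun x y => b modular (lam x *: y)) L).
  apply: eq_sw => x y.
  rewrite (islinZ (bb.2 _)) -(islinZ (bb.1 y)) -lam_modular (sw_lin _ _ (bb.1 y)).
  by apply: eq_sw => ? ?; rewrite (islinZ (bb.1 y)).
by rewrite -(sw_lin _ _ (bb.2 _)).
Qed.

Lemma sw_modularX (V : vectType k) (b : H -> H -> V) j : bilin b ->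
  sw b (modular ^+ j) = b (modular ^+ j) (modular ^+ j).
Proof.
elim: j V b => [|j IHj] V b bb; first by rewrite !expr0 sw1.
rewrite exprS swM // sw_modular; last by mlin.
by rewrite IHj //; mlin.
Qed.

(* Compare the two ways of moving a factor around [lam]: on [lam] itself and on
   [lam \o S], which is [lam] translated by the modular element. *)
Lemma modular_antipode4 (h : H) : h * modular = modular * S (S (S (S h))).
Proof.
apply: lam_nondegr => c; rewrite mulrA -lam_antipode antipodeM lam_twist -!antipodeM.
by rewrite lam_antipode -mulrA lam_twist -mulrA.
Qed.

(** At the grouplike a^j, [lam_modular] says lam (a^j) a^j = lam (a^j) a. A nonzero value would
    force a^j = a, but lam a = lam (S 1) = 0. *)
Lemma lam_modularX j : lam (1 : H) = 0 -> lam (modular ^+ j) = 0.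
Proof.
move=> l1; apply/eqP/contraT => /negPf nz.
have ll := llam.
have : modular ^+ j = modular.
  apply/eqP; rewrite -subr_eq0 -[_ == _]/(false || _) -nz -scaler_eq0 scalerBr.
  rewrite -[X in _ - X]lam_modular sw_modularX ?subrr //; mlin.
by move=> aj; move: nz; rewrite aj -[modular]mul1r -lam_antipode antipode1 l1 eqxx.
Qed.

End Modular.

(** * Representations of separable algebras *)

Section Rep.
Variables (k : closedFieldType) (A : vectType k).
Variables (mul : A -> A -> A) (one : A).
Hypotheses (mulb : bilin mul) (mulA : associative mul).
Hypotheses (mul1x : left_id one mul) (mulx1 : right_id one mul).

Definition isrep n (r : A -> 'M[k]_n) :=
  [/\ islin r, forall x y, r (mul x y) = r x *m r y & r one = 1%:M].

(* Scalar commutant; by [rep_summand] this is irreducibility when [mul] has a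
   Casimir element. *)
Definition irr_rep n (r : A -> 'M[k]_n) :=
  [/\ isrep r, (0 < n)%N &
      forall T, (forall x, T *m r x = r x *m T) -> is_scalar_mx T].

(* [{classic _}] only provides decidable equality. *)
Definition family : Type := {classic {n : nat & A -> 'M[k]_n}}.
Definition Family n (r : A -> 'M[k]_n) : family := existT _ n r.
Definition deg_rep (s : family) : nat := projT1 s.
Definition fun_rep (s : family) : A -> 'M[k]_(deg_rep s) := projT2 s.

(** * Separating representations by their kernels *)

Section Separation.

Lemma rep_sep n m (r : A -> 'M[k]_n) (s : A -> 'M[k]_m) x :
  isrep r -> isrep s -> (forall B, exists y, s y = B) -> r x = 0 -> s x <> 0 ->
  exists e, r e = 0 /\ s e = 1%:M.
Proof.
move=> [lr rM r1] [ls sM s1] surj rx0 sx0.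
have /'exists_existsP[i [j sxij]] : [exists i, exists j, s x i j != 0].
  apply/contraT => /existsPn nz; case: sx0; apply/matrixP => i j; rewrite mxE.
  by have /existsPn/(_ j)/negPn/eqP := nz i.
have /choice[f fE] l : exists y, s y = (s x i j)^-1 *: delta_mx l i by exact: surj.
have /choice[g gE] l : exists y, s y = delta_mx j l by exact: surj.
exists (\sum_l mul (mul (f l) x) (g l)); split.
  rewrite (islin_big _ _ _ lr) big1 // => l _.
  by rewrite !rM rx0 mulmx0 mul0mx.
rewrite (islin_big _ _ _ ls); apply/matrixP => u v; rewrite summxE.
transitivity (\sum_l ((l == u)%:R * (l == v)%:R) : k).
  apply: eq_bigr => l _; rewrite !sM fE gE -scalemxAl -scalemxAl mxE.
  rewrite (_ : delta_mx l i = delta_mx l ord0 *m delta_mx (ord0 : 'I_1) i); last first.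
    by rewrite mul_delta_mx.
  rewrite (_ : delta_mx j l = delta_mx j ord0 *m delta_mx (ord0 : 'I_1) l); last first.
    by rewrite mul_delta_mx.
  rewrite -!mulmxA [s x *m _]mulmxA -colE [delta_mx _ i *m (_ *m _)]mulmxA -rowE.
  rewrite (_ : row i (col j (s x)) = (s x i j)%:M); last first.
    by apply/matrixP => a b; rewrite !ord1 !mxE eqxx mulr1n.
  rewrite mul_scalar_mx -scalemxAr mxE mulrA mulVf // mul1r mul_delta_mx mxE.
  by rewrite -natrM mulnb ![l == _]eq_sym.
rewrite mxE; have [->|nuv] := eqVneq u v.
  rewrite (bigD1 v) //= eqxx mulr1 big1 ?addr0 // => l /negPf ->.
  by rewrite mul0r.
by rewrite big1 // => l _; case: eqVneq => [->|_]; rewrite ?mul0r // (negPf nuv) mulr0.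
Qed.

(** Otherwise [rep_sep] yields an element that [s] kills and [r] sends to 1. Its difference with
    [one] is killed by [r], hence by [s], so 0 = 1 in matrices of positive size. *)
Lemma rep_ker_eq n m (r : A -> 'M[k]_n) (s : A -> 'M[k]_m) :
  isrep r -> isrep s -> (forall B, exists y, r y = B) ->
  (0 < m)%N -> (forall x, r x = 0 -> s x = 0) -> forall x, s x = 0 -> r x = 0.
Proof.
move=> rr rs surj m0 rs0 x sx0; apply: contrapT => rx0.
have [e [se re]] := rep_sep rs rr surj sx0 rx0.
have [[lr _ r1] [ls _ s1]] := (rr, rs).
have /rs0 : r (e - one) = 0 by rewrite (islinD lr) (islinN lr) re r1 subrr.
rewrite (islinD ls) (islinN ls) se s1 sub0r => /eqP; rewrite oppr_eq0 => /eqP.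
case: m s m0 {rs0 sx0 rs se ls s1} => // m s _.
by move/matrixP/(_ ord0 ord0)/eqP; rewrite !mxE eqxx oner_eq0.
Qed.

Lemma rep_sep_seq m (s : A -> 'M[k]_m) (l : seq family) :
  isrep s -> (forall r, r \in l -> isrep (fun_rep r)) ->
  (forall r, r \in l -> exists e, fun_rep r e = 0 /\ s e = 1%:M) ->
  exists e, s e = 1%:M /\ forall r, r \in l -> fun_rep r e = 0.
Proof.
move=> rs; have [ls sM s1] := rs.
elim: l => [|t l IHl] rl el; first by exists one.
have [||e [se e0]] := IHl; first by move=> r rl'; apply: rl; rewrite inE rl' orbT.
  by move=> r rl'; apply: el; rewrite inE rl' orbT.
have [f [tf sf]] := el t (mem_head _ _).
exists (mul e f); split=> [|r]; first by rewrite sM se sf mulmx1.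
move=> rtl; have [_ rM _] := rl r rtl; rewrite rM.
by move: rtl; rewrite inE => /predU1P[->|/e0 ->]; rewrite ?tf ?mulmx0 ?mul0mx.
Qed.

(** Chinese remainder theorem: the elements of [rep_sep_seq] are 1 in one representation and 0 in
    the others. *)
Lemma rep_joint_surj (s : seq family) : uniq s ->
  (forall r, r \in s -> isrep (fun_rep r)) ->
  (forall r, r \in s -> forall B, exists x, fun_rep r x = B) ->
  (forall r t, r \in s -> t \in s -> r <> t ->
     exists e, fun_rep r e = 0 /\ fun_rep t e = 1%:M) ->
  forall B : forall r, 'M[k]_(deg_rep r),
    exists x, forall r, r \in s -> fun_rep r x = B r.
Proof.
move=> us rs surj sep B.
have /choice[f fE] (t : family) : exists z, t \in s ->
    fun_rep t z = B t /\ forall r, r \in s -> r <> t -> fun_rep r z = 0.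
  have [ts|] := boolP (t \in s); last by exists one.
  have [||e [te e0]] := @rep_sep_seq _ (fun_rep t) (rem t s) (rs t ts).
  - by move=> r /mem_rem; apply: rs.
  - move=> r; rewrite mem_rem_uniq // inE => /andP[/eqP rt rs'].
    exact: sep.
  have [y yE] := surj t ts (B t); exists (mul y e) => _.
  have [_ tM _] := rs t ts; rewrite tM yE te mulmx1; split=> // r rs' rt.
  have [_ rM _] := rs r rs'; rewrite rM e0 ?mulmx0 //.
  by rewrite mem_rem_uniq // inE; apply/andP; split=> //; apply/eqP.
exists (\sum_(t <- s) f t) => r rs'; have [lr _ _] := rs r rs'.
rewrite (islin_big _ _ _ lr) (bigD1_seq r) //= big_seq_cond big1 ?addr0 => [|t].
  by have [] := fE r rs'.
by move=> /andP[ts /eqP tr]; have [_] := fE t ts; apply=> //; apply/nesym.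
Qed.

End Separation.

Variables (m : nat) (ca cb : 'I_m -> A).
(* A separability idempotent. *)
Hypothesis casimir : forall x,
  \sum_t tens (mul x (ca t)) (cb t) = \sum_t tens (ca t) (mul (cb t) x).
Hypothesis casimir1 : \sum_t mul (ca t) (cb t) = one.

Section Average.
Variables (n : nat) (r : A -> 'M[k]_n).
Hypothesis rr : isrep r.

Let lr : islin r. Proof. by case: rr. Qed.
Let rM x y : r (mul x y) = r x *m r y. Proof. by case: rr. Qed.
Let r1 : r one = 1%:M. Proof. by case: rr. Qed.

(** Averaging over the separability idempotent, the substitute for the mean over a finite group; the
    result lies in the commutant. *)
Definition avg P := \sum_t r (ca t) *m P *m r (cb t).

Lemma avgC P x : r x *m avg P = avg P *m r x.
Proof.
pose b u v : 'M[k]_n := r u *m P *m r v.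
have bb : bilin b.
  split=> u a y z; first by rewrite /b lr !mulmxDl -!scalemxAl.
  by rewrite /b lr mulmxDr -scalemxAr.
have := congr1 (tlift b) (casimir x); rewrite !(linear_sum (tlift b))
  /avg mulmx_sumr mulmx_suml.
move=> /= e; transitivity (\sum_t tlift b (tens (mul x (ca t)) (cb t))).
  by apply: eq_bigr => t _; rewrite tliftE // /b rM !mulmxA.
by rewrite e; apply: eq_bigr => t _; rewrite tliftE // /b rM !mulmxA.
Qed.

(** Maschke's argument: the average of a linear projection onto U still maps into U and, by
    [casimir1], still fixes U. Modules are spaces of row vectors, acted on from the right. *)
Lemma rep_summand (U : 'M[k]_n) : (forall x, (U *m r x <= U)%MS) ->
  exists P, [/\ forall x, P *m r x = r x *m P, P *m P = P & (P :=: U)%MS].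
Proof.
move=> Ur.
have [P0 P0U P0s] : exists2 P0 : 'M[k]_n,
    forall m' (W : 'M_(m', n)), (W <= U)%MS -> W *m P0 = W &
    forall m' (W : 'M_(m', n)), (W *m P0 <= U)%MS.
  exists (pinvmx U *m U) => m' W => [WU|]; first by rewrite mulmxA mulmxKpV.
  by rewrite mulmxA submxMl.
have avgU (m' : nat) (W : 'M_(m', n)) : (W <= U)%MS -> W *m avg P0 = W.
  move=> WU; rewrite /avg mulmx_sumr; transitivity (\sum_t W *m r (mul (ca t) (cb t))).
    apply: eq_bigr => t _; rewrite !mulmxA P0U ?rM ?mulmxA //.
    exact: submx_trans (submxMr _ WU) (Ur _).
  by rewrite -mulmx_sumr -(islin_big _ _ _ lr) casimir1 r1 mulmx1.
have PU : (avg P0 <= U)%MS.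
  rewrite /avg; apply: summx_sub => t _.
  exact: submx_trans (submxMr _ (P0s _ _)) (Ur _).
exists (avg P0); split; [by move=> x; rewrite avgC | exact: avgU |].
by apply/eqmxP; rewrite PU -{1}(avgU _ U) ?submxMl.
Qed.

(** The orbit of [v] is a submodule, so the commuting projection onto it is a scalar, nonzero
    because the orbit contains [v]. *)
Lemma rep_orbit (v : 'rV[k]_n) : irr_rep r -> v != 0 ->
  forall u : 'rV_n, exists x, v *m r x = u.
Proof.
move=> [_ n0 irr] v0 u.
pose G := \matrix_(i < dimT A) (v *m r (bvec i)).
have GP (w : 'rV_n) : (w <= G)%MS -> exists x, w = v *m r x.
  move=> /submxP[D ->]; exists (\sum_i D 0 i *: bvec i).
  rewrite (islin_big _ _ _ lr) mulmx_sumr mulmx_sum_row; apply: eq_bigr => i _.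
  by rewrite rowK (islinZ lr) -scalemxAr.
have PG x : (v *m r x <= G)%MS.
  rewrite [x]bcoord_sum (islin_big _ _ _ lr) mulmx_sumr summx_sub // => i _.
  by rewrite (islinZ lr) -scalemxAr scalemx_sub // -(rowK (fun i => v *m r (bvec i)))
    row_sub.
have [|P [Pr PP PG']] := @rep_summand <<G>>%MS.
  move=> x; rewrite (eqmxMr _ (genmxE G)) genmxE; apply/row_subP => i.
  by rewrite row_mul rowK -mulmxA -rM PG.
have /is_scalar_mxP[c cE] := irr P Pr.
have vG : (v <= G)%MS by rewrite -[v]mulmx1 -r1 PG.
have c0 : c != 0.
  apply: contra v0 => /eqP c0; rewrite -submx0 (submx_trans vG) //.
  by rewrite -(genmxE G) -PG' cE c0 -scalemx1 scale0r submx_refl.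
have [|x ->] := GP u; last by exists x.
rewrite -(genmxE G) -PG' cE -[u]mul1mx.
have -> : 1%:M *m u = (c^-1 *: u) *m c%:M.
  by rewrite mul_mx_scalar scalerA mulfV // scale1r mul1mx.
exact: submxMl.
Qed.

(** Schur orthogonality: the average of the matrix unit E_jl is a scalar c_jl. Fixing j with c_jl
    nonzero for some l, the elements [X i] act by the rank-one matrices with column g = (c_jl)_l in
    position i. By [rep_orbit] no nonzero row is orthogonal to all r(y) g, so these columns fill the
    space and the products y X_i reach every matrix. *)
Lemma burnside : irr_rep r -> forall B, exists x, r x = B.
Proof.
move=> ir; have [_ n0 irr] := ir; move=> B.
have /choice[c' cE'] P : exists c, avg P = c%:M.
  by apply/is_scalar_mxP/irr => x; rewrite avgC.
pose c j l := c' (delta_mx j l).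
have cE i j l w : \sum_t r (ca t) i j * r (cb t) l w = c j l *+ (i == w).
  have /matrixP/(_ i w) := cE' (delta_mx j l); rewrite summxE [RHS]mxE => <-.
  apply: eq_bigr => t _.
  rewrite (_ : delta_mx j l = delta_mx j ord0 *m delta_mx (ord0 : 'I_1) l); last first.
    by rewrite mul_delta_mx.
  by rewrite -!mulmxA mulmxA -colE -rowE mxE big_ord1 !mxE.
have [j [l cjl]] : exists j l, c j l != 0.
  apply: contrapT => nc; have c0 j l : c j l = 0.
    by apply/eqP/contraT => /negPn cjl; case: nc; exists j, l; apply/negPn.
  have : avg 1%:M = 1%:M.
    by rewrite /avg -[RHS]r1 -casimir1 (islin_big _ _ _ lr); apply: eq_bigr => t _;
      rewrite mulmx1 rM.
  move=> /matrixP/(_ (Ordinal n0) (Ordinal n0)); rewrite summxE mxE eqxx.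
  under eq_bigr => t _ do (rewrite mulmx1 mxE; idtac).
  rewrite exchange_big big1 => [/eqP|i _]; first by rewrite eq_sym oner_eq0.
  by rewrite cE c0 mul0rn.
pose g : 'cV[k]_n := \col_l' c j l'.
have g0 : g != 0 by apply: contra cjl => /eqP/matrixP/(_ l ord0); rewrite !mxE => ->.
pose X i := \sum_t r (ca t) i j *: cb t.
have XE i : r (X i) = g *m delta_mx ord0 i.
  apply/matrixP => u v; rewrite (islin_big _ _ _ lr) summxE !mxE big_ord1 !mxE eqxx /=.
  rewrite mulr_natr eq_sym -(cE i); apply: eq_bigr => t _.
  by rewrite (islinZ lr) mxE.
pose G := \matrix_(i < n, t < dimT A) (r (bvec t) *m g) i ord0.
have GE x : r x *m g = G *m \col_t bcoord x t.
  apply/matrixP => i z; rewrite ord1 [RHS]mxE [x in LHS]bcoord_sum (islin_big _ _ _ lr).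
  rewrite mulmx_suml summxE; apply: eq_bigr => t _; rewrite (islinZ lr) -scalemxAl.
  by rewrite [LHS]mxE [X in _ = X * _]mxE [X in _ = _ * X]mxE mulrC.
have freeG : row_free G.
  rewrite -kermx_eq0; apply/contraT => /rowV0Pn[u /sub_kermxP uG u0].
  case/negP: g0; apply/eqP/matrixP => i z; rewrite ord1.
  have [x ux] := rep_orbit ir u0 (delta_mx 0 i).
  have /matrixP/(_ 0 0) : delta_mx 0 i *m g = 0 :> 'M_1.
    by rewrite -ux -mulmxA GE mulmxA uG mul0mx.
  by rewrite -rowE !mxE.
have surjg (w : 'cV_n) : exists y, r y *m g = w.
  pose y := pinvmx G *m w; exists (\sum_t y t ord0 *: bvec t).
  rewrite GE -[w]mul1mx -(mulmxVp freeG) -mulmxA; congr (_ *m _).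
  apply/colP => t; rewrite mxE -[RHS]/(y t ord0).
  have lb := @islin_bcoord _ A t.
  rewrite (islin_big _ _ _ lb) (bigD1 t) //= (islinZ lb) big1 => [|i /negPf ni].
    by rewrite bcoord_bvec eqxx addr0 [_ *: _]mulr1.
  by rewrite (islinZ lb) bcoord_bvec ni [_ *: _]mulr0.
have /choice[y yE] i := surjg (col i B).
exists (\sum_i mul (y i) (X i)); rewrite (islin_big _ _ _ lr).
apply/matrixP => u v; rewrite summxE (bigD1 v) //= big1 => [|i /negPf ni].
  by rewrite rM XE mulmxA yE mxE big_ord1 !mxE !eqxx mulr1 addr0.
by rewrite rM XE mulmxA yE mxE big_ord1 !mxE eqxx eq_sym ni mulr0.
Qed.

End Average.

(** A rank factorisation P = C R with R C = 1 puts coordinates on the image of P; compression to R r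
    C is multiplicative because C R commutes with r. *)
Lemma rep_cut n (r : A -> 'M[k]_n) (P : 'M[k]_n) :
  isrep r -> (forall x, P *m r x = r x *m P) -> P *m P = P ->
  exists d (r' : A -> 'M[k]_d), [/\ d = \rank P, isrep r',
    forall x, \tr (r x *m P) = \tr (r' x) & forall x, r' x = 0 -> r x *m P = 0].
Proof.
move=> [lr rM r1] Pr PP.
have [d [C [R [dE CR RC]]]] : exists d (C : 'M[k]_(n, d)) (R : 'M[k]_(d, n)),
    [/\ d = \rank P, C *m R = P & R *m C = 1%:M].
  exists (\rank P).
  move: (mulmx_base P) (col_base_full P) (row_base_free P).
  move: (col_base P) (row_base P) => C R CR fC fR; exists C, R; split=> //.
  apply: (row_full_inj fC); apply: (row_free_inj fR).
  by rewrite mulmx1 mulmxA CR -mulmxA CR PP.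
exists d, (fun x => R *m r x *m C); split=> //.
- split=> [a x y|x y|]; last by rewrite r1 mulmx1.
    by rewrite lr mulmxDr mulmxDl -scalemxAr -scalemxAl.
  rewrite rM -!mulmxA [C *m (R *m _)]mulmxA CR [P *m (r y *m C)]mulmxA Pr.
  have PC : P *m C = C by rewrite -CR -mulmxA RC mulmx1.
  by rewrite -[r y *m P *m C]mulmxA PC.
- by move=> x; rewrite -CR mulmxA mxtrace_mulC mulmxA.
- move=> x e; rewrite -PP mulmxA -Pr -CR -!mulmxA [r x *m _]mulmxA.
  by rewrite [R *m (_ *m R)]mulmxA [R *m (r x *m C)]mulmxA e mul0mx mulmx0.
Qed.

(** An eigenspace of a non-scalar element of the commutant is a proper nonzero submodule. *)
Lemma rep_split n (r : A -> 'M[k]_n) : isrep r -> (0 < n)%N -> ~ irr_rep r ->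
  exists P, [/\ forall x, P *m r x = r x *m P, P *m P = P, P != 0 & P != 1%:M].
Proof.
move=> rr n0 nirr.
have [T TC Ts] : exists2 T, forall x, T *m r x = r x *m T & ~~ is_scalar_mx T.
  apply: contrapT => nT; apply: nirr; split=> // T TC.
  by apply/contraT => Ts; case: nT; exists T.
have [c cT] : exists c, root (char_poly T) c.
  by apply/closed_rootP; rewrite size_char_poly; case: (n) n0.
pose U := kermx (T - c%:M).
have cTr x : (T - c%:M) *m r x = r x *m (T - c%:M).
  by rewrite mulmxBl mulmxBr TC scalar_mxC.
have [x|P [Pr PP PU]] := rep_summand rr (U := U).
  by apply/sub_kermxP; rewrite -mulmxA -cTr mulmxA mulmx_ker mul0mx.
exists P; split=> //.
  rewrite -mxrank_eq0 PU mxrank_eq0.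
  by rewrite -eigenvalue_root_char in cT; exact: cT.
apply: contra Ts => /eqP P1; apply/is_scalar_mxP; exists c; apply/eqP.
rewrite -subr_eq0 -[_ - _]mul1mx -submx0.
have /sub_kermxP -> : (1%:M <= U)%MS by rewrite -PU P1.
exact: submx_refl.
Qed.

(** No change of basis is recorded: traces and the joint kernel of the constituents suffice for
    every later use. *)
Lemma rep_decomp n (r : A -> 'M[k]_n) : isrep r -> exists s : seq family,
  [/\ forall t, t \in s -> irr_rep (fun_rep t),
      forall x, \tr (r x) = \sum_(t <- s) \tr (fun_rep t x)
    & forall x, (forall t, t \in s -> fun_rep t x = 0) -> r x = 0].
Proof.
elim: {n}n.+1 {-2}n (ltnSn n) r => // N IHN n nN r rr.
have [n0|n0] := posnP n.
  subst n; exists [::]; split=> // x; first by rewrite big_nil /mxtrace big_ord0.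
  by move=> _; apply: flatmx0.
have [ir|nir] := pselect (irr_rep r).
  exists [:: Family r]; split=> [t|x|x]; first by rewrite inE => /eqP ->.
    by rewrite big_seq1.
  by move=> x0; apply: (x0 (Family r) (mem_head _ _)).
have [P [Pr PP P0 P1]] := rep_split rr n0 nir.
pose Q := 1%:M - P.
have Qr x : Q *m r x = r x *m Q by rewrite mulmxBl mulmxBr mul1mx mulmx1 Pr.
have QQ : Q *m Q = Q by rewrite /Q mulmxBl mul1mx mulmxBr mulmx1 PP subrr subr0.
have PQ : P *m Q = 0 by rewrite mulmxBr mulmx1 PP subrr.
have ltrk (P' Q' : 'M[k]_n) : P' *m Q' = 0 -> Q' != 0 -> (\rank P' < n)%N.
  move=> PQ' nz; rewrite ltn_neqAle rank_leq_row andbT.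
  apply: contra nz => rk; have : P' \in unitmx by rewrite -row_free_unit.
  by move=> uP; rewrite -[Q']mul1mx -(mulVmx uP) -mulmxA PQ' mulmx0.
have QP : Q *m P = 0 by rewrite mulmxBl mul1mx PP subrr.
have Q0 : Q != 0 by rewrite subr_eq0 eq_sym.
have [d1 [r1 [d1E rr1 tr1 k1]]] := rep_cut rr Pr PP.
have [d2 [r2 [d2E rr2 tr2 k2]]] := rep_cut rr Qr QQ.
have [|s1 [i1 t1 z1]] := IHN _ _ r1 rr1; first by rewrite d1E (leq_trans (ltrk P Q PQ Q0)).
have [|s2 [i2 t2 z2]] := IHN _ _ r2 rr2; first by rewrite d2E (leq_trans (ltrk Q P QP P0)).
have rE x : r x = r x *m P + r x *m Q by rewrite -mulmxDr addrC subrK mulmx1.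
exists (s1 ++ s2); split=> [t|x|x z].
- by rewrite mem_cat => /orP[/i1|/i2].
- by rewrite rE raddfD /= tr1 tr2 t1 t2 big_cat.
- rewrite rE k1 ?k2 ?addr0 //; first by apply: z2 => t ts; apply: z;
  rewrite mem_cat ts orbT.
  by apply: z1 => t ts; apply: z; rewrite mem_cat ts.
Qed.

Definition reg_rep (x : A) : 'M[k]_(dimT A) :=
  \matrix_(i, j) bcoord (mul (bvec i) x) j.

Lemma reg_rep_isrep : isrep reg_rep.
Proof.
split=> [a x y|x y|]; apply/matrixP => i j; rewrite !mxE.
- by rewrite mulb.2 islin_bcoord.
- rewrite mulA [mul (bvec i) x in LHS]bcoord_sum.
  rewrite (islin_big _ _ _ (mulb.1 y)) (islin_big _ _ _ (islin_bcoord j)).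
  apply: eq_bigr => l _.
  by rewrite (islinZ (mulb.1 y)) (islinZ (islin_bcoord j)) !mxE.
- by rewrite mulx1 bcoord_bvec.
Qed.

Lemma reg_rep_eq0 x : reg_rep x = 0 -> x = 0.
Proof.
move=> x0; rewrite -[x]mul1x [one]bcoord_sum (islin_big _ _ _ (mulb.1 x)).
apply: big1 => i _; rewrite (islinZ (mulb.1 x)) [mul _ _]bcoord_sum big1 ?scaler0 // => j _.
by have /matrixP/(_ i j) := x0; rewrite !mxE => ->; rewrite scale0r.
Qed.

Lemma wedderburn : exists s : seq family,
  [/\ uniq s, forall t, t \in s -> irr_rep (fun_rep t),
      forall x, (forall t, t \in s -> fun_rep t x = 0) -> x = 0 &
      forall B : (forall t, 'M[k]_(deg_rep t)),
        exists x, forall t, t \in s -> fun_rep t x = B t].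
Proof.
have [s0 [irr0 _ ker0]] := rep_decomp reg_rep_isrep.
have {ker0} ker0 x : (forall t, t \in s0 -> fun_rep t x = 0) -> x = 0.
  by move/ker0; apply: reg_rep_eq0.
have surj t : irr_rep (fun_rep t) -> forall B, exists x, fun_rep t x = B.
  by move=> it; apply: burnside => //; case: it.
have [s [us irrs sep kers]] : exists s : seq family, [/\ uniq s,
    forall t, t \in s -> irr_rep (fun_rep t),
    forall r t, r \in s -> t \in s -> r <> t ->
      exists e, fun_rep r e = 0 /\ fun_rep t e = 1%:M &
    forall x, (forall t, t \in s -> fun_rep t x = 0) ->
      (forall t, t \in s0 -> fun_rep t x = 0)].
  elim: s0 irr0 {ker0} => [|t0 s0 IH] irr0; first by exists [::].
  have [t ts|s [us irrs sep kers]] := IH; first by apply: irr0; rewrite inE ts orbT.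
  have irr_t0 : irr_rep (fun_rep t0) := irr0 _ (mem_head _ _).
  (* Repetitions are detected through kernels: [t0] is dropped when it vanishes on the kernel of a
     representation already kept. *)
  have [[t ts tt0]|ns] :=
      pselect (exists2 t, t \in s & forall x, fun_rep t x = 0 -> fun_rep t0 x = 0).
    exists s; split=> // x x0 t'; rewrite inE => /predU1P[->|]; last exact: kers.
    by apply: tt0; apply: x0.
  have st t : t \in s -> (exists e, fun_rep t e = 0 /\ fun_rep t0 e = 1%:M) /\
                         (exists e, fun_rep t0 e = 0 /\ fun_rep t e = 1%:M).
    move=> ts; have [[rt t_gt0 _] [rt0 t0_gt0 _]] := (irrs t ts, irr_t0).
    have [x tx t0x] : exists2 x, fun_rep t x = 0 & fun_rep t0 x <> 0.
      apply: contrapT => nx; apply: ns; exists t => // x tx.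
      by apply: contrapT => t0x; apply: nx; exists x.
    split; first exact: rep_sep rt rt0 (surj _ irr_t0) tx t0x.
    have [y ty t0y] : exists2 y, fun_rep t0 y = 0 & fun_rep t y <> 0.
      apply: contrapT => ny; apply: t0x.
      apply: (rep_ker_eq rt0 rt (surj _ irr_t0) t_gt0) => // z t0z.
      by apply: contrapT => tz; apply: ny; exists z.
    exact: rep_sep rt0 rt (surj _ (irrs t ts)) ty t0y.
  exists (t0 :: s); split.
  - rewrite /= us andbT; apply/negP => t0s; apply: ns; exists t0 => //.
  - by move=> t; rewrite inE => /predU1P[->|/irrs].
  - move=> r t; rewrite !inE => /predU1P[->|rs] /predU1P[->|ts] // rt.
    + by have [] := st t ts.
    + by have [] := st r rs.
    + exact: sep.
  - move=> x x0 t; rewrite inE => /predU1P[->|ts]; first by apply: x0; exact: mem_head.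
    by apply: kers ts => t' ts'; apply: x0; rewrite inE ts' orbT.
exists s; split=> // [x /kers/ker0 //|]; apply: rep_joint_surj => // r rs.
  by have [] := irrs r rs.
exact/surj/irrs.
Qed.

End Rep.

(** * Power sums of eigenvalues *)

Section PowerSums.
Variable k : closedFieldType.

Lemma mxtrace_powers n (W : 'M[k]_n) :
  exists r : seq k, forall j, \tr (W ^+ j) = \sum_(z <- r) z ^+ j.
Proof.
elim: n W => [|n IHn] W.
  by exists [::] => j; rewrite big_nil /mxtrace big_ord0.
have [c cW] : exists c, root (char_poly W) c.
  by apply/closed_rootP; rewrite size_char_poly.
rewrite -eigenvalue_root_char in cW; have /eigenvalueP[v vW v0] := cW.
(* The first row of this invertible matrix is proportional to the eigenvector, so conjugating by it
   makes W block triangular with corner [c]. *)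
pose E := row_ebase v; have uE : E \in unitmx := row_ebase_unit v.
have [d vE] : exists d, v = d *: row 0 E.
  exists (col_ebase v 0 0); rewrite -[LHS](mulmx_ebase v) -/E rank_rV v0.
  apply/rowP => j; rewrite [in LHS]mxE [RHS]mxE.
  rewrite (bigD1 ord0) //= big1 => [|i ni].
    by rewrite addr0 !mxE big_ord1 !mxE /= mulr1.
  rewrite mxE big_ord1 [pid_mx _ _ _]mxE /= eq_sym.
  by rewrite -[_ == _]/(i == ord0) (negPf ni) mulr0 mul0r.
have d0 : d != 0 by apply: contra v0 => /eqP d0; rewrite vE d0 scale0r.
have EW : row 0 E *m W = c *: row 0 E.
  apply: (scalerI d0); rewrite scalemxAl -vE vW {1}vE !scalerA mulrC.
  by [].
have [W' W'D] : exists W' : 'M[k]_(1 + n), W' = E *m W *m invmx E by eexists.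
have W'E : row 0 W' = c *: delta_mx 0 0.
  rewrite W'D !row_mul EW -scalemxAl; congr (_ *: _).
  by rewrite -row_mul mulmxV // row1.
pose D := drsubmx W'; pose B := dlsubmx W'.
have WB : W' = block_mx c%:M 0 B D.
  rewrite -[LHS]submxK; congr (block_mx _ _ _ _); apply/matrixP => i j.
    rewrite !ord1 !mxE; have /rowP/(_ (lshift n 0)) := W'E.
    by rewrite !mxE lshift0 eqxx mulr1 => <-; congr (W' _ _); apply: val_inj.
  rewrite !ord1 !mxE; have /rowP/(_ (rshift 1 j)) := W'E.
  by rewrite !mxE /= mulr0 => <-; congr (W' _ _); apply: val_inj.
have WX j : exists B', W' ^+ j = block_mx (c ^+ j)%:M 0 B' (D ^+ j).
  elim: j => [|j [B' IHj]]; first by exists 0; rewrite !expr0 -scalar_mx_block.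
  rewrite !exprS IHj WB -[_ * _]/(_ *m _) mulmx_block.
  by rewrite !mulmx0 !mul0mx !addr0 add0r -scalar_mxM; eexists.
have [r rE] := IHn D; exists (c :: r) => j.
have -> : \tr (W ^+ j) = \tr (W' ^+ j).
  have -> : W' ^+ j = E *m W ^+ j *m invmx E.
    elim: j => [|j IHj]; first by rewrite !expr0 mulmx1 mulmxV.
    rewrite exprS IHj exprS -![_ * _]/(_ *m _) W'D !mulmxA.
    by rewrite mulmxKV.
  by rewrite mxtrace_mulC mulmxA mulVmx // mul1mx.
have [B' ->] := WX j; rewrite big_cons (mxtrace_block (c ^+ j)%:M) rE.
by rewrite mxtrace_scalar mulr1n.
Qed.

(* The rational row spaces of [M] and of its Gram matrix agree; the integer
   [d] clears the denominators. *)
Lemma int_gram p q (M : 'M[int]_(p, q)) :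
  exists2 d : int, d != 0 & exists X, d *: M = X *m (M^T *m M).
Proof.
pose f m n := @map_mx _ _ (intr : int -> rat) m n.
pose G := f _ _ M.
(* The point where positivity is used: y y^T is a sum of rational squares. *)
have kerG (v : 'rV[rat]_q) : v *m (G^T *m G) = 0 -> v *m G^T = 0.
  move=> vG; have [y yE] : exists y, y = v *m G^T by eexists.
  have : y *m y^T = 0 by rewrite yE trmx_mul trmxK mulmxA -[v *m _ *m _]mulmxA vG mul0mx.
  move=> /matrixP/(_ 0 0); rewrite [RHS]mxE mxE => /eqP.
  rewrite Num.Theory.psumr_eq0 => [/allP y0|i _];
    last by rewrite mxE -expr2 Num.Theory.sqr_ge0.
  rewrite -yE; apply/rowP => i; have := y0 i (mem_index_enum _).
  by rewrite !mxE -expr2 sqrf_eq0 => /eqP.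
have kers : (kermx (G^T *m G) <= kermx G^T)%MS.
  apply/row_subP => i; apply/sub_kermxP/kerG.
  by rewrite -row_mul mulmx_ker row0.
have rk : \rank (G^T *m G) = \rank G.
  apply/eqP; rewrite eqn_leq mxrankM_maxr /= -(mxrank_tr G).
  have := mxrankS kers; rewrite !mxrank_ker.
  have := rank_leq_row G^T; move: (\rank G^T) (\rank (G^T *m G)) => a b; lia.
have /submxP[X XE] : (G <= G^T *m G)%MS.
  by rewrite -(geq_leqif (mxrank_leqif_sup (submxMl G^T G))) rk.
pose d : int := \prod_i \prod_j denq (X i j).
have d0 : d != 0.
  by apply/prodf_neq0 => i _; apply/prodf_neq0 => j _; exact: denq_neq0.
have dX i j : exists n : int, d%:~R * X i j = n%:~R.
  exists (numq (X i j) * \prod_(l | l != j) denq (X i l) *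
          \prod_(l | l != i) \prod_j denq (X l j)).
  rewrite /d (bigD1 i) //= (bigD1 j) //= !intrM -[X in _ * X = _]divq_num_den.
  set c := (denq (X i j))%:~R; have c0 : c != 0 :> rat by rewrite intr_eq0 denq_neq0.
  by rewrite -!mulrA mulrCA [in LHS]mulrC !mulrA; field.
have /choice[Y YE] ij := dX ij.1 ij.2.
exists d => //; exists (\matrix_(i, j) Y (i, j)).
apply/matrixP => i j; apply: (@intr_inj rat).
have /matrixP/(_ i j) := congr1 (fun Z => d%:~R *: Z) XE.
rewrite scalemxAl !mxE -intrM => ->; rewrite rmorph_sum; apply: eq_bigr => l _ /=.
rewrite !mxE intrM -(YE (i, l)) rmorph_sum; congr (_ * _).
by apply: eq_bigr => l' _; rewrite !mxE /= intrM.
Qed.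

(** Pairing [e] with the polynomial that vanishes at all nodes other than [z] isolates e z. *)
Lemma vandermonde_eq0 (Z : seq k) (e : k -> k) : uniq Z ->
  (forall m, \sum_(z <- Z) e z * z ^+ m = 0) -> forall z, z \in Z -> e z = 0.
Proof.
move=> uZ e0 z zZ; pose p := \prod_(y <- rem z Z) ('X - y%:P).
have : \sum_(y <- Z) e y * p.[y] = 0.
  under eq_bigr => y _ do rewrite horner_coef mulr_sumr.
  rewrite exchange_big big1 // => i _ /=.
  under eq_bigr => y _ do rewrite mulrCA.
  by rewrite -mulr_sumr e0 mulr0.
rewrite (bigD1_seq z) //= big_seq_cond big1 => [|y /andP[yZ yz]].
  rewrite addr0 => /eqP; rewrite mulf_eq0 => /orP[/eqP //|].
  by rewrite -/(root _ _) root_prod_XsubC mem_rem_uniqF.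
apply/eqP; rewrite mulf_eq0 -/(root _ _) root_prod_XsubC mem_rem_uniq // inE.
by rewrite yz yZ orbT.
Qed.

(* With [M] the matrix of the differences of the multiplicities of [z] and [- z],
   and [y] the vector of all [z], the hypothesis says [M^T *m M *m y = 0]. *)
Lemma odd_sums_eq0 (rs : seq (seq k)) : [pchar k] =i pred0 ->
  (forall j, \sum_(r <- rs) (\sum_(z <- r) z) * (\sum_(z <- r) z ^+ j.*2.+1) = 0) ->
  forall r, r \in rs -> \sum_(z <- r) z = 0.
Proof.
move=> char0 rs0.
(* All eigenvalues together with their negatives, so that sums over [Z] can be reindexed by z |-> -
   z. *)
pose W := flatten rs; pose Z := undup (W ++ map -%R W).
have uZ : uniq Z := undup_uniq _.
have ZN z : (- z \in Z) = (z \in Z).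
  have NW y : (y \in map -%R W) = (- y \in W).
    by rewrite -{1}[y]opprK (mem_map (@oppr_inj k)).
  by rewrite !mem_undup !mem_cat !NW opprK orbC.
have ZNperm : perm_eq Z (map -%R Z).
  apply: uniq_perm => // [|z]; first by rewrite map_inj_uniq //; exact: oppr_inj.
  by rewrite -[z in RHS]opprK (mem_map (@oppr_inj k)) ZN.
have sZ r z : r \in rs -> z \in r -> z \in Z.
  by move=> rr zr; rewrite mem_undup mem_cat; apply/orP; left; apply/flattenP; exists r.
have sumN (g : k -> k) : \sum_(z <- Z) g (- z) = \sum_(z <- Z) g z.
  by rewrite [RHS](perm_big _ ZNperm) big_map.
pose n (r : seq k) z : int := (count_mem z r)%:Z.
have sumr r (g : k -> k) : r \in rs -> \sum_(z <- r) g z = \sum_(z <- Z) (n r z)%:~R * g z.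
  move=> rr; have := sZ r ^~ rr; elim: r {rr} => [|y r IHr] yZ.
    by rewrite big_nil big1 // => z _; rewrite mul0r.
  rewrite big_cons IHr => [|z zr]; last by apply: yZ; rewrite inE zr orbT.
  rewrite [RHS](bigD1_seq y) ?yZ ?mem_head //= [in LHS](bigD1_seq y) ?yZ ?mem_head //=.
  rewrite addrA; congr (_ + _); first by rewrite /n /= eqxx PoszD intrD mulrDl mul1r.
  by apply: eq_bigr => z /negPf zy; rewrite /n /= eq_sym zy add0n.
pose x r : k := \sum_(z <- r) z.
pose c z : k := \sum_(r <- rs) x r * (n r z)%:~R.
have cE (g : k -> k) : \sum_(z <- Z) c z * g z = \sum_(r <- rs) x r * \sum_(z <- r) g z.
  rewrite /c; under eq_bigr => z _ do rewrite mulr_suml.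
  rewrite exchange_big big_seq [RHS]big_seq; apply: eq_bigr => r rr.
  by rewrite [in RHS](sumr r) // mulr_sumr; apply: eq_bigr => z _; rewrite mulrA.
(* All moments of c z - c (- z) vanish, the even ones by the symmetry of [Z] and the odd ones by
   hypothesis. *)
have cN z : z \in Z -> c z = c (- z).
  move=> zZ; apply/eqP; rewrite -subr_eq0; apply/eqP; move: z zZ.
  apply: (@vandermonde_eq0 _ (fun z => c z - c (- z)) uZ) => m.
  under eq_bigr => z _ do rewrite mulrBl.
  rewrite sumrB -[X in _ - X]sumN; under [X in _ - X]eq_bigr => z _ do rewrite opprK exprNn.
  have [om|em] := boolP (odd m); last first.
    by under [X in _ - X]eq_bigr => z _ do rewrite -signr_odd (negPf em) mul1r;
      rewrite subrr.
  rewrite [X in X - _]cE (@cE (fun z => (-1) ^+ m * z ^+ m)).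
  under [X in _ - X]eq_bigr => r _ do rewrite -mulr_sumr mulrCA.
  rewrite -mulr_sumr; have [j ->] : exists j, m = j.*2.+1.
    by exists m./2; rewrite -[LHS]odd_double_half om.
  by rewrite rs0 mulr0 subrr.
have n0 (l : nat) : (l%:R == 0 :> k) = (l == 0%N) by apply: (pcharf0P k).1.
have z0 (d : int) : (d%:~R == 0 :> k) = (d == 0).
  by case: d => l; rewrite ?NegzE ?rmorphN ?oppr_eq0 /= -?pmulrn n0.
pose f m l := @map_mx _ _ (intr : int -> k) m l.
pose M : 'M[int]_(size rs, size Z) :=
  \matrix_(i, t) (n (nth [::] rs i) Z`_t - n (nth [::] rs i) (- Z`_t)).
pose y : 'cV[k]_(size Z) := \col_t Z`_t.
have My : f _ _ M *m y = \col_i (x (nth [::] rs i) *+ 2).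
  apply/matrixP => i t; rewrite !mxE; set r := nth _ _ _.
  have rr : r \in rs by apply: mem_nth.
  transitivity (\sum_(z <- Z) ((n r z)%:~R - (n r (- z))%:~R) * z).
    rewrite (big_nth 0) big_mkord; apply: eq_bigr => l _.
    by rewrite !mxE rmorphB.
  under eq_bigr => z _ do rewrite mulrBl.
  rewrite sumrB -[X in _ - X]sumN; under [X in _ - X]eq_bigr => z _ do rewrite opprK mulrN.
  by rewrite sumrN opprK -(@sumr r id) // mulr2n.
have MMy : f _ _ (M^T *m M) *m y = 0.
  rewrite /f map_mxM -mulmxA -/(f _ _ M) My; apply/matrixP => t l; rewrite !mxE.
  transitivity ((c Z`_t - c (- Z`_t)) *+ 2); last by rewrite -cN ?mem_nth // subrr mul0rn.
  rewrite /c !(big_nth [::]) !big_mkord -sumrB -sumrMnl; apply: eq_bigr => i _.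
  by rewrite !mxE rmorphB /= mulrnAr mulrC mulrBr.
have [d d0 [X XE]] := int_gram M.
have : d%:~R *: (f _ _ M *m y) = 0.
  rewrite scalemxAl; have -> : d%:~R *: f _ _ M = f _ _ (d *: M).
    by apply/matrixP => i t; rewrite !mxE rmorphM.
  by rewrite XE /f map_mxM -mulmxA MMy mulmx0.
rewrite My => /matrixP xE r rr.
have ri : (index r rs < size rs)%N by rewrite index_mem.
have /eqP := xE (Ordinal ri) 0; rewrite !mxE nth_index // mulf_eq0 z0 (negPf d0) /=.
by rewrite -mulr_natr mulf_eq0 n0 orbF => /eqP.
Qed.

End PowerSums.

(** * Semisimplicity implies cosemisimplicity *)

Section LarsonRadford.
Variables (k : closedFieldType) (H : hopfType k).
Local Notation S := (antipode : H -> H).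

(* [h_1 (x) h_2] as a sum indexed by the basis: [bvec i (x) swr h i]. *)
Definition swr (h : H) (i : 'I_(dimT H)) : H :=
  \sum_j (comul h : 'M_(_, _)) i j *: bvec j.

Lemma sw_swr (V : vectType k) (b : H -> H -> V) h : bilin b ->
  sw b h = \sum_i b (bvec i) (swr h i).
Proof.
move=> bb; rewrite swE; apply: eq_bigr => i _.
rewrite /swr (islin_big _ _ _ (bb.2 _)); apply: eq_bigr => j _.
by rewrite (islinZ (bb.2 _)).
Qed.

Lemma bilin_mul : bilin ( *%R : H -> H -> H).
Proof. by apply: bilinP => ?; [apply: islin_mull | apply: islin_mulr]; lin. Qed.

Section WithIntegral.
Variables (L : H) (intL : is_integral fullv L).

Lemma int_casimir_family x :
  \sum_t tens (x * bvec t) (S (swr L t)) = \sum_t tens (bvec t : H) (S (swr L t) * x).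
Proof.
have bt := tens_bilin H H.
rewrite -(sw_swr (b := fun u v => tens (x * u) (S v))); last by mlin.
rewrite -(sw_swr (b := fun u v => tens u (S v * x))); last by mlin.
exact: int_casimir.
Qed.

Lemma int_casimir_family1 : \sum_t (bvec t : H) * S (swr L t) = 1.
Proof.
rewrite -(sw_swr (b := fun u v => u * S v)); last by mlin.
by rewrite sw_antipoder; case: intL => _ _ _ ->; rewrite scale1r.
Qed.

Lemma hopf_wedderburn : exists s : seq (family H),
  [/\ uniq s, forall t, t \in s -> irr_rep *%R 1 (fun_rep t),
      forall x, (forall t, t \in s -> fun_rep t x = 0) -> x = 0 &
      forall B : (forall t : family H, 'M[k]_(deg_rep t)),
        exists x, forall t, t \in s -> fun_rep t x = B t].
Proof.
by apply: (wedderburn bilin_mul (@mulrA H) (@mul1r H) (@mulr1 H)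
  int_casimir_family int_casimir_family1).
Qed.

Variable s : seq (family H).
Hypotheses (us : uniq s) (irrs : forall t, t \in s -> irr_rep *%R 1 (fun_rep t)).
Hypothesis faith : forall x, (forall t, t \in s -> fun_rep t x = 0) -> x = 0.
Hypothesis surj : forall B : (forall t : family H, 'M[k]_(deg_rep t)),
  exists x, forall t, t \in s -> fun_rep t x = B t.

Let linr t : t \in s -> islin (fun_rep t).
Proof. by move/irrs; case; case. Qed.
Let rM t x y : t \in s -> fun_rep t (x * y) = fun_rep t x *m fun_rep t y.
Proof. by move/irrs; case; case. Qed.
Let r1 t : t \in s -> fun_rep t (1 : H) = 1%:M.
Proof. by move/irrs; case; case. Qed.

Lemma matrix_units : exists E : (forall t : family H, 'I_(deg_rep t) -> 'I_(deg_rep t)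
  -> H),
  [/\ forall t i j, t \in s -> fun_rep t (E t i j) = delta_mx i j,
      forall r t i j, r \in s -> t \in s -> r != t -> fun_rep r (E t i j) = 0 &
      forall x, x = \sum_(t <- s) \sum_i \sum_j fun_rep t x i j *: E t i j].
Proof.
(* Indices are compared as natural numbers because [r] and [t] may have different dimensions. *)
pose B (t : family H) (i j : 'I_(deg_rep t)) (r : family H) : 'M[k]_(deg_rep r) :=
  \matrix_(a, b) [&& r == t, a == i :> nat & b == j :> nat]%:R.
have EE t i j : exists x, forall r, r \in s -> fun_rep r x = B t i j r by apply: surj.
pose E t i j := projT1 (cid (EE t i j)).
have EP t i j r : r \in s -> fun_rep r (E t i j) = B t i j r := projT2 (cid (EE t i j)) r.
have E1 t i j : t \in s -> fun_rep t (E t i j) = delta_mx i j.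
  by move=> ts; rewrite EP //; apply/matrixP => a b; rewrite !mxE eqxx.
have E0 r t i j : r \in s -> t \in s -> r != t -> fun_rep r (E t i j) = 0.
  by move=> rs ts /negPf rt; rewrite EP //; apply/matrixP => a b; rewrite !mxE rt.
exists E; split=> // x; apply/eqP; rewrite -subr_eq0; apply/eqP/faith => r rs.
have lr := linr rs; rewrite (islinD lr) (islinN lr) (islin_big _ _ _ lr).
rewrite (bigD1_seq r) //= [X in _ - (_ + X)]big_seq_cond [X in _ - (_ + X)]big1 =>
  [|t /andP[ts tr]].
  rewrite addr0 (islin_big _ _ _ lr) [X in X - _]matrix_sum_delta -sumrB big1 // => i _.
  rewrite (islin_big _ _ _ lr) -sumrB big1 // => j _.
  by rewrite (islinZ lr) E1 // subrr.
rewrite (islin_big _ _ _ lr) big1 // => i _; rewrite (islin_big _ _ _ lr) big1 // => j _.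
by rewrite (islinZ lr) E0 ?scaler0 // eq_sym.
Qed.

Definition tchar (x : H) : k := \sum_(t <- s) \tr (fun_rep t x).

Lemma tcharC x y : tchar (x * y) = tchar (y * x).
Proof.
rewrite /tchar big_seq [RHS]big_seq; apply: eq_bigr => t ts.
by rewrite !rM // mxtrace_mulC.
Qed.

Lemma islin_tchar : islin (fun x => tchar x : k^o).
Proof.
move=> a x y; rewrite /tchar scaler_sumr -big_split big_seq [RHS]big_seq.
by apply: eq_bigr => t ts; rewrite (linr ts) raddfD /= mxtraceZ.
Qed.

(** On each matrix block the map is left multiplication by x composed with right multiplication by
    y, so its trace factors. *)
Lemma ftrace_mul x y :
  ftrace (fun z => x * z * y) = \sum_(t <- s) \tr (fun_rep t x) * \tr (fun_rep t y).
Proof.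
have [E [E1 E0 Esum]] := matrix_units.
have lf : islin (fun z : H => x * z * y) by lin.
have ftE (z : H) l : bcoord (x * z * y) l = \sum_(t <- s) \sum_i \sum_j
    fun_rep t z i j * bcoord (x * E t i j * y) l.
  have lb := @islin_bcoord _ H l.
  rewrite {1}[z]Esum (islin_big _ _ _ lf) (islin_big _ _ _ lb); apply: eq_bigr => t _.
  rewrite (islin_big _ _ _ lf) (islin_big _ _ _ lb); apply: eq_bigr => i _.
  rewrite (islin_big _ _ _ lf) (islin_big _ _ _ lb); apply: eq_bigr => j _.
  by rewrite (islinZ lf) (islinZ lb).
rewrite /ftrace; under eq_bigr => l _ do rewrite ftE.
rewrite exchange_big /= big_seq [RHS]big_seq; apply: eq_bigr => t ts.
have lr := linr ts.
rewrite exchange_big /= /mxtrace big_distrl /=; apply: eq_bigr => i _.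
rewrite exchange_big /= big_distrr /=; apply: eq_bigr => j _.
transitivity (fun_rep t (x * E t i j * y) i j).
  rewrite [x * _ * y in RHS]bcoord_sum (islin_big _ _ _ lr) summxE.
  by apply: eq_bigr => l _; rewrite (islinZ lr) [RHS]mxE mulrC.
rewrite !rM // E1 // (_ : delta_mx i j = delta_mx i ord0 *m delta_mx (ord0 : 'I_1) j).
  by rewrite -!mulmxA mulmxA -colE -rowE mxE big_ord1 !mxE.
by rewrite mul_delta_mx.
Qed.

(** The trace form of a matrix block is nondegenerate; the (i, j) entry of [u] is the value of [lam]
    on the unit E_ji. *)
Lemma lam_tchar : exists u, forall h, lam h = tchar (u * h).
Proof.
have [E [E1 E0 Esum]] := matrix_units.
have ll := @islin_lam k H.
have [u uE] := surj (fun t => \matrix_(i, j) lam (E t j i)).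
exists u => h; rewrite {1}[h]Esum (islin_big _ _ _ ll) /tchar big_seq [RHS]big_seq.
apply: eq_bigr => t ts; rewrite rM // uE //.
rewrite mxtrace_mulC (islin_big _ _ _ ll); apply: eq_bigr => i _.
rewrite mxE (islin_big _ _ _ ll); apply: eq_bigr => j _.
by rewrite mxE (islinZ ll).
Qed.

(* The element [u] representing [lam] by [tchar] implements [S^2] and
   [modular L * u ^ 2] is central; [v] is [u] divided in each matrix block by a
   square root of that scalar. *)
Lemma antipode2_inner : exists v w, [/\ v * w = 1, w * v = 1,
  modular L = w * w & forall c, S (S c) = v * c * w].
Proof.
have ll := @islin_lam k H.
have [u uE] := lam_tchar.
have lt := islin_tchar.
have uinj h : h * u = 0 -> h = 0.
  move=> hu; apply: (lam_nondegr intL) => c.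
  by rewrite mulr0 (islin0 ll) uE mulrA tcharC mulrA hu mul0r (islin0 lt).
have [u' u'u] : exists u', u' * u = 1.
  have [F FE] := @linfunE_islin _ H H (fun h => h * u) ltac:(lin).
  have /eqP/lker0_limgf e : lker F = 0%VS.
    apply/eqP/lker0P => x y; rewrite !FE => /eqP; rewrite -subr_eq0 -mulrBl.
    by move=> /eqP/uinj/eqP; rewrite subr_eq0 => /eqP.
  have /memv_imgP[g _ ->] : (1 : H) \in limg F by rewrite e memvf.
  by exists g; rewrite FE.
have uu' : u * u' = 1.
  apply/eqP; rewrite -subr_eq0; apply/eqP/uinj.
  by rewrite mulrBl -mulrA u'u mulr1 mul1r subrr.
have tnd y : (forall b, tchar (y * b) = 0) -> y = 0.
  move=> y0; have : u' * y = 0.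
    apply: (lam_nondegl intL) => c.
    by rewrite uE !mulrA uu' mul1r y0.
  by move=> /(congr1 ( *%R u)); rewrite mulr0 mulrA uu' mul1r.
have Su c : S (S c) * u = u * c.
  apply/eqP; rewrite -subr_eq0; apply/eqP/tnd => b.
  rewrite mulrBl (islinD lt) (islinN lt) -mulrA tcharC -!mulrA -!uE.
  by rewrite [lam (c * b)]lam_twist subrr.
pose a := modular L; pose z := a * (u * u).
have zC c : c * z = z * c.
  rewrite /z mulrA (modular_antipode4 intL) -/a -!mulrA.
  by rewrite [S (S (S (S c))) * _]mulrA Su -[u * S (S c) * u]mulrA Su.
have [a' [a'a aa']] := modular_inv intL.
have zz' : z * (u' * u' * a') = 1.
  by rewrite /z !mulrA -[a * u * u * u']mulrA uu' mulr1 -[a * u * u']mulrA uu' mulr1.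
have /choice[c cP] (t : family H) : exists c : k, t \in s ->
    c != 0 /\ fun_rep t z = (c ^+ 2)%:M.
  have [ts|] := boolP (t \in s); last by exists 0.
  have [_ n0 irr] := irrs ts.
  have /is_scalar_mxP[d dE] : is_scalar_mx (fun_rep t z).
    by apply: irr => x; rewrite -!rM // zC.
  have [c cE] : exists c, root ('X^2 - d%:P) c.
    by apply/closed_rootP; rewrite size_XnsubC.
  exists c => _; have dc : d = c ^+ 2.
    by move: cE; rewrite /root !hornerE subr_eq0 => /eqP.
  rewrite dE dc; split=> //; apply/eqP => c0.
  have zt0 : fun_rep t z = 0.
    by rewrite dE dc c0 expr0n /=; apply/matrixP => i j; rewrite !mxE mul0rn.
  have := r1 ts; rewrite -zz' rM // zt0 mul0mx.
  move=> /matrixP/(_ (Ordinal n0) (Ordinal n0)); rewrite !mxE eqxx => /eqP.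
  by rewrite eq_sym oner_eq0.
have [v vE] := surj (fun t => (c t)^-1 *: fun_rep t u).
have [w wE] := surj (fun t => c t *: fun_rep t u').
have eqH x y : (forall t, t \in s -> fun_rep t x = fun_rep t y) -> x = y.
  move=> xy; apply/eqP; rewrite -subr_eq0; apply/eqP/faith => t ts.
  by rewrite (islinD (linr ts)) (islinN (linr ts)) xy // subrr.
have vw : v * w = 1.
  apply: eqH => t ts; have [c0 _] := cP t ts.
  by rewrite rM // vE // wE // -scalemxAl -scalemxAr scalerA mulVf // scale1r -rM // uu'.
have wv : w * v = 1.
  apply: eqH => t ts; have [c0 _] := cP t ts.
  by rewrite rM // vE // wE // -scalemxAl -scalemxAr scalerA mulfV // scale1r -rM // u'u.
have av : a * (v * v) = 1.
  apply: eqH => t ts; have [c0 zE] := cP t ts.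
  rewrite !rM // vE // -scalemxAl -!scalemxAr scalerA -!rM // -/z zE.
  by rewrite scale_scalar_mx -invfM -expr2 mulVf ?expf_neq0 // r1.
exists v, w; split=> //.
  by rewrite -[LHS]mulr1 -vw -[v in v * w]mulr1 -vw !mulrA -[a * v * v]mulrA av mul1r.
move=> x; rewrite -[LHS]mulr1 -vw mulrA; congr (_ * _).
apply: eqH => t ts; have [c0 _] := cP t ts.
by rewrite !rM // vE // -scalemxAr -scalemxAl -!rM // Su.
Qed.

Lemma lam1_neq0_aux : [pchar k] =i pred0 -> lam (1 : H) != 0.
Proof.
move=> char0; apply/eqP => l1.
have [v [w [vw wv aE SE]]] := antipode2_inner.
have lE h : lam h = \sum_(t <- s) \tr (fun_rep t (h * v)) * \tr (fun_rep t w).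
  by rewrite -ftrace_mul; apply: eq_ftrace => x; rewrite SE !mulrA.
have /choice[r rP] (t : family H) : exists r : seq k, t \in s ->
    forall j, \tr (fun_rep t (w ^+ j)) = \sum_(z <- r) z ^+ j.
  have [ts|] := boolP (t \in s); last by exists [::].
  have [r rE] := mxtrace_powers (fun_rep t w); exists r => _ j; rewrite -rE; congr (\tr _).
  by elim: j => [|j IHj]; rewrite ?expr0 ?r1 // !exprS rM // IHj.
have tw t : t \in s -> \tr (fun_rep t w) = 0.
  move=> ts; rewrite -[w]expr1 rP //; under eq_bigr => z _ do rewrite expr1.
  apply: (@odd_sums_eq0 _ [seq r t | t <- s]) => //; last exact: map_f.
  (* The power j + 1 of the modular element is w^(2j+2), and the factor v = w^-1 in [lE] lowers it
     to the odd power 2j + 1. *)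
  move=> j; rewrite big_map; have := lam_modularX intL j.+1 l1; rewrite lE => e.
  rewrite -[RHS]e big_seq [RHS]big_seq; apply: eq_bigr => t' ts'.
  rewrite mulrC -(rP t') // (_ : modular L ^+ j.+1 * v = w ^+ j.*2.+1); last first.
    by rewrite aE -expr2 -exprM mul2n doubleS exprSr -mulrA wv mulr1.
  by congr (_ * _); rewrite -[w in RHS]expr1 rP.
have := lam_int intL; rewrite lE big_seq big1 => [/eqP|t ts].
  by rewrite eq_sym oner_eq0.
by rewrite tw // mulr0.
Qed.

End WithIntegral.

Lemma lam1_neq0 : [pchar k] =i pred0 -> semisimple H -> lam (1 : H) != 0.
Proof.
move=> char0 /is_integral_fullv[L intL].
have [s [us irrs faith surj]] := hopf_wedderburn intL.
exact: (lam1_neq0_aux intL us irrs faith surj).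
Qed.

End LarsonRadford.

(** * The dual algebra *)

Section Dual.
Variables (k : fieldType) (H : hopfType k).
Local Notation S := (antipode : H -> H).
Local Notation A := 'Hom(H, k^o).

Definition hom_of (U V : vectType k) (f : U -> V) (lf : islin f) : 'Hom(U, V) :=
  projT1 (cid (linfunE_islin lf)).

Lemma hom_ofE (U V : vectType k) (f : U -> V) (lf : islin f) x : hom_of lf x = f x.
Proof. exact: (projT2 (cid (linfunE_islin lf))). Qed.

Lemma islin_fun (U V : vectType k) (f : 'Hom(U, V)) : islin (f : U -> V).
Proof. exact: linearP. Qed.

Lemma scale_regC (a b : k^o) : (a : k) *: b = (b : k) *: a.
Proof. exact: mulrC. Qed.

Lemma islin_conv (p q : A) :
  islin (fun h => sw (fun x y => (p x : k) *: (q y : k^o)) h).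
Proof. by lin. Qed.

Definition conv (p q : A) : A := hom_of (islin_conv p q).

Lemma convE p q h : conv p q h = sw (fun x y => (p x : k) *: (q y : k^o)) h.
Proof. exact: hom_ofE. Qed.

Lemma bilin_scale (p q : A) : bilin (fun x y => (p x : k) *: (q y : k^o)).
Proof. by mlin. Qed.

Lemma bilin_conv : bilin conv.
Proof.
split=> r a p q; apply/lfunP => h; rewrite add_lfunE scale_lfunE !convE.
  rewrite sw_scale -sw_add; apply: (@eq_sw _ _ k^o) => x y.
  by rewrite add_lfunE scale_lfunE scalerDl scalerA.
rewrite sw_scale -sw_add; apply: (@eq_sw _ _ k^o) => x y.
by rewrite add_lfunE scale_lfunE scalerDr !scalerA mulrC.
Qed.

Lemma convA : associative conv.
Proof.
move=> p q r; apply/lfunP => h; rewrite !convE.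
under eq_sw => x y do rewrite convE sw_scale.
under [RHS]eq_sw => x y do rewrite convE scale_regC sw_scale.
rewrite -sw_coassoc; last by mlin.
by apply: eq_sw => x y; apply: (@eq_sw _ _ k^o) => x1 x2;
  rewrite scale_regC scalerA [RHS]scalerA mulrC.
Qed.

Lemma conv1p : left_id (counit : A) conv.
Proof.
move=> p; apply/lfunP => h; rewrite convE.
by rewrite (sw_counitl (f := fun y => p y : k^o)) //; lin.
Qed.

Lemma convp1 : right_id (counit : A) conv.
Proof.
move=> p; apply/lfunP => h; rewrite convE.
rewrite -[RHS](sw_counitr (f := fun y => p y : k^o)); last by lin.
by apply: (@eq_sw _ _ k^o) => x y; apply: mulrC.
Qed.

Lemma dual_sep (V : vectType k) (U : {vspace V}) v : v \notin U ->
  exists p : 'Hom(V, k^o), (forall u, u \in U -> p u = 0) /\ p v != 0.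
Proof.
move=> vU; pose f w := w - projv U w.
have lf : islin f by rewrite /f; lin.
have fv : f v != 0.
  by apply: contra vU; rewrite subr_eq0 => /eqP ->; exact: memv_proj.
have [i fvi] : exists i, bcoord (f v) i != 0.
  apply: contrapT => nf; case/eqP: fv; rewrite [f v]bcoord_sum big1 // => i _.
  have [->|fi] := eqVneq (bcoord (f v) i) 0; first by rewrite scale0r.
  by case: nf; exists i.
exists (hom_of (islin_comp (@islin_bcoord _ V i) lf)); split=> [u uU|];
  last by rewrite hom_ofE.
by rewrite hom_ofE /f projv_id // subrr (islin0 (@islin_bcoord _ V i)).
Qed.

Lemma eq_dual (V : vectType k) (u v : V) : (forall p : 'Hom(V, k^o), p u = p v) -> u = v.
Proof.
move=> e; apply/eqP; rewrite -subr_eq0 -memv0; apply/contraT => /dual_sep[p [_]].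
by rewrite linearB /= e subrr eqxx.
Qed.

Definition dual_basis (i : 'I_(dimT H)) : A := hom_of (@islin_bcoord _ H i).

Lemma dual_basisE i h : dual_basis i h = bcoord h i. Proof. exact: hom_ofE. Qed.

Lemma dual_sum (p : A) : p = \sum_i (p (bvec i) : k) *: dual_basis i.
Proof.
apply/lfunP => h; rewrite {1}[h]bcoord_sum linear_sum sum_lfunE; apply: eq_bigr => i _.
by rewrite linearZ scale_lfunE dual_basisE; apply: mulrC.
Qed.

(** Apply [lam_left] to x S(y_1) and multiply by y_2 on the right. As S reverses the coproduct, a
    factor S(y_2) y_3 appears and contracts. *)
Lemma lam_antipode_shift (x y : H) :
  sw (fun x1 x2 => lam (x2 * S y) *: x1) x = sw (fun y1 y2 => lam (x * S y1) *: y2) y.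
Proof.
have ll := @islin_lam k H.
transitivity (sw (fun y1 y2 => sw (fun x1 x2 => sw (fun a b =>
     lam (x2 * S a) *: (x1 * (S b * y2))) y1) x) y); last first.
  apply: eq_sw => y1 y2.
  have := lam_left (x * S y1) => /(congr1 (fun z => z * y2)).
  rewrite -scalerAl mul1r => <-; rewrite swM; last by mlin.
  rewrite sw_mull; apply: eq_sw => x1 x2; rewrite sw_antipode; last by mlin.
  by rewrite sw_mull; apply: eq_sw => a b; rewrite -scalerAl mulrA.
rewrite sw_exch; apply: eq_sw => x1 x2; rewrite sw_coassoc; last by mlin.
rewrite -(sw_counitr (f := fun y => lam (x2 * S y) *: x1)); last by lin.
apply: eq_sw => a y'.
rewrite -(sw_lin (f := fun z => lam (x2 * S a) *: (x1 * z))); last by lin.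
by rewrite sw_antipodel -scalerAr mulr1 !scalerA mulrC.
Qed.

Hypothesis lam1 : lam (1 : H) != 0.

(** As a functional on H (x) H this is the separability idempotent of the dual; [haar_basis] and
    [dual_basis] split it into a finite sum. Its convolution product is lam (x_1 S x_2) / lam 1 =
    eps x. *)
Definition haar (x y : H) : k^o := (lam (1 : H))^-1 * lam (x * S y).

Lemma islin_haar t : islin (haar^~ t).
Proof.
by have ll := @islin_lam k H; apply: (@islin_scaler _ _ _ (lam 1)^-1 (fun x =>
  lam (x * S t) : k^o)); lin.
Qed.

Lemma islin_haarr x : islin (haar x).
Proof.
by have ll := @islin_lam k H; apply: (@islin_scaler _ _ _ (lam 1)^-1 (fun t =>
  lam (x * S t) : k^o)); lin.
Qed.

Definition haar_basis (i : 'I_(dimT H)) : A := hom_of (islin_haar (bvec i)).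

(** Read as functionals on H (x) H, the two sides are, up to the factor 1 / lam 1, [p] applied to
    the two sides of [lam_antipode_shift]. *)
Lemma dual_casimir p :
  \sum_t tens (conv p (haar_basis t)) (dual_basis t) =
  \sum_t tens (haar_basis t) (conv (dual_basis t) p).
Proof.
have [tl tr] := tens_bilin A A.
have -> : \sum_t tens (haar_basis t) (conv (dual_basis t) p) =
  \sum_t \sum_r (conv (dual_basis t) p (bvec r) : k) *: tens (haar_basis t) (dual_basis r).
  apply: eq_bigr => t _; rewrite {1}[conv _ _]dual_sum (islin_big _ _ _ (tr _)).
  by apply: eq_bigr => r _; rewrite (islinZ (tr _)).
rewrite exchange_big; apply: eq_bigr => r _ /=.
transitivity (tens (\sum_t (conv (dual_basis t) p (bvec r) : k) *: haar_basis t)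
  (dual_basis r)).
  congr (tens _ _); apply/lfunP => x; rewrite convE sum_lfunE.
  transitivity ((lam (1 : H))^-1 * p (sw (fun x1 x2 => lam (x2 * S (bvec r)) *: x1) x)).
    have lp := islin_fun p.
    rewrite (sw_lin (W := k^o) _ _ lp) -[_ * _]/(_ *: (_ : k^o)) sw_scale.
    apply: (@eq_sw _ _ k^o) => x1 x2; rewrite hom_ofE (islinZ lp).
    by rewrite -![_ *: _]/(_ * _) mulrC -mulrA.
  rewrite lam_antipode_shift.
  have lp := islin_fun p.
  rewrite (sw_lin (W := k^o) _ _ lp) -[_ * _]/(_ *: (_ : k^o)) sw_scale.
  under [RHS]eq_bigr => t _ do
    (rewrite scale_lfunE convE scale_regC sw_scale).
  rewrite -sw_sum; apply: (@eq_sw _ _ k^o) => y1 y2.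
  rewrite (islinZ lp) -![_ *: _]/(_ * _).
  rewrite mulrA; transitivity (haar x y1 * p y2); first by [].
  rewrite {1}[y1]bcoord_sum (islin_big _ _ _ (islin_haarr x)) mulr_suml.
  apply: eq_bigr => t _; rewrite (islinZ (islin_haarr x)) dual_basisE hom_ofE.
  rewrite -![_ *: _]/(_ * _) /haar -!mulrA mulrCA; congr (_ * _).
  exact: mulrCA.
rewrite (islin_big _ _ _ (tl _)); apply: eq_bigr => t _; by rewrite (islinZ (tl _)).
Qed.

Lemma dual_casimir1 : \sum_t conv (haar_basis t) (dual_basis t) = (counit : A).
Proof.
apply/lfunP => h; rewrite sum_lfunE.
under eq_bigr => t _ do rewrite convE.
rewrite -sw_sum.
transitivity (sw (fun x y => haar x y) h).
  apply: (@eq_sw _ _ k^o) => x y; rewrite {2}[y]bcoord_sum.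
  rewrite (islin_big _ _ _ (islin_haarr x)); apply: eq_bigr => t _.
  by rewrite (islinZ (islin_haarr x)) hom_ofE dual_basisE; apply: mulrC.
have ll := @islin_lam k H; rewrite /haar -sw_scale.
rewrite -(sw_lin (W := k^o) _ _ ll) sw_antipoder (islinZ ll).
by rewrite -![_ *: _]/(_ * _) mulrCA mulVf // mulr1.
Qed.

End Dual.

(** * Irreducible characters and simple subcoalgebras *)

Section SubcoalgebraSweedler.
Variables (k : fieldType) (H : hopfType k).

Lemma subcoalg_sw (D : {vspace H}) (V : vectType k) (U : {vspace V})
    (b : H -> H -> V) d : subcoalg D -> bilin b ->
  (forall x y, x \in D -> y \in D -> b x y \in U) -> d \in D -> sw b d \in U.
Proof.
move=> sD bb bD dD.
have /subvP/(_ _ (sD _ dD)) : (tensv D D <= linfun (tlift b) @^-1: U)%VS.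
  apply: spanP_sub => _ [x [y [xD yD ->]]].
  by rewrite -memv_preim lfunE /= tliftE // bD.
by rewrite -memv_preim lfunE.
Qed.

Lemma eq_subcoalg_sw (D : {vspace H}) (V : vectType k) (b b' : H -> H -> V) d :
  subcoalg D -> bilin b -> bilin b' ->
  (forall x y, x \in D -> y \in D -> b x y = b' x y) -> d \in D -> sw b d = sw b' d.
Proof.
move=> sD bb bb' e dD; apply/eqP; rewrite -subr_eq0 -memv0 -sw_sub.
apply: (subcoalg_sw sD) dD => [|x y xD yD]; last by rewrite e // subrr mem0v.
split=> z a u v; first by rewrite bb.1 bb'.1 opprD scalerBr addrACA.
by rewrite bb.2 bb'.2 opprD scalerBr addrACA.
Qed.

End SubcoalgebraSweedler.

Section Characters.
Variables (k : closedFieldType) (H : hopfType k).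
Local Notation S := (antipode : H -> H).
Local Notation A := 'Hom(H, k^o).
Local Notation arep := (@isrep k A (@conv k H) (counit : A)).
Implicit Types (C D U : {vspace H}) (c d : irr H).

(** The comodule with coefficient matrix [x], viewed as a representation of the convolution
    algebra. *)
Definition corep_fun n (x : 'M[H]_n) (p : A) : 'M[k]_n := \matrix_(i, j) p (x i j).

Lemma sw_comatrix n (x : 'M[H]_n) (V : vectType k) (b : H -> H -> V) i j :
  (forall i j, comul (x i j) = \sum_l tens (x i l) (x l j)) -> bilin b ->
  sw b (x i j) = \sum_l b (x i l) (x l j).
Proof.
move=> xE bb; rewrite /sw xE linear_sum; apply: eq_bigr => l _.
by rewrite /= tliftE.
Qed.

Lemma corep_isrep n (x : 'M[H]_n) :
  (forall i j, comul (x i j) = \sum_l tens (x i l) (x l j)) ->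
  (forall i j, eps (x i j) = (i == j)%:R) -> arep (corep_fun x).
Proof.
move=> xE xe; split=> [a p q|p q|]; apply/matrixP => i j; rewrite !mxE.
- by rewrite add_lfunE scale_lfunE.
- rewrite convE sw_comatrix //; last exact: bilin_scale.
  by apply: eq_bigr => l _; rewrite !mxE.
- exact: xe.
Qed.

Lemma comatrix_dual C n (x : 'M[H]_n) : comatrix_basis C x ->
  forall B : 'M[k]_n, exists p : A, corep_fun x p = B.
Proof.
move=> [_ /andP[_ freeX]] B; set X := [seq _ | p : _] in freeX.
have sX : size X = #|{: 'I_n * 'I_n}| by rewrite size_image.
pose idx (ij : 'I_n * 'I_n) : 'I_(size X) := cast_ord (esym sX) (enum_rank ij).
have Xidx ij : X`_(idx ij) = x ij.1 ij.2.
  by rewrite /X /= (nth_image 0) enum_rankK.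
have lc i : islin (fun v : H => coord (in_tuple X) i v : k^o) by exact: linearP.
exists (\sum_i \sum_j B i j *: hom_of (lc (idx (i, j)))).
apply/matrixP => i j; rewrite mxE sum_lfunE (bigD1 i) //= sum_lfunE (bigD1 j) //=.
have cE ij kl : coord (in_tuple X) (idx kl) (x ij.1 ij.2) = (ij == kl)%:R.
  rewrite -Xidx -[X in X`_ _]/(tval (in_tuple X)) coord_free //.
  by rewrite (inj_eq (@cast_ord_inj _ _ _)) (inj_eq enum_rank_inj).
rewrite scale_lfunE hom_ofE (cE (i, j)) eqxx [_ *: _]mulr1 !big1 ?addr0 //.
  move=> i' ni; rewrite sum_lfunE big1 // => j' _.
  by rewrite scale_lfunE hom_ofE (cE (i, j)) xpair_eqE eq_sym (negPf ni) [_ *: _]mulr0.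
move=> j' nj.
by rewrite scale_lfunE hom_ofE (cE (i, j)) xpair_eqE [j == _]eq_sym (negPf nj)
  andbF [_ *: _]mulr0.
Qed.

Lemma comatrix_span C n (x : 'M[H]_n) U : comatrix_basis C x ->
  (forall i j, x i j \in U) -> (C <= U)%VS.
Proof.
move=> [_ /andP[/eqP <- _]] xU; apply/span_subvP => v vX.
by move: vX; rewrite /image_mem => /mapP[ij _ ->].
Qed.

Lemma comatrix_mem C n (x : 'M[H]_n) i j : comatrix_basis C x -> x i j \in C.
Proof.
by move=> [_ /andP[/eqP <- _]]; apply/memv_span/mapP; exists (i, j); rewrite ?mem_enum.
Qed.

(** Linear independence forces these values: apply a functional dual to x_jj to the counit law for
    x_ij. *)
Lemma comatrix_eps C n (x : 'M[H]_n) : comatrix_basis C x ->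
  forall i j, eps (x i j) = (i == j)%:R.
Proof.
move=> xC i j; have [p pE] := comatrix_dual xC (delta_mx j j).
have pE' a b : p (x a b) = ((a == j) && (b == j))%:R.
  by have /matrixP/(_ a b) := pE; rewrite !mxE.
have [xE _] := xC.
have := @sw_counitl _ _ k^o (fun h => p h) (x i j) (islin_fun p).
rewrite sw_comatrix //; last by mlin.
rewrite (bigD1 j) //= big1 => [|l /negPf lj]; last by rewrite pE' lj [_ *: _]mulr0.
by rewrite !pE' !eqxx !andbT addr0 [_ *: _]mulr1.
Qed.

Lemma comatrix_isrep C n (x : 'M[H]_n) : comatrix_basis C x -> arep (corep_fun x).
Proof. by move=> xC; apply: corep_isrep; [case: xC | exact: comatrix_eps xC]. Qed.

Lemma comatrix_eq0 C n (x : 'M[H]_n) p : comatrix_basis C x ->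
  corep_fun x p = 0 -> forall h, h \in C -> p h = 0.
Proof.
move=> xC p0 h hC; apply/eqP; rewrite -memv_ker (subvP (comatrix_span xC _)) //.
by move=> i j; rewrite memv_ker; have /matrixP/(_ i j) := p0; rewrite !mxE => ->.
Qed.

Lemma comatrix_eq1 C n (x : 'M[H]_n) p : comatrix_basis C x ->
  corep_fun x p = 1%:M -> forall h, h \in C -> p h = eps h.
Proof.
move=> xC p1 h hC; apply/eqP; rewrite -subr_eq0.
have -> : p h - eps h = (p - (counit : A)) h by rewrite add_lfunE opp_lfunE.
apply/eqP/(comatrix_eq0 xC) => //; apply/matrixP => i j; rewrite !mxE add_lfunE opp_lfunE.
have /matrixP/(_ i j) := p1; rewrite !mxE => ->.
by rewrite -/(eps _) (comatrix_eps xC) subrr.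
Qed.

Lemma comatrix_gt0 C n (x : 'M[H]_n) : C != 0%VS -> comatrix_basis C x -> (0 < n)%N.
Proof.
case: n x => // x C0 xC; case/eqP: C0; apply/eqP; rewrite -subv0.
by apply: (comatrix_span xC); case.
Qed.

(** Functionals dual to matrix units, applied to the left and then the right leg, carry a nonzero
    element of D to a nonzero multiple of any chosen x_ab. *)
Lemma comatrix_simple C n (x : 'M[H]_n)
  : (0 < n)%N -> comatrix_basis C x -> simple_subcoalg C.
Proof.
move=> n0 xC; have [xE _] := xC.
have dual := comatrix_dual xC.
split=> [h hC||D sD DC].
- have /subvP/(_ _ hC) : (C <= comul @^-1: tensv C C)%VS.
    apply: (comatrix_span xC) => i j; rewrite -memv_preim xE memv_suml // => l _.
    by apply: mem_spanP; exists (x i l), (x l j); split=> //; apply: comatrix_mem.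
  by rewrite -memv_preim.
- apply/eqP => C0; have := comatrix_eps xC (Ordinal n0) (Ordinal n0).
  have := comatrix_mem (Ordinal n0) (Ordinal n0) xC; rewrite C0 memv0 => /eqP ->.
  by rewrite eqxx /eps linear0 => /eqP; rewrite eq_sym oner_eq0.
have [->|D0] := eqVneq D 0%VS; [by left | right].
apply/eqP; rewrite eqEsubv DC /=; have dD := memv_pick D.
have dn0 : vpick D != 0 by rewrite vpick0.
move: (vpick D) dD dn0 => d dD d0.
have [al dE] : exists al : 'M[k]_n, d = \sum_i \sum_j al i j *: x i j.
  pose f (a : 'M[k]_n) : H := \sum_i \sum_j a i j *: x i j.
  have lf : islin f.
    move=> c a b; rewrite /f scaler_sumr -big_split; apply: eq_bigr => i _ /=.
    rewrite scaler_sumr -big_split; apply: eq_bigr => j _ /=.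
    by rewrite !mxE scalerDl scalerA.
  suff : (C <= limg (hom_of lf))%VS.
    by move=> /subvP/(_ _ (subvP DC _ dD))/memv_imgP[a _ ->]; exists a; rewrite hom_ofE.
  apply: (comatrix_span xC) => i j; apply/memv_imgP; exists (delta_mx i j);
    first exact: memvf.
  rewrite hom_ofE /f (bigD1 i) //= (bigD1 j) //= !mxE !eqxx scale1r !big1 ?addr0 //.
    by move=> i' /negPf ni; rewrite big1 // => j' _; rewrite mxE ni scale0r.
  by move=> j' /negPf nj; rewrite mxE nj andbF scale0r.
have [i [j aij]] : exists i j, al i j != 0.
  apply: contrapT => na; case/eqP: d0; rewrite dE big1 // => i _; rewrite big1 // => j _.
  have [->|aij] := eqVneq (al i j) 0; first by rewrite scale0r.
  by case: na; exists i, j.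
apply: (comatrix_span xC) => a b.
have [p pE] := dual (delta_mx i a); have [q qE] := dual (delta_mx b j).
have pE' u v : p (x u v) = ((u == i) && (v == a))%:R.
  by have /matrixP/(_ u v) := pE; rewrite !mxE.
have qE' u v : q (x u v) = ((u == b) && (v == j))%:R.
  by have /matrixP/(_ u v) := qE; rewrite !mxE.
have b1 : bilin (fun y z : H => (p y : k) *: z) by mlin.
have b2 : bilin (fun y z : H => (q z : k) *: y) by mlin.
pose d1 := sw (fun y z : H => (p y : k) *: z) d.
have d1D : d1 \in D by apply: (subcoalg_sw sD b1) dD => y z _ zD; rewrite memvZ.
pose d2 := sw (fun y z : H => (q z : k) *: y) d1.
have d2D : d2 \in D by apply: (subcoalg_sw sD b2) d1D => y z yD _; rewrite memvZ.
have l1 : islin (sw (fun y z : H => (p y : k) *: z)) by apply: islin_sw; lin.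
have l2 : islin (sw (fun y z : H => (q z : k) *: y)) by apply: islin_sw; lin.
have e1 u v : sw (fun y z : H => (p y : k) *: z) (x u v) = (u == i)%:R *: x a v.
  rewrite sw_comatrix // (bigD1 a) //= pE' eqxx andbT big1 ?addr0 // => l /negPf la.
  by rewrite pE' la andbF scale0r.
have e2 u v : sw (fun y z : H => (q z : k) *: y) (x u v) = (v == j)%:R *: x u b.
  rewrite sw_comatrix // (bigD1 b) //= qE' eqxx /= big1 ?addr0 // => l /negPf lb.
  by rewrite qE' lb scale0r.
have d1E : d1 = \sum_v al i v *: x a v.
  rewrite /d1 dE (islin_big _ _ _ l1) (bigD1 i) //= [X in _ + X]big1 => [|u /negPf ui].
    rewrite addr0 (islin_big _ _ _ l1); apply: eq_bigr => v _.
    by rewrite (islinZ l1) e1 eqxx scale1r.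
  rewrite (islin_big _ _ _ l1) big1 // => v _.
  by rewrite (islinZ l1) e1 ui scale0r scaler0.
have : d2 = al i j *: x a b.
  rewrite /d2 d1E (islin_big _ _ _ l2) (bigD1 j) //= big1 => [|v /negPf vj].
    by rewrite addr0 (islinZ l2) e2 eqxx scale1r.
  by rewrite (islinZ l2) e2 vj scale0r scaler0.
move=> e; rewrite e in d2D; rewrite -[x a b](scalerK aij).
by rewrite memvZ.
Qed.

(** The entry x_ij is the element of H representing the functional p |-> r(p)_ij on the dual.
    Multiplicativity of [r] becomes the comatrix identity, and surjectivity becomes linear
    independence. *)
Lemma irr_rep_char n (r : A -> 'M[k]_n) :
  arep r -> (0 < n)%N -> (forall B, exists p, r p = B) ->
  exists C (x : 'M[H]_n), [/\ comatrix_basis C x, simple_subcoalg C & forall p,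
    r p = corep_fun x p].
Proof.
move=> [lr rM r1] n0 surj.
have [x xD] : exists x : 'M[H]_n, forall i j,
    x i j = \sum_t r (dual_basis t) i j *: bvec t.
  by exists (\matrix_(i, j) \sum_t r (dual_basis t) i j *: bvec t) => i j; rewrite mxE.
have rE p : r p = corep_fun x p.
  apply/matrixP => i j; rewrite mxE xD linear_sum [p in LHS]dual_sum (islin_big _ _ _ lr) summxE.
  by apply: eq_bigr => t _; rewrite (islinZ lr) linearZ mxE; apply: mulrC.
have xE i j : comul (x i j) = \sum_l tens (x i l) (x l j).
  apply/matrixP => u v; rewrite summxE.
  have := rM (dual_basis u) (dual_basis v) => /matrixP/(_ i j).
  rewrite rE !mxE convE /sw.
  have -> : tlift (fun x y : H => (dual_basis u x : k) *: (dual_basis v y : k^o))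
    (comul (x i j))
            = (comul (x i j) : 'M_(_, _)) u v.
    rewrite /tlift (bigD1 u) //= (bigD1 v) //= !dual_basisE !bcoord_bvec !eqxx.
    rewrite !big1 ?addr0.
    - by rewrite [1 *: _]mulr1 [_ *: _]mulr1.
    - move=> u' /negPf nu; rewrite big1 // => v' _.
      by rewrite !dual_basisE !bcoord_bvec nu scale0r scaler0.
    - by move=> v' /negPf nv; rewrite !dual_basisE !bcoord_bvec nv scaler0 scaler0.
  move=> ->; apply: eq_bigr => l _; rewrite mxE !rE !mxE !dual_basisE.
  by [].
exists (span [seq x p.1 p.2 | p : 'I_n * 'I_n]), x.
suff xC : comatrix_basis (span [seq x p.1 p.2 | p : 'I_n * 'I_n]) x.
  by split=> //; apply: comatrix_simple xC.
split=> //; apply/andP; split=> //; set X := [seq _ | p : _].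
have sX : size X = #|{: 'I_n * 'I_n}| by rewrite size_image.
apply/(@freeP _ _ _ (in_tuple X)) => a a0 i.
pose ij := enum_val (cast_ord sX i).
have [p pE] := surj (delta_mx ij.1 ij.2).
have lp := islin_fun p; have := congr1 p a0.
rewrite (islin0 lp) (islin_big _ _ _ lp) (bigD1 i) //= (islinZ lp) big1 => [|i' ni].
  rewrite addr0; have -> : X`_i = x ij.1 ij.2.
    by rewrite /X (nth_image 0 (fun p => x p.1 p.2) (cast_ord sX i)).
  by have /matrixP/(_ ij.1 ij.2) := pE; rewrite rE !mxE !eqxx => ->; rewrite [_ *: _]mulr1.
have -> : X`_i' = x (enum_val (cast_ord sX i')).1 (enum_val (cast_ord sX i')).2.
  by rewrite /X (nth_image 0 (fun p => x p.1 p.2) (cast_ord sX i')).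
rewrite (islinZ lp); set kl := enum_val _.
have /matrixP/(_ kl.1 kl.2) := pE; rewrite rE !mxE => ->.
rewrite -xpair_eqE -!surjective_pairing (inj_eq enum_val_inj)
  (inj_eq (@cast_ord_inj _ _ _)).
by rewrite (negPf ni) [_ *: _]mulr0.
Qed.

End Characters.

(** * Decomposition of comodules and of products of characters *)

Section CharacterFacts.
Variables (k : closedFieldType) (H : hopfType k).
Local Notation A := 'Hom(H, k^o).
Local Notation arep := (@isrep k A (@conv k H) (counit : A)).
Implicit Types (C D U : {vspace H}) (c d : irr H).
Hypotheses (char0 : [pchar k] =i pred0) (lam1 : lam (1 : H) != 0).

Lemma natr_neq0 n : (0 < n)%N -> n%:R != 0 :> k.
Proof. by move=> n0; rewrite (pcharf0P k).1 // -lt0n. Qed.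

Lemma coalg_ofP d : has_char (coalg_of d) (val d).
Proof. exact: (xgetPex _ (set_valP d)). Qed.

Lemma corep_trace n (x : 'M[H]_n) (p : A) : p (\tr x) = \tr (corep_fun x p) :> k.
Proof. by rewrite linear_sum; apply: eq_bigr => i _; rewrite mxE. Qed.

(* A trace on a matrix algebra is determined by its value at 1. *)
Lemma trace_ker n (r r' : A -> 'M[k]_n) : (0 < n)%N -> arep r -> arep r' ->
  (forall B, exists p, r p = B) -> (forall p, r p = 0 -> r' p = 0) ->
  forall p, \tr (r p) = \tr (r' p).
Proof.
move=> n0 [lr rM r1] [lr' rM' r1'] surj ker p.
have eqr p1 p2 : r p1 = r p2 -> r' p1 = r' p2.
  move=> e; apply/eqP; rewrite -subr_eq0 -(islinN lr') -(islinD lr'); apply/eqP/ker.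
  by rewrite (islinD lr) (islinN lr) e subrr.
have /choice[e eE] (ij : 'I_n * 'I_n) := surj (delta_mx ij.1 ij.2).
have eM i j l : r' (e (i, l)) = r' (e (i, j)) *m r' (e (j, l)).
  by rewrite -rM'; apply: eqr; rewrite rM !eE /= mul_delta_mx.
have eM0 i j l m : j != l -> r' (e (i, j)) *m r' (e (l, m)) = 0.
  by move=> jl; rewrite -rM'; apply: ker; rewrite rM !eE /= mul_delta_mx_0.
have tij i j : i != j -> \tr (r' (e (i, j))) = 0.
  move=> ij; rewrite (eM i i j) mxtrace_mulC eM0 ?raddf0 // 1?eq_sym //.
have tii i j : \tr (r' (e (i, i))) = \tr (r' (e (j, j))).
  by rewrite (eM i j i) mxtrace_mulC -eM.
have sum1 : \sum_i \tr (r' (e (i, i))) = n%:R.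
  rewrite -raddf_sum /= -(islin_big _ _ _ lr') -(@mxtrace1 k n) -r1'; congr (\tr _).
  apply: eqr; rewrite r1 (islin_big _ _ _ lr); apply/matrixP => i j.
  rewrite summxE mxE (bigD1 i) //= eE big1 ?addr0 => [|l li];
    first by rewrite mxE eqxx eq_sym.
  by rewrite eE mxE eq_sym (negPf li).
have t1 i : \tr (r' (e (i, i))) = 1.
  apply: (mulIf (natr_neq0 n0)); rewrite mul1r -[RHS]sum1.
  by rewrite (eq_bigr _ (fun j _ => tii j i)) sumr_const card_ord mulr_natr.
have -> : r' p = r' (\sum_i \sum_j r p i j *: e (i, j)).
  apply: eqr; rewrite (islin_big _ _ _ lr) [LHS]matrix_sum_delta; apply: eq_bigr => i _.
  by rewrite (islin_big _ _ _ lr); apply: eq_bigr => j _; rewrite (islinZ lr) eE.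
rewrite (islin_big _ _ _ lr') raddf_sum; apply: eq_bigr => i _ /=.
rewrite (islin_big _ _ _ lr') raddf_sum (bigD1 i) //= (islinZ lr') mxtraceZ t1 mulr1.
rewrite big1 ?addr0 // => j ji.
by rewrite (islinZ lr') mxtraceZ tij ?mulr0 // eq_sym.
Qed.

Lemma has_char_inj C (x y : H) : has_char C x -> has_char C y -> x = y.
Proof.
move=> [[_ C0 _] [n [X [XC ->]]]] [_ [m [Y [YC ->]]]].
have nm : n = m.
  have e1 : (n ^ 2)%N = \dim C by rewrite (size_basis XC.2) card_prod !card_ord.
  have e2 : (m ^ 2)%N = \dim C by rewrite (size_basis YC.2) card_prod !card_ord.
  by apply/eqP; rewrite -(@eqn_exp2r n m 2) // e1 e2.
subst m; have n0 := comatrix_gt0 C0 XC.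
apply: eq_dual => p; rewrite !corep_trace.
apply: trace_ker n0 (comatrix_isrep XC) (comatrix_isrep YC) (comatrix_dual XC) _ p.
move=> p p0; apply/matrixP => i j; rewrite !mxE.
by apply: (comatrix_eq0 XC p0); apply: comatrix_mem.
Qed.

Lemma irr_matrix d : exists s : {n & 'M[H]_n},
  [/\ comatrix_basis (coalg_of d) (projT2 s), (0 < projT1 s)%N & val d = \tr (projT2 s)].
Proof.
have [[_ C0 _] [n [x [xC dE]]]] := coalg_ofP d.
by exists (existT (fun n => 'M[H]_n) n x); split=> //=; apply: comatrix_gt0 xC.
Qed.

Definition irr_mat d := projT1 (cid (irr_matrix d)).
Definition irr_mx d : 'M[H]_(projT1 (irr_mat d)) := projT2 (irr_mat d).

Lemma irr_mxP d : comatrix_basis (coalg_of d) (irr_mx d).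
Proof. by case: (projT2 (cid (irr_matrix d))). Qed.

Lemma irr_dim_gt0 d : (0 < projT1 (irr_mat d))%N.
Proof. by case: (projT2 (cid (irr_matrix d))). Qed.

Lemma irr_mx_trace d : val d = \tr (irr_mx d).
Proof. by case: (projT2 (cid (irr_matrix d))). Qed.

Lemma eps_irr d : eps (val d) != 0.
Proof.
rewrite irr_mx_trace /eps corep_trace.
rewrite (_ : corep_fun _ _ = 1%:M) ?mxtrace1 ?natr_neq0 ?irr_dim_gt0 //.
by have [] := comatrix_isrep (irr_mxP d).
Qed.

Lemma irr_mem d : val d \in coalg_of d.
Proof. by rewrite irr_mx_trace memv_suml // => i _; apply: comatrix_mem (irr_mxP d). Qed.

Lemma coalg_of_subcoalg d : subcoalg (coalg_of d).
Proof. by have [[]] := coalg_ofP d. Qed.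

Definition irr_fam d : family A := Family (corep_fun (irr_mx d)).

Lemma comatrix_sep C D n (x : 'M[H]_n) m (y : 'M[H]_m) : simple_subcoalg C ->
  simple_subcoalg D -> comatrix_basis C x -> comatrix_basis D y -> C <> D ->
  exists e : A, corep_fun x e = 0 /\ corep_fun y e = 1%:M.
Proof.
move=> sC [sD D0 _] xC yD CD.
have [p [xp yp]] : exists p : A, corep_fun x p = 0 /\ corep_fun y p <> 0.
  apply: contrapT => np.
  have DC : (D <= C)%VS.
    apply: (comatrix_span yD) => i j; apply/contraT => /dual_sep[p [pC py]].
    have [] := np; exists p; split.
      by apply/matrixP => a b; rewrite !mxE pC //; apply: comatrix_mem xC.
    by move=> /matrixP/(_ i j)/eqP; rewrite !mxE (negPf py).
  by have [_ _ /(_ D sD DC)[/eqP|DE]] := sC; [rewrite (negPf D0) | case: CD].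
exact: rep_sep (comatrix_isrep xC) (comatrix_isrep yD) (comatrix_dual yD) xp yp.
Qed.

Lemma irr_sep c d : c <> d ->
  exists e, fun_rep (irr_fam c) e = 0 /\ fun_rep (irr_fam d) e = 1%:M.
Proof.
move=> cd; apply: comatrix_sep (irr_mxP c) (irr_mxP d) _.
- by case: (coalg_ofP c).
- by case: (coalg_ofP d).
move=> CD; apply: cd; apply: val_inj; apply: (@has_char_inj (coalg_of c)).
  exact: coalg_ofP.
by rewrite CD; exact: coalg_ofP.
Qed.

(** A functional equal to 0 on C and to [eps] on [coalg_of d] would send the common character both
    to 0 and to its degree, nonzero in characteristic zero. *)
Lemma coalg_of_eq C d : has_char C (val d) -> C = coalg_of d.
Proof.
move=> [sC [n [x [xC dE]]]]; apply: contrapT => CD.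
have [sD _] := coalg_ofP d.
have [e [xe ye]] := comatrix_sep sC sD xC (irr_mxP d) CD.
have := corep_trace (irr_mx d) e; rewrite ye mxtrace1 -irr_mx_trace dE corep_trace xe.
by rewrite raddf0 => /esym/eqP; rewrite (negPf (natr_neq0 (irr_dim_gt0 d))).
Qed.

Lemma irr1 : exists d, val d = 1 /\ coalg_of d = <[1]>%VS.
Proof.
pose x : 'M[H]_1 := 1%:M.
have x1 i j : x i j = 1 by rewrite !ord1 mxE eqxx.
have xC : comatrix_basis <[1]>%VS x.
  split=> [i j|]; first by rewrite big_ord1 !x1 comul1.
  rewrite /image_mem (eq_map (_ : _ =1 fun=> 1)) => [|p]; last by rewrite x1.
  rewrite (_ : map _ _ = [:: 1]) ?/basis_of ?span_seq1 ?eqxx ?seq1_free ?oner_eq0 //.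
  apply/(@eq_from_nth _ 0) => [|i]; rewrite size_map -cardE card_prod card_ord // => i1.
  by rewrite (nth_map (ord0, ord0)) -?cardE ?card_prod ?card_ord //; case: i i1.
have irr1 : has_char <[1]>%VS (1 : H).
  by split; [exact: comatrix_simple xC | exists 1%N, x; rewrite mxtrace1].
have one_irr : irr H 1 by exists <[1]>%VS.
by exists (SigSub (mem_set one_irr)); split=> //; apply/esym/coalg_of_eq.
Qed.

Lemma irr_of_rep n (r : A -> 'M[k]_n) : arep r -> (0 < n)%N ->
  (forall B, exists p, r p = B) -> exists d, (forall p, \tr (r p) = p (val d)) /\
  (forall p : A, (forall h, h \in coalg_of d -> p h = 0) -> r p = 0).
Proof.
move=> ra n0 surj; have [C [x [xC sC rE]]] := irr_rep_char ra n0 surj.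
have xch : has_char C (\tr x) by split=> //; exists n, x.
have x_irr : irr H (\tr x) by exists C.
exists (SigSub (mem_set x_irr)); split=> p; first by rewrite rE corep_trace.
rewrite -(@coalg_of_eq C) // => p0; rewrite rE; apply/matrixP => i j; rewrite !mxE.
by apply: p0; apply: comatrix_mem xC.
Qed.

(** Cosemisimplicity enters here: [lam1] normalises the separability idempotent of the dual. *)
Lemma arep_decomp n (r : A -> 'M[k]_n) : arep r -> exists s : seq (irr H),
  (forall p, \tr (r p) = \sum_(d <- s) p (val d)) /\
  (forall p : A, (forall d, d \in s -> forall h, h \in coalg_of d -> p h = 0) -> r p = 0).
Proof.
move=> ra.
have cas := @dual_casimir k H; have cas1 := dual_casimir1 lam1.
have [s [irrs trs kers]] := rep_decomp cas cas1 ra.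
have [d1 _] := irr1.
have /choice[f fE] (t : family A) : exists d : irr H, t \in s ->
    (forall p : A, \tr (fun_rep t p) = p (val d)) /\
    (forall p : A, (forall h, h \in coalg_of d -> p h = 0) -> fun_rep t p = 0).
  have [ts|] := boolP (t \in s); last by exists d1.
  have it := irrs t ts; have [rt t0 _] := it.
  have [|d dP] := irr_of_rep rt t0; last by exists d.
  exact: (burnside cas cas1 rt it).
exists (map f s); split=> p.
  rewrite trs big_map big_seq [RHS]big_seq; apply: eq_bigr => t ts.
  by have [-> _] := fE t ts.
move=> p0; apply: kers => t ts; have [_] := fE t ts; apply=> h.
by apply: p0; apply: map_f.
Qed.

(** A functional vanishing on the subcoalgebras of the constituents of the regular representation
    acts as 0, hence is 0. *)
Lemma irr_cover : exists s : seq (irr H), forall U,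
  (forall d, d \in s -> (coalg_of d <= U)%VS) -> U = fullv.
Proof.
have [s [_ ker]] := arep_decomp (reg_rep_isrep (@bilin_conv k H) (@convA k H)
  (@convp1 k H)).
exists s => U sU; apply/eqP; rewrite eqEsubv subvf; apply/subvP => v _.
apply/contraT => /dual_sep[p [pU pv]].
suff p0 : p = 0 by rewrite p0 lfunE eqxx in pv.
apply: (reg_rep_eq0 (@bilin_conv k H) (@conv1p k H)); apply: ker => d ds h hd.
by apply: pU; apply: (subvP (sU d ds)).
Qed.

(** An irreducible character outside the covering list could be separated from the whole list by a
    functional, which would then vanish on all of H. *)
Lemma irr_finite : exists s : seq (irr H), uniq s /\ forall d, d \in s.
Proof.
have [s sU] := irr_cover; exists (undup s); split; first exact: undup_uniq.
move=> d; rewrite mem_undup; apply/contraT => ds.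
have [||e [e1 e0]] := @rep_sep_seq k A (@conv k H) (counit : A) _ (fun_rep (irr_fam d))
    (map irr_fam s) (comatrix_isrep (irr_mxP d)).
- by move=> r /mapP[c _ ->]; apply: comatrix_isrep (irr_mxP c).
- move=> r /mapP[c cs ->]; apply: irr_sep => cd.
  by rewrite -cd cs in ds.
have : lker e = fullv.
  apply: sU => c cs; apply/subvP => h hc; rewrite memv_ker.
  by apply/eqP/(comatrix_eq0 (irr_mxP c)) => //; apply: (e0 (irr_fam c)); apply: map_f.
move=> kE; have : val d \in lker e by rewrite kE memvf.
rewrite memv_ker (comatrix_eq1 (irr_mxP d) e1) ?irr_mem //.
by rewrite (negPf (eps_irr d)).
Qed.

Lemma irr_full U : (forall d, (coalg_of d <= U)%VS) -> U = fullv.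
Proof. by have [s sU] := irr_cover => dU; apply: sU => d _. Qed.

(** The functional [e] is the sum of the central idempotents of the dual indexed by [X]. *)
Lemma irr_functional (X : pred (irr H)) :
  exists e : A, forall d h, h \in coalg_of d -> e h = if X d then eps h else 0.
Proof.
have [s [us sP]] := irr_finite.
have /choice[f fE] t : exists e, fun_rep (irr_fam t) e = 1%:M /\
    forall c, c != t -> fun_rep (irr_fam c) e = 0.
  have [||e [e1 e0]] := @rep_sep_seq k A (@conv k H) (counit : A) _ (fun_rep (irr_fam t))
      (map irr_fam (rem t s)) (comatrix_isrep (irr_mxP t)).
  - by move=> r /mapP[c _ ->]; apply: comatrix_isrep (irr_mxP c).
  - move=> r /mapP[c]; rewrite mem_rem_uniq // inE => /andP[/eqP ct _] ->.
    exact: irr_sep.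
  exists e; split=> // c ct; apply: e0; apply: map_f.
  by rewrite mem_rem_uniq // inE ct sP.
exists (\sum_(t <- s | X t) f t) => d h hd; rewrite sum_lfunE.
have f0 t : t != d -> f t h = 0.
  move=> td; have [_ ft0] := fE t; apply: (comatrix_eq0 (irr_mxP d)) hd.
  by apply: (ft0 d); rewrite eq_sym.
have f1 : f d h = eps h by apply: (comatrix_eq1 (irr_mxP d)) => //; case: (fE d).
case: ifP => Xd; last first.
  by rewrite big1_seq // => t /andP[Xt _]; apply: f0; apply: contraTneq Xt => ->;
    rewrite Xd.
rewrite big_mkcond (bigD1_seq d) //= Xd f1 big1 ?addr0 // => t td.
by case: ifP => // _; apply: f0.
Qed.

(** The Kronecker product [Z] of the two comatrices satisfies the comatrix identity, but its entries
    may be linearly dependent. It is therefore decomposed as a representation of the dual; its trace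
    shows the constituents to be those of the product of the characters. *)
Lemma coalg_of_prod (x y : irr H) U :
  (forall z, constituent z (val x * val y) -> (coalg_of z <= U)%VS) ->
  (coalg_of x * coalg_of y <= U)%VS.
Proof.
move=> zU.
have [xE _] := irr_mxP x; have [yE _] := irr_mxP y.
move: (irr_mxP x) (irr_mxP y) (irr_mx_trace x) (irr_mx_trace y).
move: (irr_mx x) (irr_mx y) xE yE; move: (projT1 _) (projT1 _) =>
  n m X Y XE YE XC YC xtr ytr.
pose N := #|{: 'I_m * 'I_n}|.
pose ev (i : 'I_N) : 'I_m * 'I_n := enum_val i.
pose Z : 'M[H]_N := \matrix_(i, j) (X (ev i).1 (ev j).1 * Y (ev i).2 (ev j).2).
have ZE i j : Z i j = X (ev i).1 (ev j).1 * Y (ev i).2 (ev j).2 by rewrite mxE.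
have sumN (V : vectType k) (F : 'I_m * 'I_n -> V) : \sum_(l : 'I_N) F (ev l)
  = \sum_a \sum_b F (a, b).
  by rewrite pair_bigA -(big_enum_val F); apply: eq_big => //; case.
have Zcom i j : comul (Z i j) = \sum_l tens (Z i l) (Z l j).
  have bt := tens_bilin H H.
  transitivity (sw (@tens k H H) (Z i j)).
    by rewrite /sw [LHS]tensor_sum.
  rewrite ZE swM // sw_comatrix //; last by mlin.
  under eq_bigr => a _ do (rewrite sw_comatrix //; last by mlin).
  rewrite -(sumN _ (fun ab => tens (X _ ab.1 * Y _ ab.2) (X ab.1 _ * Y ab.2 _))).
  by apply: eq_bigr => l _; rewrite !ZE.
have Zeps i j : eps (Z i j) = (i == j)%:R.
  rewrite ZE epsM (comatrix_eps XC) (comatrix_eps YC) -natrM mulnb -xpair_eqE.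
  by rewrite -!surjective_pairing (inj_eq enum_val_inj).
have [s [trs ker]] := arep_decomp (corep_isrep Zcom Zeps).
have trZ : \tr Z = val x * val y.
  rewrite xtr ytr /mxtrace big_distrl /=; under [RHS]eq_bigr =>
    i _ do rewrite big_distrr /=.
  by rewrite -(sumN _ (fun ab => X ab.1 ab.1 * Y ab.2 ab.2)); apply: eq_bigr => l _;
    rewrite ZE.
have xyE : val x * val y = \sum_(d <- s) val d.
  apply: eq_dual => p; rewrite -trZ corep_trace trs.
  by rewrite (islin_big _ _ _ (islin_fun p)).
have sU d : d \in s -> (coalg_of d <= U)%VS by move=> ds; apply: zU; exists s.
have ZU i j : Z i j \in U.
  apply/contraT => /dual_sep[p [pU]].
  have /matrixP/(_ i j) : corep_fun Z p = 0.
    by apply: ker => d ds h hd; apply: pU; apply: (subvP (sU d ds)).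
  by rewrite !mxE -ZE => ->; rewrite eqxx.
have XYU a a' b b' : X a a' * Y b b' \in U.
  have := ZU (enum_rank (a, b)) (enum_rank (a', b')).
  by rewrite ZE /ev !enum_rankK.
apply/prodvP => g h gx hy.
have lg : islin (fun g => g * h) by lin.
have : (coalg_of x <= hom_of lg @^-1: U)%VS.
  apply: (comatrix_span XC) => a a'; rewrite -memv_preim hom_ofE.
  have lh : islin (fun h => X a a' * h) by lin.
  have : (coalg_of y <= hom_of lh @^-1: U)%VS.
    by apply: (comatrix_span YC) => b b'; rewrite -memv_preim hom_ofE.
  by move/subvP/(_ h hy); rewrite -memv_preim hom_ofE.
by move/subvP/(_ g gx); rewrite -memv_preim hom_ofE.
Qed.

End CharacterFacts.

(** * The grading and the Mackey isomorphism *)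

Section Grading.
Variables (k : closedFieldType) (H : hopfType k).
Hypotheses (char0 : [pchar k] =i pred0) (lam1 : lam (1 : H) != 0).
Variables (gT : finGroupType) (deg : irr H -> gT).
Hypothesis degG : is_grading deg.
Local Notation S := (antipode : H -> H).
Local Notation gp := (graded_part deg).
Implicit Types (X Y Z : {set gT}) (U : {vspace H}) (c d : irr H) (N : {group gT}).

Lemma gp_sub X U : (forall d, deg d \in X -> (coalg_of d <= U)%VS) -> (gp X <= U)%VS.
Proof. by move=> XU; apply: spanP_sub => h [d [dX hd]]; apply: (subvP (XU d dX)). Qed.

Lemma sub_gp X d : deg d \in X -> (coalg_of d <= gp X)%VS.
Proof. by move=> dX; apply/subvP => h hd; apply: mem_spanP; exists d. Qed.

Lemma gpS X Y : X \subset Y -> (gp X <= gp Y)%VS.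
Proof. by move=> XY; apply: gp_sub => d dX; apply: sub_gp; apply: (fintype.subsetP XY). Qed.

Definition gp_fun X := projT1 (cid (irr_functional char0 lam1 (fun d => deg d \in X))).

Lemma gp_funE X d h : h \in coalg_of d -> gp_fun X h = if deg d \in X then eps h else 0.
Proof. exact: (projT2 (cid (irr_functional char0 lam1 (fun d => deg d \in X)))). Qed.

Lemma islin_gproj X : islin (fun h => sw (fun x y => (gp_fun X x : k) *: y) h).
Proof. by lin. Qed.

(** The projection onto H(X) along the other simple subcoalgebras, obtained by hitting the left leg
    with a functional that is [eps] on H(X) and 0 elsewhere. *)
Definition gproj X : 'End(H) := hom_of (islin_gproj X).

Lemma gprojE X d h : h \in coalg_of d -> gproj X h = if deg d \in X then h else 0.
Proof.
move=> hd; rewrite hom_ofE.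
transitivity (sw (fun x y => (if deg d \in X then 1 else 0) *: (eps x *: y)) h).
  apply: (eq_subcoalg_sw (@coalg_of_subcoalg _ _ d)) hd => [||x y xd yd]; try by mlin.
  by rewrite (gp_funE _ xd); case: ifP; rewrite ?scale1r ?scale0r.
rewrite -sw_scale (sw_counitl (f := id)); last exact: islin_id.
by case: ifP; rewrite ?scale1r ?scale0r.
Qed.

Lemma gproj_eq (V : vectType k) (f g : 'Hom(H, V)) :
  (forall d h, h \in coalg_of d -> f h = g h) -> forall h, f h = g h.
Proof.
move=> fg h; apply/eqP; rewrite -subr_eq0.
have -> : f h - g h = (f - g) h by rewrite add_lfunE opp_lfunE.
rewrite -memv_ker.
rewrite (irr_full char0 lam1 (U := lker (f - g))) ?memvf // => d; apply/subvP => x xd.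
by rewrite memv_ker add_lfunE opp_lfunE (fg d) // subrr.
Qed.

Lemma gp_eq (V : vectType k) (f g : 'Hom(H, V)) X :
  (forall d h, deg d \in X -> h \in coalg_of d -> f h = g h) ->
  forall h, h \in gp X -> f h = g h.
Proof.
move=> fg h hX; apply/eqP; rewrite -subr_eq0.
have -> : f h - g h = (f - g) h by rewrite add_lfunE opp_lfunE.
rewrite -memv_ker; apply: (subvP (gp_sub _)) hX => d dX; apply/subvP => x xd.
by rewrite memv_ker add_lfunE opp_lfunE (fg d) // subrr.
Qed.

Lemma gproj_mem X h : gproj X h \in gp X.
Proof.
rewrite memv_preim (irr_full char0 lam1 (U := (gproj X @^-1: gp X)%VS)) ?memvf // => d.
apply/subvP => x xd; rewrite -memv_preim (gprojE _ xd).
by case: ifP => [dX|_]; [apply: (subvP (sub_gp dX)) | apply: mem0v].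
Qed.

Lemma gproj_id X h : h \in gp X -> gproj X h = h.
Proof.
move=> hX; rewrite -[RHS](id_lfunE h); apply: gp_eq hX => d x dX xd.
by rewrite (gprojE _ xd) dX id_lfunE.
Qed.

Lemma gproj_gproj X Y h : gproj X (gproj Y h) = gproj (X :&: Y) h.
Proof.
rewrite -comp_lfunE; apply: (@gproj_eq _ (gproj X \o gproj Y)%VF (gproj (X :&: Y))) =>
  d x xd.
rewrite comp_lfunE !(gprojE _ xd) inE andbC; case: (deg d \in Y); last by rewrite linear0.
by rewrite (gprojE _ xd).
Qed.

Lemma gpI X Y h : h \in gp X -> h \in gp Y -> h \in gp (X :&: Y).
Proof. by move=> hX hY; rewrite -(gproj_id hX) -(gproj_id hY) gproj_gproj gproj_mem. Qed.

Lemma gp0 : gp finset.set0 = 0%VS.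
Proof. by apply/eqP; rewrite -subv0; apply: gp_sub => d; rewrite inE. Qed.

Lemma gp_prod X Y U :
  (forall c d, deg c \in X -> deg d \in Y -> (coalg_of c * coalg_of d <= U)%VS) ->
  (gp X * gp Y <= U)%VS.
Proof.
move=> XYU; apply/prodvP => g h gX hY.
have lg : islin (fun g => g * h) by lin.
suff : (gp X <= hom_of lg @^-1: U)%VS.
  by move/subvP/(_ g gX); rewrite -memv_preim hom_ofE.
apply: gp_sub => c cX; apply/subvP => x xc; rewrite -memv_preim hom_ofE.
have lh : islin (fun h => x * h) by lin.
suff : (gp Y <= hom_of lh @^-1: U)%VS.
  by move/subvP/(_ h hY); rewrite -memv_preim hom_ofE.
apply: gp_sub => d dY; apply/subvP => y yd; rewrite -memv_preim hom_ofE.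
by apply: (subvP (XYU c d cX dY)); apply: memv_mul.
Qed.

Lemma gpM X Y : (gp X * gp Y <= gp (X * Y)%g)%VS.
Proof.
apply: gp_prod => c d cX dY; apply: coalg_of_prod => // z /degG zE.
by apply: sub_gp; rewrite zE mem_mulg.
Qed.

Lemma gpM_mem X Y x y : x \in gp X -> y \in gp Y -> x * y \in gp (X * Y)%g.
Proof. by move=> xX yY; apply: (subvP (gpM X Y)); apply: memv_mul. Qed.

Lemma irr_deg1 : exists d, deg d = 1%g /\ coalg_of d = <[1]>%VS.
Proof.
have [d [d1 dC]] := irr1 H char0; exists d; split=> //; apply: (mulgI (deg d)).
rewrite mulg1 -(@degG d d d) //; exists [:: d].
by rewrite mem_head big_seq1 d1 mulr1.
Qed.

Lemma gp1 : 1 \in gp [set 1%g].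
Proof.
have [d [d1 dC]] := irr_deg1.
by apply: (subvP (sub_gp (d := d) _)); rewrite ?inE ?d1 // dC memv_line.
Qed.

Lemma subcoalg_gp X : subcoalg (gp X).
Proof.
move=> h hX; rewrite memv_preim; apply: (subvP (gp_sub _)) hX => d dX.
apply/subvP => x xd; rewrite -memv_preim.
apply: subvP (coalg_of_subcoalg xd); apply: spanP_sub => _ [y [z [yd zd ->]]].
by apply: mem_spanP; exists y, z; split=> //; apply: (subvP (sub_gp dX)).
Qed.

Lemma gproj_mull X Y Z x y : (forall g h, g \in X -> (g * h \in Z)%g = (h \in Y)) ->
  x \in gp X -> gproj Z (x * y) = x * gproj Y y.
Proof.
move=> XYZ xX.
have l1 : islin (fun y => gproj Z (x * y)) by lin.
have l2 : islin (fun y => x * gproj Y y) by lin.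
rewrite -(hom_ofE l1) -(hom_ofE l2); apply: gproj_eq => d {}y yd; rewrite (hom_ofE l1)
  (hom_ofE l2) {l1 l2}.
have l3 : islin (fun x => gproj Z (x * y)) by lin.
have l4 : islin (fun x => x * gproj Y y) by lin.
rewrite -(hom_ofE l3) -(hom_ofE l4); apply: gp_eq xX => c {}x cX xc;
  rewrite (hom_ofE l3) (hom_ofE l4).
have xy : x * y \in gp [set (deg c * deg d)%g].
  apply: subvP (memv_mul xc yd); apply: coalg_of_prod => // z /degG zE.
  by apply: sub_gp; rewrite inE zE.
rewrite (gprojE _ yd) -(XYZ (deg c)) //; case: ifPn => [cdZ|cdZ].
  by apply: gproj_id; apply: subvP xy; apply: gpS; rewrite finset.sub1set.
rewrite mulr0 -(gproj_id xy) gproj_gproj (_ : _ :&: _ = finset.set0).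
  by apply/eqP; rewrite -memv0 -gp0 gproj_mem.
by apply/finset.setP => g; rewrite !inE; case: eqP => [->|]; rewrite ?(negPf cdZ) ?andbF.
Qed.

Lemma gproj_mulr X Y Z x y : (forall g h, h \in X -> (g * h \in Z)%g = (g \in Y)) ->
  y \in gp X -> gproj Z (x * y) = gproj Y x * y.
Proof.
move=> XYZ yX.
have l1 : islin (fun x => gproj Z (x * y)) by lin.
have l2 : islin (fun x => gproj Y x * y) by lin.
rewrite -(hom_ofE l1) -(hom_ofE l2); apply: gproj_eq => c {}x xc; rewrite (hom_ofE l1)
  (hom_ofE l2) {l1 l2}.
have l3 : islin (fun y => gproj Z (x * y)) by lin.
have l4 : islin (fun y => gproj Y x * y) by lin.
rewrite -(hom_ofE l3) -(hom_ofE l4); apply: gp_eq yX => d {}y dX yd;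
  rewrite (hom_ofE l3) (hom_ofE l4).
have xy : x * y \in gp [set (deg c * deg d)%g].
  apply: subvP (memv_mul xc yd); apply: coalg_of_prod => // z /degG zE.
  by apply: sub_gp; rewrite inE zE.
rewrite (gprojE _ xc) -(XYZ _ (deg d)) //; case: ifPn => [cdZ|cdZ].
  by apply: gproj_id; apply: subvP xy; apply: gpS; rewrite finset.sub1set.
rewrite mul0r -(gproj_id xy) gproj_gproj (_ : _ :&: _ = finset.set0).
  by apply/eqP; rewrite -memv0 -gp0 gproj_mem.
by apply/finset.setP => g; rewrite !inE; case: eqP => [->|]; rewrite ?(negPf cdZ) ?andbF.
Qed.

(** Uniqueness of convolution inverses: on C_d, the projection of S to degree g^-1 is still a right
    inverse of the identity, since x_1 S(x_2) lies in degree 1. *)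
Lemma antipode_gp X h : h \in gp X -> S h \in gp (X^-1)%g.
Proof.
move=> hX; rewrite memv_preim; apply: (subvP (gp_sub _)) hX => d dX {h}.
apply/subvP => h hd; rewrite -memv_preim; set g := deg d.
suff -> : S h = gproj [set g^-1%g] (S h).
  by apply: (subvP (gpS _)) (gproj_mem _ _); rewrite finset.sub1set memV_invg.
pose P := gproj [set g^-1%g].
have prS x : x \in coalg_of d -> sw (fun x1 x2 => x1 * P (S x2)) x = eps x *: 1.
  move=> xd; transitivity (gproj [set 1%g] (sw (fun x1 x2 => x1 * S x2) x)).
    rewrite sw_hom; apply: (eq_subcoalg_sw (@coalg_of_subcoalg _ _ d)) xd =>
      [||y z yd zd]; try by mlin.
    apply/esym/(@gproj_mull [set g]); last by apply: (subvP (sub_gp _)) yd; rewrite inE.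
    move=> a b; rewrite !inE => /eqP ->.
    by rewrite -(inj_eq (mulgI g^-1%g)) mulKg mulg1.
  by rewrite sw_antipoder linearZ /= gproj_id ?gp1.
transitivity (sw (fun x y => eps y *: S x) h).
  by rewrite (sw_counitr (f := S)) //; lin.
transitivity (sw (fun x y => S x * sw (fun x1 x2 => x1 * P (S x2)) y) h).
  apply: (eq_subcoalg_sw (@coalg_of_subcoalg _ _ d)) hd => [||x y xd yd]; try by mlin.
  by rewrite prS // -scalerAr mulr1.
under eq_sw => x y do rewrite sw_mulr.
rewrite -sw_coassoc; last by mlin.
rewrite -(sw_counitl (f := fun x => P (S x))); last by lin.
apply: eq_sw => x y; under eq_sw => x1 x2 do rewrite mulrA.
by rewrite -sw_mull sw_antipodel -scalerAl mul1r.
Qed.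

Lemma hopf_subalg_gp N : hopf_subalg (gp N).
Proof.
split; [|by rewrite -{3}(mulGid N) gpM|exact: subcoalg_gp|].
  by apply: (subvP (gpS _)) gp1; rewrite finset.sub1set group1.
by apply/subvP => _ /memv_imgP[h hN ->]; rewrite -(invGid N); apply: antipode_gp.
Qed.

Lemma irr_expand d : exists2 y, y \in coalg_of d &
  eps y = 1 /\ forall h, h = sw (fun y1 y2 => y1 * (S y2 * h)) y.
Proof.
have e0 := eps_irr char0 d; have le : islin (fun x : H => eps x : k^o) by lin.
exists ((eps (val d))^-1 *: val d); first by rewrite memvZ // irr_mem.
have e1 : eps ((eps (val d))^-1 *: val d) = 1 by rewrite (islinZ le) [_ *: _]mulVf.
split=> // h; rewrite -[LHS]mul1r -[1](scale1r 1) -e1 -sw_antipoder sw_mull.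
by apply: eq_sw => x y; rewrite mulrA.
Qed.

Lemma inv_lcoset_mul (a : gT) X : ([set a]%SET^-1 * (a *: X))%g = X.
Proof.
by rewrite invg_set1 -[(a *: X)%g]/([set a]%SET * X)%g mulgA mulg_set1 mulVg mul1g.
Qed.

Lemma coalg_mul_gp c X : (coalg_of c * gp X)%VS = gp (deg c *: X)%g.
Proof.
apply/eqP; rewrite eqEsubv; apply/andP; split.
  rewrite -[(deg c *: X)%g]/([set deg c]%SET * X)%g; apply: subv_trans (gpM _ _).
  by apply: prodvSl; apply: sub_gp; rewrite inE.
apply/subvP => h hgN; have [y yc [_ yE]] := irr_expand c; rewrite (yE h).
apply: (subcoalg_sw (@coalg_of_subcoalg _ _ c)) yc => [|y1 y2 y1c y2c]; first by mlin.
apply: memv_mul => //.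
have : S y2 * h \in gp ([set deg c]%SET^-1 * (deg c *: X))%g.
  by apply: gpM_mem => //; apply: antipode_gp; apply: (subvP (sub_gp _)) y2c; rewrite inE.
by rewrite inv_lcoset_mul.
Qed.

(** Both legs of an element of C_d lie in C_d, so projecting one leg already projects the other. *)
Lemma sw_gprojl (V : vectType k) (b : H -> H -> V) X h : bilin b ->
  sw (fun x y => b (gproj X x) y) h = sw (fun x y => b (gproj X x) (gproj X y)) h.
Proof.
move=> bb; have l1 : islin (fun h => sw (fun x y => b (gproj X x) y) h) by lin.
have l2 : islin (fun h => sw (fun x y => b (gproj X x) (gproj X y)) h) by lin.
rewrite -(hom_ofE l1) -(hom_ofE l2); apply: gproj_eq => d {}h hd.
rewrite (hom_ofE l1) (hom_ofE l2).
apply: (eq_subcoalg_sw (@coalg_of_subcoalg _ _ d)) hd => [||x y xd yd]; try by mlin.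
rewrite !(gprojE _ xd) !(gprojE _ yd); case: ifP => // _.
by rewrite !(islin0 (bb.1 _)).
Qed.

(** * Integrals and conjugates of the subalgebras H(N) *)

Section GradedIntegral.
Variables (L : H) (intL : is_integral fullv L).

Definition supp : {set gT} := finset (fun g => `[< exists d, deg d = g >]).

(** If y in C_d has counit 1 and deg d = g, then y pr_1 L = pr_g (y L) = pr_g L. Thus the components
    of L in all degrees that occur have the same counit; [supp] accounts for a degree map that is
    not onto. *)
Lemma eps_gproj X : eps (gproj X L) = #|X :&: supp|%:R * eps (gproj [set 1%g] L).
Proof.
have le : islin (fun x : H => eps x : k^o) by lin.
have eg g : eps (gproj [set g] L) = (g \in supp)%:R * eps (gproj [set 1%g] L).
  rewrite inE; case: asboolP => [[d dg]|nd].
    have [y yd [y1 _]] := irr_expand d; have [_ LL _ _] := intL.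
    have := @gproj_mull [set g] [set 1%g] [set g] y L.
    rewrite LL ?memvf // y1 scale1r => -> => [|a b|]; first by rewrite epsM y1.
      by rewrite !inE => /eqP ->; rewrite -(inj_eq (mulgI g^-1%g)) mulKg mulVg.
    by apply: (subvP (sub_gp _)) yd; rewrite inE dg.
  have : gproj [set g] L \in 0%VS.
    rewrite (subvP (gp_sub _) _ (gproj_mem _ _)) // => d /set1P dg.
    by case: nd; exists d.
  by rewrite memv0 => /eqP ->; rewrite (islin0 le) mul0r.
have -> : gproj X L = \sum_(g in X) gproj [set g] L.
  have ls : islin (fun h => \sum_(g in X) gproj [set g] h).
    move=> a u v; rewrite scaler_sumr -big_split; apply: eq_bigr => g _.
    by rewrite linearP.
  rewrite -(hom_ofE ls); apply: gproj_eq => d h hd; rewrite (hom_ofE ls) (gprojE _ hd).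
  under eq_bigr => g _ do rewrite (gprojE _ hd) inE.
  rewrite -big_mkcondr /=; case: ifPn => dX.
    rewrite (big_pred1 (deg d)) // => g /=.
    by rewrite [deg d == g]eq_sym; case: eqVneq => [->|_]; rewrite ?dX ?andbF.
  rewrite big_pred0 // => g.
  by rewrite [deg d == g]eq_sym; case: eqVneq => [->|_]; rewrite ?(negPf dX) ?andbF.
rewrite (islin_big _ _ _ le) (eq_bigr _ (fun g _ => eg g)) -mulr_suml; congr (_ * _).
rewrite -natr_sum; congr _%:R; rewrite -sum1_card.
rewrite [RHS](eq_bigl (fun g => (g \in X) && (g \in supp))) => [|g];
  last by rewrite finset.in_setI.
by rewrite big_mkcondr.
Qed.

(** The counits of the components of L add up to 1, so their common value is nonzero; in
    characteristic zero neither is any positive multiple of it. *)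
Lemma eps_gproj_neq0 X : 1%g \in X -> eps (gproj X L) != 0.
Proof.
move=> X1; have : eps (gproj [set: gT] L) != 0.
  rewrite (_ : gproj _ L = L); first by case: intL => _ _ _ ->; exact: oner_neq0.
  rewrite -[RHS](id_lfunE L); apply: gproj_eq => d h hd.
  by rewrite (gprojE _ hd) inE id_lfunE.
rewrite (eps_gproj X) (eps_gproj [set: gT]%SET) !mulf_eq0 !negb_or => /andP[_ ->];
  rewrite andbT.
apply: (natr_neq0 char0); apply/card_gt0P; exists 1%g; rewrite !inE X1 /=.
by apply/asboolP; have [d [d1 _]] := irr_deg1; exists d.
Qed.

(** The projection to H(N) commutes with multiplication by H(N), so the normalised projection of L
    is the integral. *)
Lemma integral_gp N : is_integral (gp N) (integral (gp N)).
Proof.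
apply: (xgetPex _ _); exists ((eps (gproj N L))^-1 *: gproj N L).
have [_ LL LR _] := intL; have e0 := eps_gproj_neq0 (group1 N).
have le : islin (fun x : H => eps x : k^o) by lin.
split; first by rewrite memvZ // gproj_mem.
- move=> a aN; rewrite -scalerAr -(@gproj_mull N N N) // => [|g h gN];
  last by rewrite groupMl.
  by rewrite LL ?memvf // linearZ /= !scalerA mulrC.
- move=> a aN; rewrite -scalerAl -(@gproj_mulr N N N) // => [|g h gN];
  last by rewrite groupMr.
  by rewrite LR ?memvf // linearZ /= !scalerA mulrC.
- by rewrite (islinZ le) [_ *: _]mulVf.
Qed.

Lemma lcoset_mul_integral c N y h : y \in coalg_of c ->
  eps y = 1 -> (forall h, h = sw (fun y1 y2 => y1 * (S y2 * h)) y) ->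
  h \in gp (deg c *: N)%g -> h * integral (gp N) = eps h *: (y * integral (gp N)).
Proof.
set I := integral (gp N); have [_ IL _ _] := integral_gp N; rewrite -/I in IL.
move=> yc y1 yE hgN; rewrite {1}(yE (h * I)).
have le : islin (fun x : H => eps x : k^o) by lin.
have lc : islin (fun x : H => eps x *: I) by lin.
transitivity (sw (fun y1 y2 => y1 * (eps (S y2 * h) *: I)) y).
  apply: (eq_subcoalg_sw (@coalg_of_subcoalg _ _ c)) yc => [||u v uc vc]; try by mlin.
  rewrite [S v * _]mulrA IL //.
  have : S v * h \in gp ([set deg c]%SET^-1 * (deg c *: N))%g.
    by apply: gpM_mem => //; apply: antipode_gp; apply: (subvP (sub_gp _)) vc; rewrite inE.
  by rewrite inv_lcoset_mul.
transitivity (sw (fun y1 y2 => eps y2 *: (eps h *: (y1 * I))) y); last first.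
  by rewrite (sw_counitr (f := fun y => eps h *: (y * I))) //; lin.
by apply: eq_sw => u v; rewrite -scalerAr epsM eps_antipode scalerA.
Qed.

(** Conjugation [:^] is a right action, so the group on the right is g N g^-1 for g = deg c. *)
Lemma conj_sub_gp c N : conj_sub c (gp N) = gp (N :^ (deg c)^-1)%g.
Proof.
set I := integral (gp N); have [IN _ _ I1] := integral_gp N; rewrite -/I in IN I1.
have [y yc [y1 yE]] := irr_expand c.
have absorb h := @lcoset_mul_integral c N y h yc y1 yE; rewrite -/I in absorb.
have cg : val c \in gp [set deg c].
  by apply: (subvP (sub_gp _)) (irr_mem c); rewrite inE.
have dcg d : val d * val c \in gp [set (deg d * deg c)%g].
  rewrite -mulg_set1; apply: gpM_mem cg.
  by apply: (subvP (sub_gp _)) (irr_mem d); rewrite inE.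
have cond d : (val d * val c * I = eps (val d) *: (val c * I)) <->
    (deg d \in N :^ (deg c)^-1)%g.
  rewrite mem_conjg invgK; split=> [e|dN].
    (* The two sides of the condition lie in H(g N) and H(deg d g N). Since this element is nonzero,
       the two cosets must meet. *)
    have in1 : eps (val d) *: (val c * I) \in gp (deg c *: N)%g.
      by rewrite memvZ // -coalg_mul_gp memv_mul // irr_mem.
    have in2 : eps (val d) *: (val c * I) \in gp ((deg d * deg c) *: N)%g.
      by rewrite -e; apply: gpM_mem IN; apply: dcg.
    have : eps (val d) *: (val c * I) != 0.
      apply/eqP => /(congr1 (@eps k H)); have le : islin (fun x : H => eps x : k^o) by lin.
      rewrite (islinZ le) epsM I1 mulr1 (islin0 le) => /eqP.
      by rewrite mulf_eq0 !(negPf (eps_irr char0 _)).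
    apply: contraNT => nN; rewrite -memv0 -gp0.
    apply: subvP (gpI in1 in2); apply: gpS; apply/fintype.subsetP => g.
    rewrite inE => /andP[/lcosetP[n nN' ->] /lcosetP[m mN e']]; case/negP: nN.
    have -> : (deg d ^ deg c = n * m^-1)%g.
      by apply: (mulgI (deg c)); rewrite -conjgC mulgA e' mulgK.
    by rewrite groupM ?groupV.
  rewrite absorb; last first.
    apply: (subvP (gpS _)) (dcg d); rewrite finset.sub1set.
    by apply/lcosetP; exists (deg d ^ deg c)%g; rewrite // -conjgC.
  rewrite (absorb (val c)); last first.
    by apply: (subvP (gpS _)) cg; rewrite finset.sub1set lcoset_refl.
  by rewrite epsM scalerA.
by rewrite /conj_sub /graded_part; congr spanP; apply/seteqP; split=>
  h [d [/cond dP hd]]; exists d.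
Qed.

End GradedIntegral.
End Grading.

(** * The inverse of the Mackey map *)

Section Mackey.
Variables (k : closedFieldType) (H : hopfType k).
Hypotheses (char0 : [pchar k] =i pred0) (lam1 : lam (1 : H) != 0).
Variables (L : H) (intL : is_integral fullv L).
Variables (gT : finGroupType) (deg : irr H -> gT).
Hypothesis degG : is_grading deg.
Variables (M N : {group gT}).
Local Notation S := (antipode : H -> H).
Local Notation gp := (graded_part deg).
Local Notation gproj := (gproj char0 lam1 deg).
Variable V : lmodule (gp N).

Section OneCoset.
Variable c : irr H.
Let g := deg c.
Let Q := (N :^ g^-1)%G.
Local Notation CK := (coalg_of c * gp N)%VS.
Local Notation LC := (gp M :&: conj_sub c (gp N))%VS.
Local Notation ind := (@ind_tens k H (gp N) V).

Let CKE : CK = gp (g *: N)%g. Proof. exact: coalg_mul_gp. Qed.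

Let KK : (gp N * gp N <= gp N)%VS.
Proof. by have [] := hopf_subalg_gp char0 lam1 degG N. Qed.

Let LL : (gp M * gp M <= gp M)%VS.
Proof. by have [] := hopf_subalg_gp char0 lam1 degG M. Qed.

Let csE : conj_sub c (gp N) = gp Q.
Proof. exact: (conj_sub_gp char0 lam1 degG intL). Qed.

Let QgN a b : b \in (g *: N)%g -> (a * b \in g *: N)%g = (a \in Q).
Proof.
move=> /lcosetP[n nN ->]; rewrite mem_conjg invgK mem_lcoset !mulgA groupMr //.
by rewrite conjgE !mulgA.
Qed.

Let csCK : (conj_sub c (gp N) * CK <= CK)%VS.
Proof.
rewrite csE CKE; apply: subv_trans (gpM char0 lam1 degG _ _) _; apply: gpS.
by apply/fintype.subsetP => _ /mulsgP[a b aQ bN ->]; rewrite QgN.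
Qed.

(** Taking arguments in all of H makes the tensor usable inside Sweedler sums. Outside [gp M] and
    [CK] its value is junk, but linear junk. *)
Definition gen_tens (u w : H) (v : V) : @mackey_summand k H (gp M) (gp N) V c :=
  btens _ _ (vsproj (gp M) u) (btens _ _ (vsproj CK w) v).

Let lp (U : {vspace H}) : islin (vsproj U). Proof. exact: linearP. Qed.

Let bo := btens_bilin (@subv_mulr k H (gp M) LC) (@conj_act k H (gp N) V c LC).
Let bi := btens_bilin (@subv_mulr k H CK (gp N)) (fun a v => lmod_act V a v).

Lemma gen_tens1 w v : islin (fun u => gen_tens u w v).
Proof. by move=> a x y; rewrite /gen_tens lp bo.1. Qed.

Lemma gen_tens2 u v : islin (fun w => gen_tens u w v).
Proof. by move=> a x y; rewrite /gen_tens lp bi.1 bo.2. Qed.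

Lemma gen_tens3 u w : islin (gen_tens u w).
Proof. by move=> a x y; rewrite /gen_tens bi.2 bo.2. Qed.

Lemma gen_tens_bal u s x v : u \in gp M -> s \in LC -> x \in CK ->
  gen_tens u (s * x) v = gen_tens (u * s) x v.
Proof.
move=> uM sL xC; rewrite /gen_tens.
have ACK : (LC * CK <= CK)%VS by apply: subv_trans csCK; apply/prodvSl/capvSr.
have -> : vsproj (gp M) (u * s) = subv_mulr (vsproj _ u) (vsproj LC s).
  by rewrite /subv_mulr !vsprojK.
rewrite btens_bal conj_actE //; congr (btens _ _ _ (btens _ _ _ _)).
by rewrite /subv_mull !vsprojK.
Qed.

Definition mackey_inv_fun (h : H) (v : V) : @mackey_summand k H (gp M) (gp N) V c :=
  sw (fun x y => gen_tens (gproj M x) (gproj (g *: N)%g (S y * h)) v) L.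

Lemma mackey_inv_bilin : bilin mackey_inv_fun.
Proof.
apply: bilinP => z; apply: islin_swf => x y; last exact: gen_tens3.
by apply: (islin_comp (gen_tens2 _ _)); lin.
Qed.

Lemma mackey_inv_bal h (a : subvs_of (gp N)) v :
  mackey_inv_fun (h * vsval a) v = mackey_inv_fun h (lmod_act V a v).
Proof.
apply: eq_sw => x y; rewrite mulrA /gen_tens.
rewrite (@gproj_mulr _ _ char0 lam1 _ _ degG N (g *: N)%g (g *: N)%g) ?subvsP //;
  last first.
  by move=> s t tN; rewrite !mem_lcoset mulgA groupMr.
congr (btens _ _ _ _); rewrite -btens_bal; congr (btens _ _ _ _).
by rewrite /subv_mulr vsprojK // CKE gproj_mem.
Qed.

Definition mackey_inv (q : @induced k H (gp N) V) : @mackey_summand k H (gp M) (gp N) V c :=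
  (eps (gproj (M :&: Q) L))^-1 *: btlift mackey_inv_fun q.

Lemma mackey_inv_lin : islin mackey_inv.
Proof. by apply: islin_scaler => a x y; rewrite linearP. Qed.

Lemma mackey_invE h v :
  mackey_inv (ind h v) = (eps (gproj (M :&: Q) L))^-1 *: mackey_inv_fun h v.
Proof.
rewrite /mackey_inv btliftE //; first exact: mackey_inv_bilin.
exact: mackey_inv_bal.
Qed.

(** For y in C_d the degree of S y is (deg d)^-1, which lies in the subgroup [Q] exactly when deg d
    does. The projections thus act on C_d by 0 or 1, leaving x S y to contract. *)
Lemma sw_gproj_antipode h :
  sw (fun x y => gproj M x * gproj Q (S (gproj M y))) h = eps (gproj (M :&: Q) h) *: 1.
Proof.
have le : islin (fun x : H => eps x : k^o) by lin.
have l1 : islin (fun h => sw (fun x y => gproj M x * gproj Q (S (gproj M y))) h) by lin.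
have l2 : islin (fun h => eps (gproj (M :&: Q) h) *: (1 : H)) by lin.
rewrite -(hom_ofE l1) -(hom_ofE l2); apply: gproj_eq => // d {}h hd.
rewrite (hom_ofE l1) (hom_ofE l2) (gprojE _ _ _ _ hd).
transitivity (sw (fun x y => (deg d \in M :&: Q)%:R *: (x * S y)) h).
  apply: (eq_subcoalg_sw (@coalg_of_subcoalg _ _ d)) hd => [||x y xd yd]; try by mlin.
  rewrite (gprojE _ _ _ _ xd) (gprojE _ _ _ _ yd) finset.in_setI.
  case: ifP => dM; last by rewrite mul0r scale0r.
  have Sy : S y \in gp [set (deg d)^-1%g].
    rewrite -invg_set1; apply: antipode_gp => //.
    by apply: (subvP (sub_gp _)) yd; rewrite inE.
  have [dQ|dQ] := boolP (deg d \in Q).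
    rewrite scale1r gproj_id //; apply: (subvP (gpS _ _)) Sy.
    by rewrite finset.sub1set groupV.
  rewrite scale0r -(gproj_id char0 lam1 Sy) gproj_gproj (_ : _ :&: _ = finset.set0).
    have : gproj finset.set0 (S y) \in gp finset.set0 by apply: gproj_mem.
    by rewrite gp0 memv0 => /eqP ->; rewrite mulr0.
  apply/finset.setP => t; rewrite !inE; apply/andP => -[tQ /eqP tE].
  by case/negP: dQ; rewrite -groupV -tE.
rewrite -sw_scale sw_antipoder; case: ifP => _; rewrite ?scale1r // !scale0r.
by rewrite (islin0 le) scale0r.
Qed.

(** The Casimir identity turns L_1 (x) S(L_2) l into l L_1 (x) S(L_2). After the projections, the
    factor pr_Q (S (pr_M L_2)) lies in the intersection of H(M) with the conjugate, crosses the
    tensor sign, and contracts against pr_M L_1. *)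
Lemma mackey_inv_same (l : subvs_of (gp M)) (x : subvs_of CK) v :
  mackey_inv (ind (vsval l * vsval x) v) = btens _ _ l (btens _ _ x v).
Proof.
have k0 : eps (gproj (M :&: Q) L) != 0.
  by apply: eps_gproj_neq0 => //; rewrite finset.in_setI !group1.
rewrite mackey_invE.
suff -> : mackey_inv_fun (vsval l * vsval x) v =
    eps (gproj (M :&: Q) L) *: gen_tens (vsval l) (vsval x) v.
  by rewrite scalerA mulVf // scale1r /gen_tens !vsvalK.
have [lM xC] := (subvsP l, subvsP x); move: (vsval l) (vsval x) lM xC => {}l {}x lM xC.
have g1 := gen_tens1; have g2 := gen_tens2.
pose b u w := gen_tens (gproj M u) (gproj (g *: N)%g (w * x)) v.
have bb : bilin b.
  apply: bilinP => z; first by apply: (islin_comp (g1 _ _)); lin.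
  by apply: (islin_comp (g2 _ _)); lin.
transitivity (sw (fun u w => b u (S w * l)) L).
  by apply: eq_sw => u w; rewrite /b mulrA.
rewrite -(int_casimir intL) //.
have e1 u w : b (l * u) (S w) = gen_tens (l * gproj M u) (gproj Q (S w) * x) v.
  rewrite /b (@gproj_mull _ _ char0 lam1 _ _ degG M M M) // => [|s t sM]; last first.
    by rewrite groupMl.
  have xg : x \in gp (g *: N)%g by rewrite -CKE.
  by rewrite (@gproj_mulr _ _ char0 lam1 _ _ degG (g *: N)%g Q (g *: N)%g) // => s t /QgN.
under eq_sw => u w do rewrite e1.
pose b2 u w := gen_tens (l * u) (gproj Q (S w) * x) v.
have bb2 : bilin b2.
  apply: bilinP => z; first by apply: (islin_comp (g1 _ _)); lin.
  by apply: (islin_comp (g2 _ _)); lin.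
(* Copying pr_M to the second leg places S w in [gp M], as needed for it to cross the tensor
   sign. *)
transitivity (sw (fun u w => b2 (gproj M u) (gproj M w)) L).
  by rewrite -(sw_gprojl char0 lam1).
transitivity (sw (fun u w => gen_tens (l * (gproj M u * gproj Q (S (gproj M w)))) x v) L).
  apply: eq_sw => u w; rewrite /b2 gen_tens_bal ?mulrA //.
    by apply: (subvP LL); rewrite memv_mul ?gproj_mem.
  have SM : S (gproj M w) \in gp M.
    by rewrite -[X in gp X](invGid M); apply: antipode_gp => //; exact: gproj_mem.
  rewrite memv_cap csE gproj_mem andbT -(gproj_id char0 lam1 SM) gproj_gproj.
  apply: subvP (gproj_mem _ _ _ _ _); apply: gpS; exact: finset.subsetIr.
have lz : islin (fun z => gen_tens (l * z) x v).
  by apply: (islin_comp (g1 _ _)); lin.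
by rewrite -(sw_lin _ _ lz) sw_gproj_antipode (islinZ lz) mulr1.
Qed.

(** The element S(pr_M L_2) l x has degrees in M (deg d) N. If this set met g N, the double cosets
    of c and d would agree. *)
Lemma mackey_inv_other (d : irr H) : ~ dcoset_rel (gp M) (gp N) (coalg_of c) (coalg_of d) ->
  forall l x v, l \in gp M -> x \in (coalg_of d * gp N)%VS ->
  mackey_inv (ind (l * x) v) = 0.
Proof.
move=> ncd l x v lM; rewrite (coalg_mul_gp char0 lam1 degG) => xN.
rewrite mackey_invE (_ : mackey_inv_fun _ _ = 0) ?scaler0 //.
have g1 := gen_tens1; have g2 := gen_tens2.
pose b u w := gen_tens u (gproj (g *: N)%g (S w * (l * x))) v.
have bb : bilin b.
  apply: bilinP => z; first by apply: (islin_comp (g1 _ _)); lin.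
  by apply: (islin_comp (g2 _ _)); lin.
transitivity (sw (fun u w => b (gproj M u) (gproj M w)) L).
  by rewrite -(sw_gprojl char0 lam1).
transitivity (sw (fun _ _ => 0 *: (0 : @mackey_summand k H (gp M) (gp N) V c)) L);
  last first.
  by rewrite -sw_scale scale0r.
apply: eq_sw => u w; rewrite /b mulrA (_ : gproj (g *: N)%g _ = 0).
  by rewrite (islin0 (g2 _ _)) scale0r.
have : S (gproj M w) * l \in gp M.
  apply: (subvP LL); apply: memv_mul => //.
  by rewrite -[X in gp X](invGid M); apply: antipode_gp => //; exact: gproj_mem.
move: (S _ * l) => s sM {u w}.
have l1 : islin (fun s => gproj (g *: N)%g (s * x)) by lin.
rewrite -(hom_ofE l1) -(zero_lfunE _ s); apply: gp_eq sM => e {}s eM se.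
rewrite (hom_ofE l1) zero_lfunE.
have sx : s * x \in gp (deg e *: (deg d *: N))%g.
  by rewrite -(coalg_mul_gp char0 lam1 degG) memv_mul.
rewrite -(gproj_id char0 lam1 sx) gproj_gproj.
have [->|/set0Pn[t]] := eqVneq ((g *: N) :&: (deg e *: (deg d *: N)))%g finset.set0.
  by apply/eqP; rewrite -memv0 -(gp0 deg) gproj_mem.
rewrite finset.in_setI => /andP[/lcosetP[n nN ->]].
rewrite !mem_lcoset => tN; case: ncd.
have ged : g \in (deg e *: (deg d *: N))%g.
  by rewrite !mem_lcoset -(groupMr _ nN) -!mulgA -?mulgA; rewrite !mulgA in tN *.
apply: subv_trans (sub_gp ged) _.
rewrite -!(coalg_mul_gp char0 lam1 degG) prodvA.
by do 2!apply: prodvSl; apply: sub_gp.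
Qed.

End OneCoset.

Section Component.
Variable c : irr H.
Local Notation comp := (@mackey_component k H (gp M) (gp N) V c).

Lemma mackey_component_lin : islin comp.
Proof. by move=> a x y; rewrite /mackey_component linearP. Qed.

Lemma gp_mackey_componentE (l : subvs_of (gp M)) (x : subvs_of (coalg_of c * gp N)) v :
  comp (btens _ _ l (btens _ _ x v)) =
    @ind_tens k H (gp N) V (vsval l * vsval x) v.
Proof.
apply: mackey_componentE.
- by have [] := hopf_subalg_gp char0 lam1 degG M.
- by have [] := hopf_subalg_gp char0 lam1 degG N.
rewrite (conj_sub_gp char0 lam1 degG intL) (coalg_mul_gp char0 lam1 degG).
apply: subv_trans (gpM char0 lam1 degG _ _) _; apply: gpS.
apply/fintype.subsetP => _ /mulsgP[a b aQ /lcosetP[n nN ->] ->].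
rewrite mem_conjg invgK conjgE in aQ.
by rewrite mem_lcoset !mulgA groupMr // -!mulgA.
Qed.

Lemma btens2_ext (W : vectType k) (F G : @mackey_summand k H (gp M) (gp N) V c -> W) :
  islin F -> islin G ->
  (forall l x v, F (btens _ _ l (btens _ _ x v)) = G (btens _ _ l (btens _ _ x v))) ->
  F =1 G.
Proof.
move=> lF lG FG s; rewrite -(hom_ofE lF) -(hom_ofE lG); move: s.
apply: btens_ext => l w /=; rewrite !hom_ofE.
have [_ br] := btens_bilin (@subv_mulr k H (gp M) (gp M :&: conj_sub c (gp N)))
  (@conj_act k H (gp N) V c (gp M :&: conj_sub c (gp N))).
have l1 := islin_comp lF (br l); have l2 := islin_comp lG (br l).
rewrite -(hom_ofE l1) -(hom_ofE l2); move: w.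
by apply: btens_ext => x v /=; rewrite !hom_ofE.
Qed.

End Component.

Lemma mackey_inv_component (c : irr H) s :
  mackey_inv c (@mackey_component k H (gp M) (gp N) V c s) = s.
Proof.
move: s; apply: (@btens2_ext c _ (fun s => mackey_inv c (mackey_component s)) id).
- exact: (islin_comp (@mackey_inv_lin c) (@mackey_component_lin c)).
- exact: islin_id.
by move=> l x v; rewrite gp_mackey_componentE mackey_inv_same.
Qed.

Lemma mackey_inv_component0 (c d : irr H) s :
  ~ dcoset_rel (gp M) (gp N) (coalg_of c) (coalg_of d) ->
  mackey_inv c (@mackey_component k H (gp M) (gp N) V d s) = 0.
Proof.
move=> ncd; move: s.
apply: (@btens2_ext d _ (fun s => mackey_inv c (mackey_component s)) (fun=> 0)).
- exact: (islin_comp (@mackey_inv_lin c) (@mackey_component_lin d)).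
- by move=> a x y; rewrite scaler0 addr0.
move=> l x v; rewrite gp_mackey_componentE (mackey_inv_other ncd) ?subvsP //.
Qed.

(** Every C_d lies in some product H(M) C_i H(N), so the images of the components contain all pure
    tensors; with surjectivity, the left inverse given by the [mackey_inv] becomes two-sided. *)
Lemma mackey_map_surj (I : finType) (c : I -> irr H) :
  (forall d, exists i, dcoset_rel (gp M) (gp N) (coalg_of d) (coalg_of (c i))) ->
  forall q, exists f, @mackey_map k H (gp M) (gp N) V I c f = q.
Proof.
move=> cov q; pose F i := hom_of (@mackey_component_lin (c i)).
pose W := (\sum_i limg (F i))%VS.
suff : q \in W.
  case/memv_sumP => w wF ->.
  have ex i : exists s, w i = @mackey_component k H (gp M) (gp N) V (c i) s.
    by have /memv_imgP[s _ ->] := wF i isT; exists s; rewrite hom_ofE.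
  pose f i := projT1 (cid (ex i)); have fE i : w i = @mackey_component k H (gp M) (gp N)
    V (c i) (f i) := projT2 (cid (ex i)).
  exists (finfun f : {dffun forall i, mackey_summand (gp M) V (c i)}).
  by apply: eq_bigr => i _; rewrite ffunE -fE.
have tW h v : @ind_tens k H (gp N) V h v \in W.
  have [bl _] := btens_bilin (fun (h : H) (a : subvs_of (gp N)) => h * vsval a)
    (fun a v => lmod_act V a v).
  suff : h \in (hom_of (bl v) @^-1: W)%VS by rewrite -memv_preim hom_ofE.
  rewrite (irr_full char0 lam1 (U := (hom_of (bl v) @^-1: W)%VS)) ?memvf // => d.
  have [i di] := cov d; apply: subv_trans di _; rewrite -prodvA.
  apply/prodvP => l x lM xC; rewrite -memv_preim hom_ofE.
  apply: (subvP (sumv_sup i _ (subvv _))) => //; apply/memv_imgP.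
  exists (btens _ _ (vsproj (gp M) l) (btens _ _ (vsproj (coalg_of (c i) * gp N) x) v)).
    exact: memvf.
  by rewrite hom_ofE gp_mackey_componentE !vsprojK.
(* Pure tensors span: a functional vanishing on [W] agrees with 0 on them, hence everywhere. *)
apply/contraT => /dual_sep[p [pW]].
pose z : 'Hom(@induced k H (gp N) V, k^o) := 0.
have -> : p q = z q.
  by apply: btens_ext => h v; rewrite /= /z lfunE /= pW ?tW.
by rewrite /z lfunE /= eqxx.
Qed.

Lemma mackey_bijective (I : finType) (c : I -> irr H) :
  dcoset_reps (gp M) (gp N) c -> bijective (@mackey_map k H (gp M) (gp N) V I c).
Proof.
move=> [cov uniqc].
pose G q : {dffun forall i, mackey_summand (gp M) V (c i)} :=
  finfun (fun i => mackey_inv (c i) q).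
have GK : cancel (@mackey_map k H (gp M) (gp N) V I c) G.
  move=> f; apply/ffunP => i; rewrite ffunE /mackey_map.
  rewrite (islin_big _ _ _ (@mackey_inv_lin (c i))) (bigD1 i) //= mackey_inv_component.
  rewrite big1 ?addr0 // => j ji; apply: mackey_inv_component0 => /uniqc ij.
  by rewrite ij eqxx in ji.
exists G => // q; have [f <-] := mackey_map_surj cov q.
by rewrite GK.
Qed.

End Mackey.

Theorem theorem60 (k : closedFieldType) (k_char0 : [pchar k] =i pred0)
    (H : hopfType k) (ssH : semisimple H) (gT : finGroupType)
    (deg : irr H -> gT) (degG : is_grading deg) (M N : {group gT}) :
  mackey_pair (graded_part deg M) (graded_part deg N).
Proof.
have lam1 := lam1_neq0 k_char0 ssH.
have [L intL] := is_integral_fullv ssH.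
split=> [||I c reps V].
- exact: (hopf_subalg_gp k_char0 lam1 degG M).
- exact: (hopf_subalg_gp k_char0 lam1 degG N).
- exact: (mackey_bijective k_char0 lam1 intL degG).
Qed.
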